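(* Let $r \geq 0$ be an integer, let $\rho$ be a real number with $r < \rho < r+1$, and let $f : \mathbb{T} \to \mathbb{R}$ be a continuous function. Define the set $$\mathcal{B}_r(f) = \bigcap_{a_0, \dots, a_r \in \mathbb{R}} \sigma_{\mathrm{ac}}\Big( f\Big( \sum_{j=0}^{r} a_j n^j \Big) \Big),$$ where $f(\sum_{j=0}^{r} a_j n^j)$ stands for the potential $n \mapsto f(\sum_{j=0}^{r} a_j n^j)$ on $\mathbb{N}$. Then for every real $\alpha \neq 0$ and every $\theta \in \mathbb{R}$, $$\sigma_{\mathrm{ac}}\big( f(\alpha n^{\rho} + \theta) \big) \subseteq \mathcal{B}_r(f),$$ where $f(\alpha n^{\rho} + \theta)$ stands for the potential $n \mapsto f(\alpha n^{\rho} + \theta)$ on $\mathbb{N}$.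
   Context: $\mathbb{N} = \{1, 2, 3, \dots\}$ and $\mathbb{T} = \mathbb{R}/\mathbb{Z}$ is the circle; for real $t$, $f(t)$ means $f$ evaluated at the class of $t$ modulo $1$. For a bounded sequence $V : \mathbb{N} \to \mathbb{R}$, the Schrödinger operator $H_V$ on $\ell^2(\mathbb{N})$ is defined for $u \in \ell^2(\mathbb{N})$ by $$(H_V u)(n) = u(n+1) + u(n-1) + V(n) u(n) \quad (n \geq 2), \qquad (H_V u)(1) = u(2) + V(1) u(1).$$ $\sigma_{\mathrm{ac}}(V)$ denotes the absolutely continuous spectrum of the bounded self-adjoint operator $H_V$. *)

(* Defs.v *)
From HB Require Import structures.
From mathcomp Require Import all_boot all_order all_algebra.
From mathcomp Require Import complex.
From mathcomp Require Import all_classical all_reals all_analysis.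

Set Implicit Arguments.
Unset Strict Implicit.
Unset Printing Implicit Defensive.

Import Order.TTheory GRing.Theory Num.Theory.
Import numFieldNormedType.Exports.

Local Open Scope classical_set_scope.
Local Open Scope complex_scope.
Local Open Scope ring_scope.

Section Circle.
Local Open Scope quotient_scope.
Variable R : realType.

Definition eq_mod1 (x y : R) : bool := x - y \is a Num.int.

Lemma eq_mod1_refl : reflexive eq_mod1.
Proof. by move=> x; rewrite /eq_mod1 subrr. Qed.

Lemma eq_mod1_sym : symmetric eq_mod1.
Proof. by move=> x y; rewrite /eq_mod1 -(opprB y x) rpredN. Qed.

Lemma eq_mod1_trans : transitive eq_mod1.
Proof.
move=> y x z; rewrite /eq_mod1 => xy yz.
by rewrite -(subrKA y) rpredD.
Qed.

Canonical eq_mod1_equiv :=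
  EquivRel eq_mod1 eq_mod1_refl eq_mod1_sym eq_mod1_trans.

Definition circle : Type := quotient_topology {eq_quot eq_mod1_equiv}.
Definition to_circle (t : R) : circle := \pi_circle t.

End Circle.

Section SpectralTheory.
Variable R : realType.
Local Notation C := R[i].

(* A sequence u : nat -> C stands for the vector n |-> u (n - 1) indexed by
   n = 1, 2, 3, ... *)
Definition l2 : set (nat -> C) :=
  [set u | cvgn (series (fun k => Normc.normc (u k) ^+ 2))].

Definition l2norm (u : nat -> C) : R :=
  Num.sqrt (limn (series (fun k => Normc.normc (u k) ^+ 2))).

Definition l2dot (u v : nat -> C) : C :=
  (limn (series (fun k => complex.Re (u k * conjc (v k))))) +i*
  (limn (series (fun k => complex.Im (u k * conjc (v k))))).

(* Operators are given by functions on all sequences; only their values on l2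
   matter below. *)
Definition operator := (nat -> C) -> (nat -> C).

Definition shift_op (A : operator) (z : C) : operator :=
  fun u k => A u k - z * u k.

(* The spectrum of the restriction of A to an A-invariant subspace M: the z for
   which A - z has no bounded two-sided inverse on M. It is empty for M = 0. *)
Definition spectrum_on (M : set (nat -> C)) (A : operator) : set C :=
  [set z | ~ exists T : operator,
     [/\ forall u, M u -> M (T u),
         forall u, M u -> T (shift_op A z u) = u,
         forall u, M u -> shift_op A z (T u) = u
       & exists c : R, forall u, M u -> l2norm (T u) <= c * l2norm u]].

(* For A bounded self-adjoint, mu is the spectral measure of A at u: the
   compactly supported Borel measure such that <p(A) u, u> is the integral of p
   for every polynomial p (by linearity it suffices to take p = X^k). Since
   polynomials are dense in the continuous functions on a compact set, mu is
   unique and the same identity holds for the continuous functional calculus. *)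
Definition spectral_measure (A : operator) (u : nat -> C)
    (mu : {finite_measure set (measurableTypeR R) -> \bar R}) : Prop :=
  (exists M : R, mu (~` `[- M, M]) = 0%E) /\
  forall k : nat,
    l2dot (iter k A u) u =
    (Rintegral mu setT (fun x : measurableTypeR R => (x : R) ^+ k))%:C.

Definition ac_subspace (A : operator) : set (nat -> C) :=
  [set u | l2 u /\
     exists mu : {finite_measure set (measurableTypeR R) -> \bar R},
       spectral_measure A u mu /\ mu `<< (@lebesgue_measure R)].

Definition ac_spectrum (A : operator) : set C :=
  spectrum_on (ac_subspace A) A.

(* V is indexed by n = 1, 2, 3, ... (V 0 is not used), so index k of a sequence
   corresponds to the site n = k + 1. *)
Definition schrodinger (V : nat -> R) : operator := fun u k =>
  if k is k'.+1 then u k.+1 + u k' + (V k.+1)%:C * u k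
  else u 1%N + (V 1%N)%:C * u 0%N.

Definition sigma_ac (V : nat -> R) : set C := ac_spectrum (schrodinger V).

Definition B_set (r : nat) (f : circle R -> R) : set C :=
  \bigcap_(a in [set: 'I_r.+1 -> R])
    sigma_ac (fun n => f (to_circle (\sum_(j < r.+1) a j * n%:R ^+ j))).

End SpectralTheory.

(* Main.v *)
(* Say that W is a right limit of V when, along suitable n, the values
   V (n + 1), ..., V (n + N) come as close as wanted to W 1, ..., W N.

   If W is a right limit of V, then the ac spectrum of V is contained in that of
   W. Let p_n be the orthonormal polynomials of H_V at the first site, q_n the
   second solution of the recurrence, and mu the spectral measure. Where
   mu >= delta * Lebesgue, Markov's inequality bounds p_n in Lebesgue measure;
   Boole's bound on |{t < \sum_i w_i / (x - x_i)}| bounds q_n / p_n. Hence the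
   orthonormal polynomials of all shifts of V, and then those of W, are bounded
   in measure, uniformly in n, on a set S of positive measure. If the spectral
   measure nu of W vanished on a compact K in S with |K| > 0, some polynomial
   G >= 1 on K would have small norm in L^2(nu), and Boole's bound for G / p_n
   would force |K| to be small. So nu charges every such K. Taking S near z,
   and K such that nu << Lebesgue on K, gives ac vectors of H_W spectrally
   localised near z, which excludes a bounded inverse of H_W - z.

   It remains to see every polynomial p of degree at most r as a limit modulo 1
   of windows of g n = alpha n^rho + theta. By Newton's formula it suffices that
   the differences D^j g n, j <= r, approach given targets modulo 1, since
   D^(r+1) g tends to 0. As D^r g tends to infinity with increments tending to 0,
   it turns slowly around the circle. Descending in j along an arithmetic
   progression, D^(j+1) g minus its target stays for a long time in a window
   [delta/2, delta] modulo 1, so D^j g drifts slowly in one direction and in turn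
   stays for a long time in any prescribed window. *)

Require Import Defs.
From mathcomp Require Import all_boot all_order all_algebra.
From mathcomp Require Import complex.
From mathcomp Require Import all_classical all_reals all_analysis.
From HB Require Import structures.
From mathcomp Require Import separable measurable_realfun.
From mathcomp Require polyrcf.
From mathcomp Require Import ring lra zify.
Set Implicit Arguments.
Unset Strict Implicit.
Unset Printing Implicit Defensive.
Import Order.TTheory GRing.Theory Num.Theory.
Import numFieldNormedType.Exports.
Local Open Scope classical_set_scope.
Local Open Scope ring_scope.

(** * Lipschitz functions and polynomials *)

(** The spectrum is defined by inverses on the ac subspace, so the inclusion is argued with norms,
    for real and complex z alike. An inverse for W with constant c forbids nonzero ac vectors v of
    H_W with |(H_W - z) v| <= |v| / (2 c). If some ac vector of H_V charges the disc of radius about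
    1 / (2 c) around z, such a v exists; if none does, H_V - z is inverted by (H_V - conj z) h(H_V),
    where h is |x - z|^-2 cut off near z.

    Boole's bound gives the uniformity: for a sum of w_i / (x - x_i) with positive weights it
    depends on the total mass only, not on the number or the position of the poles. The poles are
    Gauss nodes and the weights of Q_n / P_n have mass 1, whatever n is.

    In the arithmetic part the obstacle is that the targets of the higher differences enter the
    increments of the lower ones. They are replaced by rationals of denominator q, and the
    progression has step Q = q r!: the binomials C(Q, l) with 1 <= l <= r are multiples of q, so the
    targets vanish modulo 1. *)

Section Bernstein.
Variable R : realType.

(* De Casteljau's form of \sum_(k <= n) 'C(n, k) * phi k * 'X^k * (1 - 'X)^(n - k). *)
Fixpoint bern (n : nat) (phi : nat -> R) : {poly R} :=
  if n is m.+1 then (1 - 'X) * bern m phi + 'X * bern m (phi \o succn)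
  else (phi 0%N)%:P.

Lemma bernS n phi x : (bern n.+1 phi).[x] =
  (1 - x) * (bern n phi).[x] + x * (bern n (phi \o succn)).[x].
Proof. by rewrite /= !hornerE. Qed.

(** Each de Casteljau step is a convex combination on [0, 1], so the Bernstein operator is positive;
    this is positivity in the form of an error bound. *)
Lemma bern_dist n phi psi c x : 0 <= x <= 1 ->
  (forall k, `|phi k - c| <= psi k) -> `|(bern n phi).[x] - c| <= (bern n psi).[x].
Proof.
move=> /andP[x0 x1]; elim: n phi psi => [|n IH] phi psi h; first by rewrite /= !hornerC.
rewrite !bernS.
have h1 := IH _ _ h.
have h2 := IH (phi \o succn) (psi \o succn) (fun k => h k.+1).
set A := (bern n phi).[x] in h1 *; set B := (bern n (phi \o succn)).[x] in h2 *.
rewrite (_ : _ - c = (1 - x) * (A - c) + x * (B - c)); last by ring.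
apply: (le_trans (ler_normD _ _)); rewrite !normrM (ger0_norm x0) ger0_norm ?subr_ge0//.
by apply: lerD; apply: ler_wpM2l; rewrite ?subr_ge0.
Qed.

Lemma bern_affine n a c phi x :
  (bern n (fun k => a + c * phi k)).[x] = a + c * (bern n phi).[x].
Proof.
elim: n phi => [|n IH] phi; first by rewrite /= !hornerC.
rewrite !bernS IH; have -> : (fun k => a + c * phi k) \o succn =
  fun k => a + c * (phi \o succn) k by [].
by rewrite IH; ring.
Qed.

(** The binomial variance plus the square of the mean. The offset c is left free because shifting
    the samples turns c into 1 + c in the induction. *)
Lemma bern_sqr n c x :
  (bern n (fun k => (k%:R + c) ^+ 2)).[x] =
  n%:R * x * (1 - x) + (n%:R * x + c) ^+ 2.
Proof.
elim: n c => [|n IH] c; first by rewrite /= !hornerC; ring.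
rewrite bernS IH; have -> : (fun k => (k%:R + c) ^+ 2) \o succn =
  fun k => (k%:R + (1 + c)) ^+ 2 :> R.
  by apply/funext => k /=; rewrite -addn1 natrD; ring.
by rewrite IH -(addn1 n) natrD; ring.
Qed.

(** The inequality a <= d / 2 + a^2 / (2 d) replaces L |k / n - x| by an affine function of (k / n -
    x)^2, whose Bernstein polynomial is explicit. As n > d^-2, the constant and the variance term
    cost at most L d / 2 each, and L d <= e. *)
Lemma lipschitz_weierstrass01 (f : R -> R) (L e : R) : 0 < e ->
  (forall x y, `|f x - f y| <= L * `|x - y|) ->
  exists P : {poly R}, forall x, 0 <= x <= 1 -> `|P.[x] - f x| <= e.
Proof.
move=> e0 hf.
have L0 : 0 <= L by have := hf 1 0; rewrite subr0 normr1 mulr1; apply: le_trans.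
pose d := e / (L + 1).
have d0 : 0 < d by rewrite divr_gt0// ltr_wpDl.
have [n hn] : exists n : nat, d ^- 2 < n%:R.
  by exists (Num.trunc (d ^- 2)).+1; exact: truncnS_gt.
have n0 : 0 < n%:R :> R by apply: le_lt_trans hn; rewrite invr_ge0 exprn_ge0// ltW.
exists (bern n (fun k => f (k%:R / n%:R))) => x x01.
pose c := L / (2 * d) / n%:R ^+ 2.
have h k : `|f (k%:R / n%:R) - f x| <= L * d / 2 + c * (k%:R + - (n%:R * x)) ^+ 2.
  apply: (le_trans (hf _ _)).
  have -> : L * d / 2 + c * (k%:R + - (n%:R * x)) ^+ 2 =
    L * (d / 2 + (k%:R / n%:R - x) ^+ 2 / (2 * d)).
    rewrite /c; field; by rewrite !gt_eqF.
  apply: ler_wpM2l => //.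
  set y := k%:R / n%:R - x.
  rewrite -real_normK ?num_real//; set a := `|y|.
  have -> : d / 2 + a ^+ 2 / (2 * d) = a + (a - d) ^+ 2 / (2 * d).
    by field; rewrite gt_eqF.
  by rewrite lerDl divr_ge0 ?sqr_ge0// mulr_ge0// ltW.
apply: (le_trans (bern_dist _ x01 h)).
rewrite bern_affine bern_sqr subrr expr0n addr0.
have hx : x * (1 - x) <= 1 by move: x01; nra.
have hc : c * (n%:R * x * (1 - x)) <= L * d / 2.
  rewrite /c -(mulrA n%:R).
  have -> : L / (2 * d) / n%:R ^+ 2 * (n%:R * (x * (1 - x))) =
    (L * d / 2) * ((d ^- 2 / n%:R) * (x * (1 - x))) by field; rewrite !gt_eqF.
  apply: ler_piMr; first by rewrite divr_ge0// mulr_ge0// ltW.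
  have h0 : 0 <= d ^- 2 / n%:R <= 1.
    by rewrite ler_pdivrMr// mul1r (ltW hn) divr_ge0 ?invr_ge0 ?exprn_ge0// ltW.
  have h1 : 0 <= x * (1 - x) by move: x01; nra.
  by move: h0; nra.
have : L * d <= e.
  by rewrite /d mulrCA ler_piMr ?ltW// ltr_pdivrMr ?ltr_wpDl// mul1r ltrDl.
by move: hc; lra.
Qed.

Lemma lipschitz_weierstrass (f : R -> R) (L M e : R) : 0 < M -> 0 < e ->
  (forall x y, `|f x - f y| <= L * `|x - y|) ->
  exists P : {poly R}, forall x, `|x| <= M -> `|P.[x] - f x| <= e.
Proof.
move=> M0 e0 hf.
have [|P hP] := @lipschitz_weierstrass01 (fun x => f (2 * M * x - M)) (L * (2 * M)) e e0.
  move=> x y; apply: (le_trans (hf _ _)); rewrite -[leRHS]mulrA.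
  rewrite (_ : _ - M - _ = 2 * M * (x - y)); last by ring.
  have M2 : 0 <= 2 * M by rewrite mulr_ge0// ltW.
  by rewrite normrM (ger0_norm M2).
exists (P \Po ((2 * M)^-1 *: ('X + M%:P))) => x; rewrite ler_norml => /andP[x1 x2].
rewrite horner_comp !hornerE.
have hM : 0 < 2 * M by rewrite mulr_gt0.
have := hP ((2 * M)^-1 * (x + M)).
rewrite mulVKf ?gt_eqF// addrK; apply.
rewrite mulr_ge0 ?invr_ge0 ?(ltW hM)//=; last by lra.
by rewrite [leLHS]mulrC ler_pdivrMr//; lra.
Qed.

End Bernstein.

(** * Orthogonal polynomials and Gauss quadrature *)

Section Recurrence.
Variable A : comNzRingType.
Implicit Types (c : nat -> A) (s : A * A).

(* The transfer matrices of u (k + 1) + u (k - 1) + b k * u k = z * u k, where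
   c k = z - b k and the state is the pair (u k, u (k - 1)). *)
Fixpoint sol c s n : A * A :=
  if n is m.+1 then let t := sol c s m in (c m * t.1 - t.2, t.1) else s.

Lemma sol_wronskian c s t n :
  (sol c s n).1 * (sol c t n).2 - (sol c s n).2 * (sol c t n).1 =
  s.1 * t.2 - s.2 * t.1.
Proof. by elim: n => //= n <-; ring. Qed.

Lemma sol_lin c (a b : A) s t n :
  sol c (a * s.1 + b * t.1, a * s.2 + b * t.2) n =
  (a * (sol c s n).1 + b * (sol c t n).1, a * (sol c s n).2 + b * (sol c t n).2).
Proof. by elim: n => //= n ->/=; congr (_, _); ring. Qed.

Lemma sol_shift c s m n : sol (fun k => c (m + k)%N) (sol c s m) n = sol c s (m + n).
Proof. by elim: n => [|n IH]; rewrite ?addn0// addnS /= IH. Qed.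

Definition pA c := sol c (1, 0).
(** The value -1 at index -1 makes q_1 = 1, so that Q n / P n has positive residues. *)
Definition qA c := sol c (0, -1).

(** The initial state (1, 0) of the shifted recurrence is expanded in the states of p and q at index
    m, which form a basis since their Wronskian is -1. *)
Lemma pA_shift c m n : (pA (fun k => c (m + k)%N) n).1 =
  (pA c m).2 * (qA c (m + n)).1 - (qA c m).2 * (pA c (m + n)).1.
Proof.
have := sol_wronskian c (1, 0) (0, -1) m; rewrite /= mul0r subr0 mul1r => h.
rewrite /pA /qA -!sol_shift.
set s := sol c (1, 0) m in h *; set t := sol c (0, -1) m in h *.
have e : (1, 0) = ((- t.2) * s.1 + s.2 * t.1, (- t.2) * s.2 + s.2 * t.2) :> A * A.
  congr (_, _); last by ring.
  have -> : 1 = - (s.1 * t.2 - s.2 * t.1) :> A by rewrite h opprK.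
  by ring.
by rewrite [in LHS]e sol_lin /=; ring.
Qed.

End Recurrence.

Lemma christoffel_darboux (A : comNzRingType) (b : nat -> A) (x y : A) n :
  let p z := pA (fun k => z - b k) in
  (p x n).1 * (p y n).2 - (p x n).2 * (p y n).1 =
  (x - y) * \sum_(k < n) (p x k).1 * (p y k).1.
Proof.
move=> p; elim: n => [|n IH]; first by rewrite big_ord0 /=; ring.
rewrite big_ord_recr [RHS]mulrDr -IH /p /=; ring.
Qed.

Section OP.
Variables (R : realType) (b : nat -> R).

(* Here b k is the potential at the site k + 1; P n are the orthonormal polynomials
   of the operator, Q n the second solution, and Pm n, Qm n stand for index n - 1. *)
Definition opc (k : nat) : {poly R} := 'X - (b k)%:P.
Definition P n : {poly R} := (pA opc n).1.
Definition Pm n : {poly R} := (pA opc n).2.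
Definition Q n : {poly R} := (qA opc n).1.
Definition Qm n : {poly R} := (qA opc n).2.

Lemma P0 : P 0 = 1. Proof. by []. Qed.
Lemma Pm0 : Pm 0 = 0. Proof. by []. Qed.
Lemma PS n : P n.+1 = ('X - (b n)%:P) * P n - Pm n. Proof. by []. Qed.
Lemma PmS n : Pm n.+1 = P n. Proof. by []. Qed.
Lemma QmS n : Qm n.+1 = Q n. Proof. by []. Qed.

Lemma P_monic_size n : P n \is monic /\ size (P n) = n.+1 /\ (size (Pm n) <= n)%N.
Proof.
elim: n => [|n [m [s1 s2]]]; first by rewrite P0 Pm0 monic1 size_poly1 size_poly0.
rewrite PmS s1 PS.
have m' : ('X - (b n)%:P) * P n \is monic by rewrite rpredM// monicXsubC.
have s' : size (('X - (b n)%:P) * P n) = n.+2.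
  by rewrite size_monicM ?monicXsubC ?monic_neq0// size_XsubC s1.
have lt : (size (- Pm n)%R < size (('X - (b n)%:P) * P n)%R)%N.
  by rewrite size_polyN s' (leq_ltn_trans s2)// ltnS leqnSn.
by rewrite size_polyDl// s'; split => //; rewrite monicE lead_coefDl// -monicE.
Qed.

Lemma P_monic n : P n \is monic. Proof. by case: (P_monic_size n). Qed.
Lemma size_P n : size (P n) = n.+1. Proof. by case: (P_monic_size n) => _ []. Qed.

Lemma size_Q n : (size (Q n) <= n)%N.
Proof.
suff : (size (Q n) <= n)%N /\ (size (Qm n) <= n.-1.+1)%N by case.
elim: n => [|n [h1 h2]].
  by rewrite /Q /Qm /= size_poly0 size_polyN size_poly1.
rewrite QmS; split; last exact: leq_trans h1 _.
have -> : Q n.+1 = ('X - (b n)%:P) * Q n - Qm n by [].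
case: n h1 h2 => [|n] h1 h2.
  rewrite [Q 0]/(0 : {poly R}) mulr0 sub0r size_polyN; exact: h2.
apply: (leq_trans (size_polyD _ _)); rewrite size_polyN geq_max; apply/andP; split.
  by apply: (leq_trans (size_polyMleq _ _)); rewrite size_XsubC /=.
exact: leq_trans h2 _.
Qed.

Lemma wronskian n : P n * Qm n - Pm n * Q n = -1.
Proof. by rewrite /P /Pm /Q /Qm sol_wronskian /=; ring. Qed.

(** The confluent form of Christoffel-Darboux, on the diagonal. It shows that the roots of [P n] are
    simple. *)
Lemma deriv_wronskian n : (P n)^`() * Pm n - (Pm n)^`() * P n = \sum_(k < n) P k ^+ 2.
Proof.
elim: n => [|n IH]; first by rewrite big_ord0 P0 Pm0 derivC; ring.
rewrite big_ord_recr /= -IH PmS PS derivB derivM derivXsubC; ring.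
Qed.

Lemma horner_sol s n (x : R) :
  (((sol opc s n).1).[x], ((sol opc s n).2).[x]) =
  sol (fun k => x - b k) ((s.1).[x], (s.2).[x]) n.
Proof. by elim: n => //= n <-/=; rewrite !hornerE. Qed.

Lemma P_cd n x y : (P n).[x] * (Pm n).[y] - (Pm n).[x] * (P n).[y] =
  (x - y) * \sum_(k < n) (P k).[x] * (P k).[y].
Proof.
have e z k : ((P k).[z], (Pm k).[z]) = pA (fun k => z - b k) k.
  by rewrite /P /Pm /pA horner_sol /= !hornerE.
have e1 z k : (P k).[z] = (pA (fun k => z - b k) k).1 by rewrite -e.
have e2 z k : (Pm k).[z] = (pA (fun k => z - b k) k).2 by rewrite -e.
rewrite !e1 !e2 christoffel_darboux; congr (_ * _).
by apply: eq_bigr => k _; rewrite !e1.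
Qed.

Lemma sum_P_gt0 n (x : R) : (0 < n)%N -> 0 < \sum_(k < n) (P k).[x] ^+ 2.
Proof.
case: n => // n _; rewrite big_ord_recl P0 hornerC expr1n.
by rewrite ltr_pwDl// sumr_ge0// => i _; rewrite sqr_ge0.
Qed.

(** Here |x - b n| >= 2, and the recurrence makes |P n x| nondecreasing in n. Hence all Gauss nodes
    lie in [-(B + 2), B + 2]. *)
Lemma P_ge (B x : R) : (forall k, `|b k| <= B) -> B + 2 < `|x| ->
  forall n, `|(Pm n).[x]| <= `|(P n).[x]| /\ 0 < `|(P n).[x]|.
Proof.
move=> hb hx; elim=> [|n [h1 h2]].
  by rewrite P0 Pm0 !hornerE normr0 normr1 ler01 ltr01.
rewrite PmS PS !hornerE.
suff : `|(P n).[x]| <= `|(x - b n) * (P n).[x] - (Pm n).[x]|.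
  by move=> h; split => //; apply: lt_le_trans h.
apply: le_trans (lerB_dist _ _); rewrite normrM.
have h3 : 2 <= `|x - b n|.
  by apply: le_trans (lerB_dist _ _); have := hb n; lra.
by nra.
Qed.

(* Over R[i]: a root z of P n with conjugate root z^* satisfies, by
   Christoffel-Darboux, (z - z^* ) * \sum_(k < n) |P k z|^2 = 0. *)
Lemma P_split n : exists xs : seq R, uniq xs /\ P n = \prod_(x <- xs) ('X - x%:P).
Proof.
case: n => [|n]; first by exists [::]; rewrite big_nil.
pose f := real_complex R.
pose p : {poly R[i]} := map_poly f (P n.+1).
have [r hr] := closed_field_poly_normal p.
have mp : p \is monic by rewrite map_monic P_monic.
rewrite (monicP mp) scale1r in hr.
have real_r z : z \in r -> complex.Im z = 0.
  move=> zr.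
  have rz : root p z by rewrite hr root_prod_XsubC.
  have e (u : R[i]) k : ((map_poly f (P k)).[u], (map_poly f (Pm k)).[u]) =
     pA (fun k => u - f (b k)) k.
    elim: k => [|k IH].
      by rewrite /P /Pm /= rmorph1 rmorph0 hornerC horner0.
    transitivity (let t := pA (fun k => u - f (b k)) k in
      ((u - f (b k)) * t.1 - t.2, t.1)); last by [].
    rewrite -IH /= PmS PS.
    by rewrite rmorphB rmorphM /= rmorphB /= map_polyX map_polyC /= !hornerE.
  have e1 u k : (map_poly f (P k)).[u] = (pA (fun k => u - f (b k)) k).1 by rewrite -e.
  have e2 u k : (map_poly f (Pm k)).[u] = (pA (fun k => u - f (b k)) k).2 by rewrite -e.
  have conj k : (map_poly f (P k)).[conjc z] = conjc (map_poly f (P k)).[z].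
    by rewrite -horner_map /= -map_poly_comp; congr (horner _ _); apply: eq_map_poly => a; apply/eqP; rewrite eq_complex /= oppr0 !eqxx.
  have := christoffel_darboux (fun k => f (b k)) z (conjc z) n.+1.
  lazy zeta; rewrite -!e1 -!e2 conj (eqP rz : (map_poly f (P n.+1)).[z] = 0) conjc0 mul0r mulr0 subrr.
  move/esym/eqP; rewrite mulf_eq0 => /orP[].
    rewrite subr_eq0 => /eqP; case: (z) => a c [] /= /eqP.
    by rewrite -subr_eq0 opprK -mulr2n mulrn_eq0 /= => /eqP.
  have -> : \sum_(k < n.+1) (pA (fun k => z - f (b k)) k).1 *
      (pA (fun k => conjc z - f (b k)) k).1 =
      (\sum_(k < n.+1) (Normc.normc (map_poly f (P k)).[z]) ^+ 2)%:C%C.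
    rewrite rmorph_sum; apply: eq_bigr => k _ /=; rewrite -!e1 conj.
    case: (_.[z]) => a c /=; rewrite sqr_sqrtr ?addr_ge0 ?sqr_ge0//.
    by apply/eqP; rewrite eq_complex /=; apply/andP; split; apply/eqP; ring.
  move=> /eqP[] /eqP; rewrite big_ord_recl P0 rmorph1 hornerC Normc.normc1 expr1n.
  by rewrite gt_eqF// ltr_pwDl// sumr_ge0// => i _; rewrite sqr_ge0.
pose xs := map (@complex.Re R) r.
have hxs : P n.+1 = \prod_(x <- xs) ('X - x%:P).
  apply: (map_poly_inj f); rewrite -/p hr rmorph_prod big_map.
  apply: eq_big_seq => z zr /=; rewrite map_polyXsubC; congr ('X - _%:P).
  by have := real_r _ zr; case: (z) => a c /= ->.
exists xs; split => //.
(* At a double root the left side of [deriv_wronskian] vanishes, while the right side is a positive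
   sum of squares. *)
have : separable_poly (P n.+1).
  rewrite unlock [X in coprimep X _]hxs.
  have : all (fun x => ~~ root (P n.+1)^`() x) xs.
    apply/allP => x xx; apply/negP => /eqP dx.
    have px : (P n.+1).[x] = 0 by apply/eqP; rewrite -/(root _ _) hxs root_prod_XsubC.
    have := congr1 (fun q => q.[x]) (deriv_wronskian n.+1).
    have gen (p1 p2 p3 p4 : {poly R}) :
      (p1 * p2 - p3 * p4).[x] = p1.[x] * p2.[x] - p3.[x] * p4.[x] by rewrite !hornerE.
    rewrite gen dx px mul0r mulr0 subrr => /esym/eqP.
    rewrite horner_sum; under eq_bigr do rewrite horner_exp.
    by rewrite gt_eqF// sum_P_gt0.
  elim: (xs) => [|x l IH] /=; first by rewrite big_nil coprime1p.
  by move=> /andP[h1 h2]; rewrite big_cons coprimepMl IH// andbT coprimep_sym coprimep_XsubC.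
by rewrite hxs separable_prod_XsubC.
Qed.

End OP.

(** * Gauss quadrature and partial fractions at its nodes *)

Section Quadrature.
Variables (R : realType) (b : nat -> R).
Local Notation P := (P b).
Local Notation Pm := (Pm b).
Local Notation Q := (Q b).

Lemma P_basis n (G : {poly R}) : (size G <= n)%N ->
  exists c : nat -> R, G = \sum_(k < n) c k *: P k.
Proof.
elim: n G => [|n IH] G sG.
  by exists (fun=> 0); rewrite big_ord0; apply/eqP; rewrite -size_poly_eq0 -leqn0.
have [|c hc] := IH (G - G`_n *: P n).
  apply/leq_sizeP => j; rewrite leq_eqVlt coefB coefZ => /orP[/eqP <-|nj].
    have := P_monic b n; rewrite monicE lead_coefE size_P /= => /eqP ->.
    by rewrite mulr1 subrr.
  have -> : G`_j = 0 by rewrite nth_default// (leq_trans sG).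
  have -> : (P n)`_j = 0 by rewrite nth_default// size_P.
  by rewrite mulr0 subrr.
exists (fun k => if k == n then G`_n else c k).
rewrite big_ord_recr /= eqxx -[LHS](subrK (G`_n *: P n)) hc; congr (_ + _).
by apply: eq_bigr => i _; rewrite ltn_eqF.
Qed.

Definition nodes n : seq R := projT1 (cid (P_split b n)).

Lemma nodes_uniq n : uniq (nodes n).
Proof. by rewrite /nodes; case: cid => ? []. Qed.

Lemma P_prod n : P n = \prod_(x <- nodes n) ('X - x%:P).
Proof. by rewrite /nodes; case: cid => ? []. Qed.

Lemma size_nodes n : size (nodes n) = n.
Proof. by have := size_P b n; rewrite P_prod size_prod_XsubC => -[]. Qed.

Lemma mem_nodes n x : (x \in nodes n) = ((P n).[x] == 0).
Proof. by rewrite P_prod -rootE root_prod_XsubC. Qed.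

Lemma nodesP n x : x \in nodes n -> (P n).[x] = 0.
Proof. by rewrite mem_nodes => /eqP. Qed.

Lemma nodes_bound B n x : (forall k, `|b k| <= B) -> x \in nodes n -> `|x| <= B + 2.
Proof.
move=> hb /nodesP px; rewrite leNgt; apply/negP => /(P_ge hb) /(_ n)[_].
by rewrite px normr0 ltxx.
Qed.

(** The Christoffel numbers, that is, the weights of the Gauss quadrature with n nodes. *)
Definition wt n (x : R) : R := (\sum_(k < n) (P k).[x] ^+ 2)^-1.

Lemma wt_gt0 n x : (0 < n)%N -> 0 < wt n x.
Proof. by move=> n0; rewrite invr_gt0 sum_P_gt0. Qed.

Lemma wt_ge0 n x : 0 <= wt n x.
Proof. by rewrite invr_ge0 sumr_ge0// => i _; rewrite sqr_ge0. Qed.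

(** The square matrix with entries sqrt(wt x) P_k(x), rows indexed by nodes and columns by degrees,
    has orthonormal rows by Christoffel-Darboux at pairs of nodes. Hence its columns are orthonormal
    too. *)
Lemma gauss_orth n j k : (j < n)%N -> (k < n)%N ->
  \sum_(x <- nodes n) wt n x * ((P j).[x] * (P k).[x]) = (j == k)%:R.
Proof.
move=> jn kn.
pose x (i : 'I_n) := nth 0 (nodes n) i.
pose O : 'M[R]_n := \matrix_(i, k) (Num.sqrt (wt n (x i)) * (P k).[x i]).
have n0 : (0 < n)%N by case: n jn {kn x O}.
have OO : O *m O^T = 1%:M.
  apply/matrixP => i l; rewrite !mxE.
  under eq_bigr do rewrite !mxE mulrACA.
  rewrite -mulr_sumr.
  have [->|il] := eqVneq i l.
    rewrite -expr2 sqr_sqrtr ?wt_ge0//.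
    under eq_bigr do rewrite -expr2.
    by rewrite mulVf// gt_eqF// sum_P_gt0.
  have xin m : (P n).[x m] = 0 by apply: nodesP; rewrite mem_nth// size_nodes.
  have := P_cd b n (x i) (x l); rewrite !xin mul0r mulr0 subrr => /esym/eqP.
  rewrite mulf_eq0 subr_eq0 nth_uniq ?size_nodes ?nodes_uniq// -[(_ == _ :> nat)]/(i == l).
  by rewrite (negPf il) /= => /eqP ->; rewrite mulr0.
have /matrixP /(_ (Ordinal jn) (Ordinal kn)) := mulmx1C OO.
rewrite !mxE -[in X in _ = X](inj_eq val_inj) /= => <-.
rewrite (big_nth 0) size_nodes big_mkord; apply: eq_bigr => i _.
rewrite !mxE mulrACA -expr2 sqr_sqrtr ?wt_ge0//.
Qed.

Definition quad n (G : {poly R}) : R := \sum_(x <- nodes n) wt n x * G.[x].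

Lemma quad_coef0 n (c : nat -> R) m : (m <= n)%N -> (0 < n)%N ->
  quad n (\sum_(k < m) c k *: P k) = \sum_(k < m) c k * (0%N == k)%:R.
Proof.
move=> mn n0; rewrite /quad.
transitivity (\sum_(x <- nodes n) \sum_(k < m)
   c k * (wt n x * ((P 0).[x] * (P k).[x]))).
  apply: eq_bigr => x _; rewrite horner_sum mulr_sumr; apply: eq_bigr => k _.
  by rewrite hornerZ P0 hornerC; ring.
rewrite exchange_big; apply: eq_bigr => k _ /=.
by rewrite -mulr_sumr gauss_orth// (leq_trans _ mn).
Qed.

(** Both sides are the coefficient of [P 0] in the expansion of G. The quadratures are thus
    consistent and determine the moments of the spectral measure. *)
Lemma quad_stable n n' (G : {poly R}) : (size G <= n)%N -> (0 < n)%N ->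
  (n <= n')%N -> quad n' G = quad n G.
Proof.
move=> sG n0 nn'; have [c ->] := P_basis sG.
by rewrite !quad_coef0// (leq_trans n0 nn').
Qed.

Lemma quad1 n : (0 < n)%N -> \sum_(x <- nodes n) wt n x = 1.
Proof.
move=> n0; have := gauss_orth n0 n0; rewrite eqxx -[true%:R]/(1 : R) => <-.
by apply: eq_bigr => x _; rewrite P0 hornerC !mulr1.
Qed.

(** Partial fractions of G / P n. The residue G(x) / P_n'(x) appears as [wt n x] Pm(x) G(x), because
    P_n'(x) Pm(x) is the inverse of the weight at a node. The proof expands G by [gauss_orth] and
    sums the kernel by Christoffel-Darboux. *)
Lemma lagrange_nodes n (G : {poly R}) u : (size G <= n)%N -> u \notin nodes n ->
  G.[u] / (P n).[u] =
  \sum_(x <- nodes n) wt n x * (Pm n).[x] * G.[x] / (u - x).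
Proof.
move=> sG un; have pu : (P n).[u] != 0 by rewrite -mem_nodes.
apply: (mulIf pu); rewrite mulfVK// mulr_suml.
have [c hc] := P_basis sG.
transitivity (\sum_(x <- nodes n) \sum_(j < n) \sum_(k < n)
   (c j * (P k).[u]) * (wt n x * ((P j).[x] * (P k).[x]))).
  rewrite exchange_big [in LHS]hc horner_sum /=; apply: eq_bigr => j _.
  rewrite exchange_big /= hornerZ.
  transitivity (\sum_(k < n) c j * (P k).[u] * (j == k)%:R).
    rewrite (bigD1 j)//= eqxx mulr1 big1 ?addr0// => k kj.
    by rewrite eq_sym (negPf kj) mulr0.
  by apply: eq_bigr => k _; rewrite -mulr_sumr gauss_orth.
apply: eq_big_seq => x xn.
have ux : u - x != 0 by rewrite subr_eq0; apply: contraNneq un => ->.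
have := P_cd b n u x; rewrite (nodesP xn) mulr0 subr0 => h.
have -> : wt n x * (Pm n).[x] * G.[x] / (u - x) * (P n).[u] =
  wt n x * G.[x] * ((P n).[u] * (Pm n).[x]) / (u - x) by ring.
rewrite h; set S := \sum_(k < n) (P k).[u] * (P k).[x].
have -> : wt n x * G.[x] * ((u - x) * S) / (u - x) = wt n x * G.[x] * S by field.
have -> : G.[x] = \sum_(j < n) c j * (P j).[x].
  by rewrite [in LHS]hc horner_sum; apply: eq_bigr => j _; rewrite hornerZ.
rewrite [wt n x * _]mulr_sumr mulr_suml; apply: eq_bigr => j _.
by rewrite mulr_sumr; apply: eq_bigr => k _; ring.
Qed.

(** At a node the Wronskian reduces to Pm Q = 1, so the residues of Q / P are the weights
    themselves. *)
Lemma lagrange_nodesQ n u : u \notin nodes n ->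
  (Q n).[u] / (P n).[u] = \sum_(x <- nodes n) wt n x / (u - x).
Proof.
move=> un; rewrite (lagrange_nodes (size_Q b n) un); apply: eq_big_seq => x xn.
congr (_ / _); rewrite -mulrA.
have gen (p1 p2 p3 p4 : {poly R}) :
  (p1 * p2 - p3 * p4).[x] = p1.[x] * p2.[x] - p3.[x] * p4.[x] by rewrite !hornerE.
have := congr1 (fun q => q.[x]) (wronskian b n).
rewrite gen (nodesP xn) mul0r sub0r hornerN hornerC => /oppr_inj ->.
by rewrite mulr1.
Qed.

End Quadrature.

(** * Boole's inequality *)

Section Boole.
Variable R : realType.
Implicit Types (w : R -> R) (s : seq R).

(* The polynomial whose roots are the solutions of
   \sum_(x <- s) w x / (u - x) = 1. *)
Definition boole_poly w s : {poly R} :=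
  \prod_(x <- s) ('X - x%:P) - \sum_(x <- s) w x *: \prod_(z <- s | z != x) ('X - z%:P).

Lemma size_filter_neq s x : uniq s -> x \in s ->
  size [seq z <- s | z != x] = (size s).-1.
Proof.
move=> us xs; rewrite size_filter; have := count_predC (pred1 x) s.
by rewrite (count_uniq_mem _ us) xs add1n => <-.
Qed.

Lemma size_boole_sum w s : uniq s ->
  (size (\sum_(x <- s) w x *: \prod_(z <- s | z != x) ('X - z%:P))%R <= size s)%N.
Proof.
move=> us; rewrite big_seq; apply: (big_ind (fun p : {poly R} => (size p <= size s)%N)).
- by rewrite size_poly0.
- by move=> p q hp hq; apply: leq_trans (size_polyD _ _) _; rewrite geq_max hp.
move=> x xs; apply: leq_trans (size_scale_leq _ _) _.
rewrite -big_filter size_prod_XsubC size_filter_neq//.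
by case: (s) xs.
Qed.

Lemma coef_boole_sum w s : uniq s ->
  (\sum_(x <- s) w x *: \prod_(z <- s | z != x) ('X - z%:P))`_(size s).-1 =
  \sum_(x <- s) w x.
Proof.
move=> us; rewrite coef_sum; apply: eq_big_seq => x xs.
rewrite coefZ -big_filter.
have := monic_prod_XsubC [seq z <- s | z != x] xpredT id.
by rewrite monicE lead_coefE size_prod_XsubC /= size_filter_neq// => /eqP ->; rewrite mulr1.
Qed.

Lemma boole_poly_at w s x : uniq s -> x \in s ->
  (boole_poly w s).[x] = - (w x * \prod_(z <- s | z != x) (x - z)).
Proof.
move=> us xs; rewrite /boole_poly hornerD hornerN.
have /eqP -> : root (\prod_(x <- s) ('X - x%:P)) x by rewrite root_prod_XsubC.
rewrite sub0r horner_sum (bigD1_seq x)//= [X in _ + X]big1 ?addr0.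
  rewrite hornerZ horner_prod; congr (- (_ * _)).
  by apply: eq_bigr => z _; rewrite hornerXsubC.
move=> y yx; rewrite hornerZ horner_prod; apply/eqP; rewrite mulf_eq0 prodf_seq_eq0.
by apply/orP; right; apply/hasP; exists x => //; rewrite eq_sym yx hornerXsubC subrr /=.
Qed.

Lemma boole_poly_off w s u : uniq s -> u \notin s ->
  (boole_poly w s).[u] = (1 - \sum_(x <- s) w x / (u - x)) * \prod_(x <- s) (u - x).
Proof.
move=> us uns; rewrite /boole_poly hornerD hornerN horner_prod mulrBl mul1r.
congr (_ - _); first by apply: eq_bigr => z _; rewrite hornerXsubC.
rewrite horner_sum mulr_suml; apply: eq_big_seq => x xs.
rewrite hornerZ horner_prod [in RHS](bigD1_seq x)//= mulrA divfK; last first.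
  by rewrite subr_eq0; apply: contraNneq uns => ->.
by congr (_ * _); apply: eq_bigr => z _; rewrite hornerXsubC.
Qed.

Lemma boole_poly_monic w s : uniq s ->
  size (boole_poly w s) = (size s).+1 /\ boole_poly w s \is monic.
Proof.
move=> us.
have lt : (size (- \sum_(x <- s) w x *: \prod_(z <- s | z != x) ('X - z%:P))%R
   < size (\prod_(x <- s) ('X - x%:P))%R)%N.
  by rewrite size_polyN size_prod_XsubC ltnS size_boole_sum.
split; first by rewrite size_polyDl// size_prod_XsubC.
by rewrite monicE lead_coefDl// -monicE monic_prod_XsubC.
Qed.

(* The roots y_i interlace with s, and Vieta's formula gives
   \sum_i (y_i - s_i) = \sum_x w x. *)
Lemma boole_sorted w s : sorted <%R s -> (forall x, x \in s -> 0 < w x) ->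
  exists y : nat -> R,
  [/\ forall i, (i < size s)%N -> s`_i <= y i,
      \sum_(i < size s) (y i - s`_i) = \sum_(x <- s) w x &
      forall u, u \notin s -> 1 < \sum_(x <- s) w x / (u - x) ->
        exists2 i, (i < size s)%N & s`_i <= u <= y i].
Proof.
move=> ss w0; set q := boole_poly w s.
have us : uniq s := lt_sorted_uniq ss.
have lt_nth i j : (i < j)%N -> (j < size s)%N -> s`_i < s`_j.
  by move=> ij js; rewrite lt_sorted_ltn_nth// inE// (ltn_trans ij).
(* Intermediate values. At consecutive poles a < c the values of q have opposite signs: the factors
   (a - c) and (c - a) do, and (a - z) (c - z) > 0 for every other pole z, as none lies between a
   and c. *)
have hroot i : exists y, (i < size s)%N -> [/\ root q y, s`_i < y &
     forall j, (i < j < size s)%N -> y < s`_j].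
  case: (ltnP i (size s)) => [si|]; last by exists 0.
  have [i1|i1] := ltnP i.+1 (size s).
    have hab := lt_nth _ _ (ltnSn i) i1.
    set a := s`_i in hab *; set c := s`_i.+1 in hab *.
    have ai : a \in s by rewrite mem_nth.
    have ci : c \in s by rewrite mem_nth.
    have [|y] := @polyrcf.poly_ivtoo _ q a c (ltW hab).
      rewrite /q !boole_poly_at// mulrNN.
      have hac : a != c by rewrite lt_eqF.
      rewrite -(big_filter s (fun z => z != a)) -(big_filter s (fun z => z != c)).
      rewrite [X in w a * X](bigD1_seq c) ?filter_uniq ?mem_filter ?(eq_sym c) ?hac//=.
      rewrite [X in w c * X](bigD1_seq a) ?filter_uniq ?mem_filter ?hac//=.
      rewrite !big_filter_cond.
      have -> : \prod_(z <- s | (z != c) && (z != a)) (c - z) =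
        \prod_(z <- s | (z != a) && (z != c)) (c - z) by apply: eq_bigl => z; rewrite andbC.
      rewrite mulrACA (mulrACA (a - c)) -big_split /=.
      have h1 : 0 < w a * w c by rewrite mulr_gt0// w0.
      have h2 : (a - c) * (c - a) < 0 by rewrite nmulr_rlt0 ?subr_gt0 ?subr_lt0.
      rewrite pmulr_rlt0// nmulr_rlt0//.
      rewrite big_seq_cond; apply: prodr_gt0 => z /and3P[zs za zc].
      have /(nthP 0) [j js jz] := zs.
      have [ji|ij] := ltnP j i.
        have hz : z < a by rewrite -jz lt_nth.
        by rewrite mulr_gt0// subr_gt0// (lt_trans hz).
      have [ji|ij'] := ltnP j i.+1.
        have eij : j = i by apply/eqP; rewrite eqn_leq ij -ltnS ji.
        by move: za; rewrite -jz eij eqxx.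
      have [ji|ij2] := ltnP i.+1 j; last first.
        have eij : j = i.+1 by apply/eqP; rewrite eqn_leq ij2 ij'.
        by move: zc; rewrite -jz eij eqxx.
      have hz : c < z by rewrite -jz lt_nth.
      by rewrite nmulr_rgt0 ?subr_lt0// (lt_trans hab).
    rewrite in_itv /= => /andP[y1 y2] ry; exists y => _; split => // j /andP[ij js].
    have [->//|ij2] := eqVneq j i.+1.
    by apply: lt_trans y2 _; rewrite lt_nth// ltn_neqAle eq_sym ij2 ij.
  have ai : s`_i \in s by rewrite mem_nth.
  set a := s`_i in ai *.
  have lea x : x \in s -> x <= a.
    move=> /(nthP 0) [j js <-].
    have [->//|ij] := eqVneq j i; apply/ltW/lt_nth => //.
    by rewrite ltn_neqAle ij -ltnS (leq_trans js).
  pose W := \sum_(x <- s) w x.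
  have W0 : 0 < W.
    rewrite /W (bigD1_seq a)//= ltr_pwDl ?w0// big_seq_cond sumr_ge0// => z /andP[zs _].
    by rewrite ltW ?w0.
  (* Beyond the last pole a: at this point every u - x is at least W + 1, so the sum is at most W /
     (W + 1) < 1 and q is positive. *)
  pose c := a + W + 1.
  have ac : a < c by rewrite /c; lra.
  have cs : c \notin s by apply/negP => /lea; rewrite leNgt ac.
  have [|y] := @polyrcf.poly_ivtoo _ q a c (ltW ac).
    rewrite /q boole_poly_at// boole_poly_off// mulNr oppr_lt0 mulr_gt0//.
      rewrite mulr_gt0 ?w0// big_seq_cond prodr_gt0// => z /andP[zs za].
      by rewrite subr_gt0 lt_neqAle za lea.
    rewrite mulr_gt0//; last first.
      by rewrite big_seq prodr_gt0// => z zs; rewrite subr_gt0 (le_lt_trans (lea _ zs)).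
    rewrite subr_gt0; apply: (@le_lt_trans _ _ (\sum_(x <- s) w x / (W + 1))).
      rewrite big_seq [leRHS]big_seq; apply: ler_sum => x xs.
      have := lea _ xs => xa.
      have h1 : W + 1 <= c - x by rewrite /c; lra.
      by rewrite ler_wpM2l ?(ltW (w0 _ xs))// lef_pV2// posrE; lra.
    by rewrite -mulr_suml -/W ltr_pdivrMr ?mul1r ?ltr_pwDr//; lra.
  rewrite in_itv /= => /andP[y1 y2] ry; exists y => _; split => // j /andP[ij js].
  by rewrite ltnNge -ltnS (leq_trans js i1) in ij.
have [y hy] := choice hroot.
have yr i : (i < size s)%N -> root q (y i) by move=> /hy[].
have ys i : (i < size s)%N -> s`_i < y i by move=> /hy[].
have ylt i j : (i < j)%N -> (j < size s)%N -> y i < s`_j.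
  by move=> ij js; have [_ _] := hy i (ltn_trans ij js); apply; rewrite ij.
pose Y := mkseq y (size s).
have uY : uniq Y.
  apply/mkseq_uniqP => i j /= si sj; rewrite !inE in si sj.
  have h k l : (k < l)%N -> (l < size s)%N -> y k < y l.
    by move=> kl ls; apply: lt_trans (ylt _ _ kl ls) (ys _ ls).
  by case: (ltngtP i j) => // ij e; [have := h _ _ ij sj|have := h _ _ ij si]; rewrite e ltxx.
have [sq mq] := boole_poly_monic w us; rewrite -/q in sq mq.
have hq : q = \prod_(z <- Y) ('X - z%:P).
  have := @all_roots_prod_XsubC _ q Y; rewrite (monicP mq) scale1r; apply.
  - by rewrite size_mkseq.
  - by rewrite all_map; apply/allP => i; rewrite mem_iota /= add0n => si; exact: yr.
  - by rewrite uniq_rootsE.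
exists y; split => [i si||u us' hu].
- exact/ltW/ys.
- have [s0|s0] := posnP (size s).
    by rewrite s0 big_ord0 (size0nil s0) big_nil.
  (* Vieta: the subleading coefficients of both expressions of q are compared. *)
  have := congr1 (fun p : {poly R} => p`_(size s).-1) hq.
  rewrite /q /boole_poly coefB coef_boole_sum//.
  rewrite coefPn_prod_XsubC -?lt0n// -[in X in _ = X -> _](size_mkseq y (size s)).
  rewrite coefPn_prod_XsubC ?size_mkseq -?lt0n//.
  rewrite big_map -[X in iota 0 X](subn0 (size s)) -/(index_iota 0 (size s)) big_mkord => e.
  rewrite sumrB -(big_mkord xpredT (fun i => s`_i)) -(big_nth 0 xpredT id).
  by move: e; lra.
(* If u lies in no interval, every factor (u - y_i) (u - s_i) is nonnegative, hence so is q(u) times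
   the product of the u - s_i. But that number is 1 minus the sum, which is negative, times a
   nonzero square. *)
- apply/not_exists2P => hn.
  have hq0 : q.[u] * \prod_(x <- s) (u - x) < 0.
    rewrite /q boole_poly_off// -mulrA -expr2 nmulr_rlt0 ?subr_lt0//.
    rewrite exprn_even_gt0//= prodf_seq_neq0; apply/allP => x xs /=.
    by rewrite subr_eq0; apply: contraNneq us' => ->.
  move: hq0; apply/negP; rewrite -leNgt hq horner_prod big_map.
  rewrite [X in _ * X](big_nth 0) -[X in iota 0 X](subn0 (size s)) -/(index_iota 0 (size s)) -big_split /=.
  rewrite big_mkord; apply: prodr_ge0 => -[i si] _ /=; rewrite hornerXsubC.
  have := hn i; rewrite si /=; have := ys _ si.
  case: (leP s`_i u) => h1; case: (leP u (y i)) => h2 h3 h4 //=.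
  + by case: h4 => //; case.
  + by rewrite mulr_ge0// subr_ge0// ltW.
  + by rewrite mulr_le0// subr_le0 ltW// (lt_trans h1).
  + by move: (lt_trans h2 h1) => h5; rewrite mulr_ge0//; lra.
Qed.

End Boole.

(** * Weak-type bounds in Lebesgue measure *)

Section BooleMeasure.
Variable R : realType.
Implicit Types (w c : R -> R) (s : seq R).
Local Notation mu := (@lebesgue_measure R).

(** Dividing the weights by t reduces to the level 1; the interlacing intervals [s_i, y_i] then
    cover the set and their lengths add up to the total mass over t. *)
Lemma boole_gt w s t : uniq s -> 0 < t -> (forall x, x \in s -> 0 < w x) ->
  exists A : set R, [/\ measurable A, (mu A <= ((\sum_(x <- s) w x) / t)%:E)%E &
    forall u, u \notin s -> t < \sum_(x <- s) w x / (u - x) -> A u].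
Proof.
move=> us t0 w0.
pose s' := sort <=%R s.
have ps : perm_eq s' s by rewrite perm_sort.
have ss : sorted <%R s' by rewrite sort_lt_sorted us.
have [|y [y1 y2 y3]] := @boole_sorted R (fun x => w x / t) s' ss.
  by move=> x; rewrite mem_sort => /w0 h; rewrite divr_gt0.
pose I i : set R := `[s'`_i, y i]%classic.
have mI i : measurable (I i) by exact: measurable_itv.
exists (\big[setU/set0]_(i < size s') I i); split.
- by apply: bigsetU_measurable => i _; exact: mI.
- have H := @Boole_inequality _ _ _ mu I (size s') (fun i _ => mI i).
  apply: (le_trans H).
  rewrite mulr_suml -(perm_big _ ps) -y2 /= -sumEFin.
  apply: lee_sum => i _; rewrite lebesgue_measure_itv /= lte_fin.
  by case: ifP => [//|_]; rewrite lee_fin subr_ge0 y1.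
- move=> u us'; rewrite -(perm_big _ ps)/= => tu.
  have [||i si /andP[h1 h2]] := y3 u.
  + by rewrite mem_sort.
  + under eq_bigr do rewrite mulrAC.
    by rewrite -mulr_suml ltr_pdivlMr// mul1r.
  + rewrite -bigcup_mkord; exists i => //=.
    by rewrite /I /= in_itv /= h1 h2.
Qed.

(** Values below -t become values above t under the reflection u -> -u of the variable and the
    nodes. *)
Lemma boole_norm w s t : uniq s -> 0 < t -> (forall x, x \in s -> 0 < w x) ->
  exists A : set R, [/\ measurable A,
    (mu A <= (2 * (\sum_(x <- s) w x) / t)%:E)%E &
    forall u, u \notin s -> t < `|\sum_(x <- s) w x / (u - x)| -> A u].
Proof.
move=> us t0 w0.
have [A [mA lA hA]] := boole_gt us t0 w0.
have [||B [mB lB hB]] := @boole_gt (w \o -%R) (map -%R s) t _ t0.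
- by rewrite map_inj_uniq//; exact: oppr_inj.
- by move=> x /mapP[y /w0 wy ->] /=; rewrite opprK.
have mB' : measurable (-%R @^-1` B).
  have mN : measurable_fun [set: measurableTypeR R] (-%R : _ -> measurableTypeR R) by [].
  by rewrite -[X in measurable X]setTI; exact: mN.
exists (A `|` (-%R @^-1` B)); split.
- exact: measurableU.
- have H : (mu (A `|` -%R @^-1` B) <= mu A + mu (-%R @^-1` B))%E by exact: measureU2.
  apply: (le_trans H).
  have -> : 2 * (\sum_(x <- s) w x) / t =
    (\sum_(x <- s) w x) / t + (\sum_(x <- s) w x) / t by ring.
  rewrite EFinD; apply: leeD => //.
  have := lebesgue_measureN mB; rewrite /pushforward => ->.
  move: lB; rewrite big_map; congr (_ <= (_ / _)%:E)%E.
  by apply: eq_bigr => x _ /=; rewrite opprK.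
- move=> u us'; rewrite ltr_normr => /orP[h|h]; [left; exact: hA|right].
  apply: hB; first by rewrite mem_map//; exact: oppr_inj.
  rewrite big_map; move: h; rewrite -sumrN; congr (_ < _).
  apply: eq_bigr => x _ /=; rewrite !opprK (_ : - u + x = - (u - x)); last by ring.
  by rewrite invrN mulrN.
Qed.

(* c is split into two positive parts, with a small mass added to each because
   boole_norm asks for positive weights. *)
Lemma boole_signed c s t S : uniq s -> 0 < t -> \sum_(x <- s) `|c x| < S ->
  exists A : set R, [/\ measurable A, (mu A <= (8 * S / t)%:E)%E &
    forall u, u \notin s -> t < `|\sum_(x <- s) c x / (u - x)| -> A u].
Proof.
move=> us t0 hS.
pose n : R := (size s)%:R + 1.
have n0 : 0 < n by rewrite ltr_wpDl.
pose S0 := \sum_(x <- s) `|c x|.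
(* The slack in the strict bound pays for the added masses: there are fewer than n nodes, so p and q
   together have mass at most 2 S. *)
pose e := (S - S0) / n.
have e0 : 0 < e by rewrite divr_gt0// subr_gt0.
have t2 : 0 < t / 2 by rewrite divr_gt0.
pose p x := (`|c x| + c x) / 2 + e.
pose q x := (`|c x| - c x) / 2 + e.
have [|A [mA lA hA]] := @boole_norm p s _ us t2.
  by move=> x _; have := ler_norm (- c x); rewrite normrN /p; lra.
have [|B [mB lB hB]] := @boole_norm q s _ us t2.
  by move=> x _; rewrite ltr_wpDl// divr_ge0// subr_ge0 ler_norm.
exists (A `|` B); split.
- exact: measurableU.
- have H : (mu (A `|` B) <= mu A + mu B)%E by exact: measureU2.
  apply: (le_trans H); apply: (le_trans (leeD lA lB)).
  rewrite -EFinD lee_fin -mulrDl -mulrDr -big_split /=.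
  have -> : \sum_(x <- s) (p x + q x) = S0 + 2 * e * (size s)%:R.
    rewrite (eq_bigr (fun x => `|c x| + 2 * e)); last by move=> x _; rewrite /p /q; field.
    by rewrite big_split /= big_const_seq count_predT iter_addr_0 mulr_natr.
  have gen (X : R) : 2 * X / (t / 2) = (4 * X) / t by field; rewrite gt_eqF.
  rewrite gen ler_pM2r ?invr_gt0//.
  have S00 : 0 <= S0 by rewrite sumr_ge0.
  have : e * n = S - S0 by rewrite /e divfK// gt_eqF.
  by rewrite /n mulrDr mulr1; lra.
- move=> u us' h.
  have e1 : \sum_(x <- s) c x / (u - x) =
    \sum_(x <- s) p x / (u - x) - \sum_(x <- s) q x / (u - x).
    rewrite -sumrB; apply: eq_bigr => x _; rewrite -mulrBl; congr (_ / _).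
    by rewrite /p /q; field.
  have [h1|h1] := ltP (t / 2) `|\sum_(x <- s) p x / (u - x)|; first by left; exact: hA.
  right; apply: hB => //; move: h; rewrite e1 => h.
  by have := lt_le_trans h (ler_normB _ _); lra.
Qed.
End BooleMeasure.

(** * Spectral measures *)

Section Ebd.
Context d (T : measurableType d) (R : realType) (mu : {finite_measure set T -> \bar R}).
Implicit Types (f g : T -> R).

(** Essential boundedness is the right class here: a polynomial is unbounded on the line, but
    bounded almost everywhere for a compactly supported measure. *)
Definition ebd f := measurable_fun setT f /\ exists C : R, {ae mu, forall x, `|f x| <= C}.

Lemma ebd_integrable f : ebd f -> mu.-integrable setT (EFin \o f).
Proof.
move=> [mf [C [N [mN N0 hN]]]]; apply/integrableP; split; first exact/measurable_EFinP.
have mf' : measurable_fun [set: T] (fun x => `|(EFin \o f) x|%E).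
  by apply: measurableT_comp => //; exact/measurable_EFinP.
apply: (@le_lt_trans _ _ (\int[mu]_x (cst `|C|%:E x))%E); last first.
  by rewrite integral_cst// ltey_eq fin_numM// fin_num_measure.
apply: ae_ge0_le_integral => //.
- by move=> x _; rewrite lee_fin.
exists N; split => //= x hx; apply: hN => /= h; apply: hx => _.
by rewrite lee_fin (le_trans h)// ler_norm.
Qed.

Lemma ebd_bounded f (C : R) : measurable_fun setT f -> (forall x, `|f x| <= C) -> ebd f.
Proof. by move=> mf h; split => //; exists C; exact: aeW. Qed.

Lemma ebd_cst (c : R) : ebd (fun=> c).
Proof. by apply: (@ebd_bounded _ `|c|) => //; exact: measurable_cst. Qed.

Lemma ebdD f g : ebd f -> ebd g -> ebd (fun x => f x + g x).
Proof.
move=> [mf [C hC]] [mg [D hD]]; split; first exact: measurable_funD.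
exists (C + D); apply: filterS2 hC hD => x hC hD.
by apply: le_trans (ler_normD _ _) _; apply: lerD.
Qed.

Lemma ebdM f g : ebd f -> ebd g -> ebd (fun x => f x * g x).
Proof.
move=> [mf [C hC]] [mg [D hD]]; split; first exact: measurable_funM.
exists (C * D); apply: filterS2 hC hD => x hC hD.
by rewrite normrM ler_pM.
Qed.

Lemma ebdZ (c : R) f : ebd f -> ebd (fun x => c * f x).
Proof. by apply: ebdM; exact: ebd_cst. Qed.

Lemma ebdN f : ebd f -> ebd (fun x => - f x).
Proof. by move=> /(ebdZ (-1)); under eq_fun do rewrite mulN1r. Qed.

Lemma ebdB f g : ebd f -> ebd g -> ebd (fun x => f x - g x).
Proof. by move=> hf /ebdN; exact: ebdD. Qed.

Lemma ebdX f n : ebd f -> ebd (fun x => f x ^+ n).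
Proof.
move=> hf; elim: n => [|n IH]; first by under eq_fun do rewrite expr0; exact: ebd_cst.
by under eq_fun do rewrite exprS; exact: ebdM.
Qed.

Lemma ebd_sum (I : Type) (s : seq I) (F : I -> T -> R) :
  (forall i, ebd (F i)) -> ebd (fun x => \sum_(i <- s) F i x).
Proof.
move=> h; elim: s => [|i s IH].
  by under eq_fun do rewrite big_nil; exact: ebd_cst.
by under eq_fun do rewrite big_cons; exact: ebdD.
Qed.

Local Notation "'I' f" := (Rintegral mu setT f) (at level 10, f at level 9).

Lemma RintD f g : ebd f -> ebd g -> I (fun x => f x + g x) = I f + I g.
Proof. by move=> hf hg; rewrite RintegralD//; exact: ebd_integrable. Qed.

Lemma RintB f g : ebd f -> ebd g -> I (fun x => f x - g x) = I f - I g.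
Proof. by move=> hf hg; rewrite RintegralB//; exact: ebd_integrable. Qed.

Lemma RintZ (c : R) f : ebd f -> I (fun x => c * f x) = c * I f.
Proof. by move=> hf; rewrite RintegralZl//; exact: ebd_integrable. Qed.

Lemma Rint_cst (c : R) : I (fun=> c) = c * fine (mu setT).
Proof. by rewrite Rintegral_cst. Qed.

Lemma Rint_sum (J : Type) (s : seq J) (F : J -> T -> R) :
  (forall i, ebd (F i)) -> I (fun x => \sum_(i <- s) F i x) = \sum_(i <- s) I (F i).
Proof.
move=> h; elim: s => [|i s IH].
  by under eq_fun do rewrite big_nil; rewrite big_nil Rint_cst mul0r.
under eq_fun do rewrite big_cons; rewrite big_cons RintD ?IH//.
exact: ebd_sum.
Qed.

Lemma Rint_ae_eq f g : measurable_fun setT f -> measurable_fun setT g ->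
  {ae mu, forall x, f x = g x} -> I f = I g.
Proof.
move=> mf mg h; congr fine; apply: ae_eq_integral => //.
- exact/measurable_EFinP.
- exact/measurable_EFinP.
- by apply: filterS h => x h _ /=; rewrite h.
Qed.

Lemma Rint_ae_ge0 f : ebd f -> {ae mu, forall x, 0 <= f x} -> 0 <= I f.
Proof.
move=> [mf _] h.
rewrite (@Rint_ae_eq f (fun x => `|f x|)) ?Rintegral_ge0//.
- exact: measurableT_comp.
- by apply: filterS h => x h; rewrite ger0_norm.
Qed.

Lemma Rint_ae_le f g : ebd f -> ebd g -> {ae mu, forall x, f x <= g x} -> I f <= I g.
Proof.
move=> hf hg h; rewrite -subr_ge0 -RintB//; apply: Rint_ae_ge0; first exact: ebdB.
by apply: filterS h => x; rewrite subr_ge0.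
Qed.

Lemma Rint_le f g : ebd f -> ebd g -> (forall x, f x <= g x) -> I f <= I g.
Proof. by move=> hf hg h; apply: Rint_ae_le => //; exact: aeW. Qed.

Lemma Rint_dct (F : nat -> T -> R) f (C : R) :
  (forall n, measurable_fun setT (F n)) -> measurable_fun setT f ->
  {ae mu, forall x, F ^~ x @ \oo --> f x} ->
  {ae mu, forall x n, `|F n x| <= C} ->
  (fun n => I (F n)) @ \oo --> I f.
Proof.
move=> mF mf cF bF.
have [] := @dominated_convergence _ T R mu setT measurableT (fun n => EFin \o F n)
  (EFin \o f) (cst C%:E).
- by move=> n; exact/measurable_EFinP.
- exact/measurable_EFinP.
- by apply: filterS cF => x h _; apply: cvg_EFin; [exact: nearW|].
- exact: (ebd_integrable (ebd_cst C)).
- by apply: filterS bF => x h n _; rewrite /= lee_fin.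
move=> fi _ h; apply: fine_cvg.
rewrite fineK//; exact: integrable_fin_num.
Qed.

Lemma Rint_indic (A : set T) : measurable A -> I (\1_A) = fine (mu A).
Proof. by move=> mA; rewrite /Rintegral integral_indic// setIT. Qed.

Lemma ebd_indic (A : set T) : measurable A -> ebd (\1_A).
Proof.
move=> mA; apply: (@ebd_bounded _ 1) => [|x]; first exact: measurable_indic.
by rewrite indicE; case: (_ \in _); rewrite ?normr1 ?normr0.
Qed.

Lemma markov_ebd f (t : R) : ebd f -> {ae mu, forall x, 0 <= f x} -> 0 < t ->
  fine (mu [set x | t < f x]) <= I f / t.
Proof.
move=> hf f0 t0.
have mA : measurable [set x | t < f x].
  have := hf.1 measurableT `]t, +oo[%classic (measurable_itv _).
  rewrite setTI; congr measurable; apply/seteqP; split => x /=; rewrite in_itv/= andbT//.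
rewrite ler_pdivlMr// mulrC -Rint_indic// -RintZ; last exact: ebd_indic.
apply: Rint_ae_le => //; first by apply/ebdZ/ebd_indic.
apply: filterS f0 => x f0; rewrite indicE.
by have [|] := boolP (x \in _); rewrite ?mulr0 ?inE ?mulr1//= => /ltW.
Qed.

End Ebd.

(** * Quantile functions of discrete laws *)

Section Quantile.
Variable R : realType.
Local Notation RM := (measurableTypeR R).
Local Notation leb := (@lebesgue_measure R).

Lemma mI01 : measurable (`[0, 1[%classic : set RM). Proof. exact: measurable_itv. Qed.

Lemma finI01 : (leb `[0%R, 1%R[%classic < +oo)%E.
Proof. by rewrite lebesgue_measure_itv/= lte01 oppr0 adde0 ltry. Qed.

Definition P01 : {finite_measure set RM -> \bar R} := mfrestr mI01 finI01.

Lemma P01E (A : set RM) : P01 A = leb (A `&` `[0, 1[%classic).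
Proof. by []. Qed.

Lemma P01_itv (a b : R) : 0 <= a -> a <= b -> b <= 1 ->
  P01 `[a, b[%classic = (b - a)%:E.
Proof.
move=> a0 ab b1; rewrite P01E setIidl.
  rewrite lebesgue_measure_itv/= lte_fin; case: ifP => // /negbT; rewrite -leNgt => ba.
  by have -> : b = a by [apply/eqP; rewrite eq_le ab ba]; rewrite subrr.
move=> x /=; rewrite !in_itv/= => /andP[h1 h2].
by rewrite (le_trans a0 h1) (lt_le_trans h2 b1).
Qed.

Lemma P01_outside : P01 (~` `[0, 1[%classic) = 0%E.
Proof. by rewrite P01E setICl measure0. Qed.

Local Notation I f := (Rintegral P01 setT f).

Lemma Rint_P01_itv (a b : R) : 0 <= a -> a <= b -> b <= 1 ->
  I (\1_`[a, b[%classic) = b - a.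
Proof.
by move=> a0 ab b1; rewrite Rint_indic ?P01_itv//; exact: measurable_itv.
Qed.

Lemma indic_split (a b c : R) (t : R) : a <= b -> b <= c ->
  \1_`[a, c[%classic t = \1_`[a, b[%classic t + \1_`[b, c[%classic t :> R.
Proof.
move=> ab bc; rewrite !indicE !mem_setE !in_itv/=.
have [h1|h1] := leP a t; have [h2|h2] := ltP t c; have [h3|h3] := ltP t b => /=;
 rewrite ?addr0 ?add0r//; lra.
Qed.

(** X takes the values of s in increasing order on consecutive intervals of lengths [w x], starting
    at a. It is continued by constants on both sides, which keeps it monotone on the whole line. *)
Lemma quantile_aux (s : seq R) (w : R -> R) (a : R) : sorted <=%R s -> s != [::] ->
  (forall x, 0 <= w x) -> 0 <= a -> a + \sum_(x <- s) w x <= 1 ->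
  exists X : RM -> RM, [/\ {homo X : u v / u <= v}, forall t, X t \in s,
   forall g : R -> R, measurable_fun setT (fun t => g (X t)) &
   forall g : R -> R,
     I (fun t => \1_`[a, a + \sum_(x <- s) w x[%classic t * g (X t)) =
     \sum_(x <- s) w x * g x].
Proof.
move=> + + w0; elim: s a => // x [|y s] IH a ss _ a0 a1.
  exists (fun=> x); split => //; first by move=> t; rewrite mem_head.
  move=> g; rewrite !big_seq1 in a1 *.
  have hi : ebd P01 (\1_`[a, a + w x[%classic : RM -> R) by apply: ebd_indic; exact: measurable_itv.
  under eq_fun do rewrite mulrC.
  rewrite RintZ// Rint_P01_itv ?lerDl//; ring.
rewrite big_cons addrA in a1.
have [||||X [X1 X2 X3 X4]] := IH (a + w x).
- exact: path_sorted ss.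
- by [].
- by rewrite addr_ge0.
- exact: a1.
pose Z (t : RM) : RM := if (t : R) < a + w x then x else X t.
have xX t : x <= X t.
  have /allP := order_path_min (@le_trans _ R) ss; apply; exact: X2.
have mZ g : measurable_fun setT (fun t => g (Z t) : R).
  have e : (fun t => g (Z t)) = fun t : RM => if (t : R) < a + w x then g x else g (X t).
    by apply/funext => t; rewrite /Z; case: ifP.
  rewrite e; apply: measurable_fun_ifT => //.
  by apply: measurable_fun_ltr => //; exact: measurable_cst.
have bZ (g : R -> R) (Y : RM -> R) (l : seq R) : (forall t, Y t \in l) ->
    measurable_fun setT (fun t => g (Y t) : R) -> ebd P01 (fun t => g (Y t)).
  move=> hY mY; have := @ebd_bounded _ _ _ P01 (fun t => g (Y t)) (\sum_(z <- l) `|g z|) mY; apply => t.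
  rewrite (big_rem (Y t))//= lerDl sumr_ge0//.
exists Z; split => //.
- move=> u v uv; rewrite /Z; case: ifP => h1; case: ifP => h2 //.
    by rewrite (le_lt_trans uv h2) in h1.
  exact: X1.
- by move=> t; rewrite /Z; case: ifP => _; rewrite ?mem_head// in_cons X2 orbT.
move=> g; rewrite !(big_cons _ _ x) addrA -X4.
set W := \sum_(_ <- _) _.
have W0 : 0 <= W by rewrite sumr_ge0.
have wx := w0 x.
have e : (fun t : RM => \1_`[a, a + w x + W[%classic t * g (Z t)) =
  (fun t : RM => g x * \1_`[a, a + w x[%classic t +
     \1_`[a + w x, a + w x + W[%classic t * g (X t)).
  apply/funext => t; rewrite (@indic_split a (a + w x)) ?lerDl// mulrDl; congr (_ + _).
    rewrite indicE mem_setE in_itv/= /Z mulrC.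
    by have [h|h] := ltP (t : R) (a + w x); rewrite ?andbF ?mulr0.
  rewrite indicE mem_setE in_itv/= /Z.
  by have [h|h] := ltP (t : R) (a + w x); rewrite ?mul0r.
have hi p q : ebd P01 (\1_`[p, q[%classic : RM -> R) by apply: ebd_indic; exact: measurable_itv.
rewrite e RintD; last 2 first.
- exact: ebdZ.
- by apply: ebdM => //; exact: (bZ g X _ X2).
have le1 : a + w x <= 1 by move: a1; rewrite -/W; lra.
by rewrite RintZ// Rint_P01_itv ?lerDl//; ring.
Qed.

Lemma quantile (s : seq R) (w : R -> R) : s != [::] -> (forall x, 0 <= w x) ->
  \sum_(x <- s) w x = 1 ->
  exists X : RM -> RM, [/\ {homo X : u v / u <= v}, forall t, X t \in s,
   forall g : R -> R, ebd P01 (fun t => g (X t)) &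
   forall g : R -> R, I (fun t => g (X t)) = \sum_(x <- s) w x * g x].
Proof.
move=> s0 w0 w1.
have ps : perm_eq (sort <=%R s) s by rewrite perm_sort.
have [|||||X [X1 X2 X3 X4]] := @quantile_aux (sort <=%R s) w 0.
- exact: sort_le_sorted.
- by rewrite -size_eq0 size_sort size_eq0.
- exact: w0.
- by [].
- by rewrite add0r (perm_big _ ps) /= w1.
have X2' t : X t \in s by rewrite -(perm_mem ps).
have bX (g : R -> R) : ebd P01 (fun t => g (X t) : R).
  have := @ebd_bounded _ _ _ P01 (fun t => g (X t)) (\sum_(z <- s) `|g z|) (X3 g); apply => t.
  rewrite (big_rem (X t))//= lerDl sumr_ge0//.
exists X; split => // g.
have := X4 g; rewrite !(perm_big _ ps)/= w1 add0r => <-.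
have hi : ebd P01 (\1_`[0, 1[%classic : RM -> R) by apply: ebd_indic; exact: measurable_itv.
apply: Rint_ae_eq; [exact: (bX g).1|exact: (ebdM hi (bX g)).1|].
exists (~` `[0, 1[%classic); split; [by apply: measurableC; exact: mI01|exact: P01_outside|].
move=> t /= + h; apply; rewrite indicE mem_set ?mul1r//.
Qed.

End Quantile.

(** The limit is the supremum of the eventual lower bounds. Gaps with rational ends suffice, so
    divergence of a sequence of functions is a countable union of crossing conditions. *)
Lemma cvg_no_gap (R : realType) (u : nat -> R) (M : R) : (forall n, `|u n| <= M) ->
  (forall p q : rat, ratr p < ratr q :> R ->
    (exists N, forall n, (N <= n)%N -> ratr p <= u n) \/
    (exists N, forall n, (N <= n)%N -> u n <= ratr q)) ->
  cvgn u.
Proof.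
move=> hM h.
pose S := [set a : R | exists N, forall n, (N <= n)%N -> a <= u n].
have supS : has_sup S.
  split; first by exists (- M), 0%N => n _; have := hM n; rewrite ler_norml => /andP[].
  exists M => a [N hN]; apply: le_trans (hN _ (leqnn N)) _.
  by have := hM N; rewrite ler_norml => /andP[].
apply/cvg_ex; exists (sup S); apply/cvgrPdist_le => e e0.
have [a [N hN] ha] := sup_adherent e0 supS.
have l1 : sup S < sup S + e by lra.
have [q] := rat_in_itvoo l1; rewrite in_itv/= => /andP[q1 q2].
have [p] := rat_in_itvoo q1; rewrite in_itv/= => /andP[p1 p2].
have [hp|[N' hN']] := h p q p2.
  by have := sup_upper_bound supS; move=> /(_ _ hp); rewrite leNgt p1.
exists (maxn N N') => // n /=; rewrite geq_max => /andP[n1 n2].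
have := hN _ n1; have := hN' _ n2; rewrite ler_norml; lra.
Qed.

Section Pushforward.
Variable R : realType.
Local Notation RM := (measurableTypeR R).
Definition law (f : RM -> RM) of measurable_fun setT f : set RM -> \bar R :=
  pushforward (P01 R) f.

Variables (f : RM -> RM) (mf : measurable_fun setT f).

HB.instance Definition _ := Measure.copy (law mf)
  (measure_function_pushforward__canonical__measure_function_Measure (P01 R) mf).

Let law_fin : fin_num_fun (law mf).
Proof.
move=> A mA; apply: fin_num_measure.
by rewrite -[X in measurable X]setTI; exact: mf.
Qed.

HB.instance Definition _ := Measure_isFinite.Build _ _ _ (law mf) law_fin.

End Pushforward.

(** * The spectral measure at the first site as a limit of Gauss quadratures *)

Section SpectralMeasure.
Variables (R : realType) (b : nat -> R) (B : R).
Hypothesis (hb : forall k, `|b k| <= B).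
Local Notation RM := (measurableTypeR R).
Local Notation M := (B + 2).
Local Notation I f := (Rintegral (P01 R) setT f).

Let B0 : 0 <= B. Proof. exact: le_trans (hb 0%N). Qed.
Let M0 : 0 < M. Proof. by have := B0; lra. Qed.

Definition gsum n (g : R -> R) := \sum_(x <- nodes b n) wt b n x * g x.

Lemma gsum_le n (g h : R -> R) e : (0 < n)%N ->
  (forall x, `|x| <= M -> `|g x - h x| <= e) -> `|gsum n g - gsum n h| <= e.
Proof.
move=> n0 gh; rewrite /gsum -sumrB.
apply: (le_trans (ler_norm_sum _ _ _)).
rewrite -[leRHS]mul1r -(quad1 b n0) mulr_suml big_seq [leRHS]big_seq.
apply: ler_sum => x xn; rewrite -mulrBr normrM ger0_norm ?wt_ge0//.
by apply: ler_wpM2l; [exact: wt_ge0|apply: gh; exact: nodes_bound xn].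
Qed.

(** On a polynomial the quadratures are eventually constant, and a Lipschitz function is uniformly
    close to a polynomial on the interval that holds all nodes. *)
Lemma gsum_cauchy (g : R -> R) L e : 0 < e ->
  (forall x y, `|g x - g y| <= L * `|x - y|) ->
  exists N, forall n m, (N < n)%N -> (N < m)%N -> `|gsum n g - gsum m g| <= e.
Proof.
move=> e0 hg; have e2 : 0 < e / 2 by lra.
have [P hP] := lipschitz_weierstrass M0 e2 hg.
exists (size P) => n m hn hm.
have h k : (size P < k)%N -> `|gsum k g - gsum (size P).+1 (horner P)| <= e / 2.
  move=> hk; have -> : gsum (size P).+1 (horner P) = gsum k (horner P).
    by apply/esym/(@quad_stable _ b (size P).+1 k) => //.
  by apply: gsum_le => [|x /hP]; [exact: leq_ltn_trans hk|rewrite distrC].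
have := ler_distD (gsum (size P).+1 (horner P)) (gsum n g) (gsum m g).
have := h _ hn; have := h _ hm; rewrite [X in X <= _]distrC; lra.
Qed.

Definition ramp (p q x : R) : R := Num.max 0 (Num.min 1 ((q - x) / (q - p))).

Lemma ramp_lip p q x y : p < q -> `|ramp p q x - ramp p q y| <= (q - p)^-1 * `|x - y|.
Proof.
move=> pq; have d0 : 0 < (q - p)^-1 by rewrite invr_gt0 subr_gt0.
have -> : (q - p)^-1 * `|x - y| = `|(q - x) / (q - p) - (q - y) / (q - p)|.
  rewrite -mulrBl normrM mulrC (gtr0_norm d0); congr (_ * _).
  by rewrite distrC; congr `|_|; ring.
rewrite /ramp; move: (_ / _) (_ / _) => t s.
have n0 := normr_ge0 (s - t); have n1 := ler_norm (s - t).
have n2 := ler_norm (t - s); rewrite distrC in n2.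
move: (`|s - t|) n0 n1 n2 => N n0 n1 n2; rewrite ler_norml.
rewrite /Num.max /Num.min; case: (ltP 1 s) => h1; case: (ltP 1 t) => h2;
 case: ltP => h3; case: ltP => h4; apply/andP; split; lra.
Qed.

Lemma ramp1 p q x : p < q -> x <= p -> ramp p q x = 1.
Proof.
move=> pq xp; have h : 1 <= (q - x) / (q - p) by rewrite ler_pdivlMr; lra.
by rewrite /ramp (min_idPl h) (max_idPr _)// ler01.
Qed.

Lemma ramp0 p q x : p < q -> q <= x -> ramp p q x = 0.
Proof.
move=> pq xp; have h : (q - x) / (q - p) <= 0.
  by rewrite pmulr_lle0 ?invr_gt0; lra.
have h1 : (q - x) / (q - p) <= 1 by lra.
by rewrite /ramp (min_idPr h1) (max_idPl h).
Qed.

Lemma ramp01 p q x : 0 <= ramp p q x <= 1.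
Proof. by rewrite /ramp le_max lexx /= ge_max ler01 ge_min lexx. Qed.

(* The quantile functions of the Gauss quadratures are monotone, and the integrals of
   ramps converge, so they converge off a countable set; mu is the law of the limit. *)
Lemma spectral_exists : exists mu : {finite_measure set RM -> \bar R},
  mu (~` `[- M, M]%classic) = 0%E /\
  forall (G : {poly R}) n, (size G <= n)%N -> (0 < n)%N ->
    Rintegral mu setT (fun x => G.[x]) = quad b n G.
Proof.
have hX n : exists X : RM -> RM, [/\ {homo X : u v / u <= v}, forall t, `|X t| <= M,
   forall g : R -> R, ebd (P01 R) (fun t => g (X t)) &
   forall g : R -> R, I (fun t => g (X t)) = gsum n.+1 g].
  have [|||X [X1 X2 X3 X4]] := @quantile R (nodes b n.+1) (wt b n.+1).
  - by rewrite -size_eq0 size_nodes.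
  - by move=> x; exact: wt_ge0.
  - exact: quad1.
  exists X; split => // t; exact: nodes_bound (X2 t).
have [X hX'] := choice hX.
have Xmono n := let: And4 h _ _ _ := hX' n in h.
have Xbd n := let: And4 _ h _ _ := hX' n in h.
have Xe n := let: And4 _ _ h _ := hX' n in h.
have XI n := let: And4 _ _ _ h := hX' n in h.
pose D (pq : rat * rat) := [set t : R | 0 <= t < 1 /\ ratr pq.1 < ratr pq.2 :> R /\
   (forall N, exists2 n, (N <= n)%N & X n t < ratr pq.1) /\
   (forall N, exists2 n, (N <= n)%N & ratr pq.2 < X n t)].
(* At most one point oscillates across a given gap. If t < t' both did, then X_n(t') < p for some
   large n makes the integral of the ramp at least t' by monotonicity, while X_m(t) > q for some
   large m makes it at most t; the integrals are Cauchy. *)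
have D1 pq t t' : D pq t -> D pq t' -> t < t' -> False.
  case: pq => p q [/andP[t0 t1] [/= pq [_ hq]]] [/andP[t0' t1'] [_ [/= hp _]]] tt'.
  have e0 : 0 < (t' - t) / 2 by lra.
  have [N hN] := gsum_cauchy e0 (fun x y => ramp_lip x y pq).
  have [n nN hn] := hp N; have [m mN hm] := hq N.
  have := hN n.+1 m.+1 nN mN; rewrite -!XI.
  have hi u v : ebd (P01 R) (\1_`[u, v[%classic : RM -> R).
    by apply: ebd_indic; exact: measurable_itv.
  have h1 : t' <= I (fun s => ramp (ratr p) (ratr q) (X n s)).
    have := @Rint_P01_itv R 0 t'; rewrite subr0 => <- //; last exact: ltW.
    apply: Rint_le => // s; rewrite indicE mem_setE in_itv/=.
    have [s0|s0] /= := leP 0 (s : R); last by case/andP: (ramp01 (ratr p) (ratr q) (X n s)).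
    have [s1|s1] /= := ltP (s : R) t'; last by case/andP: (ramp01 (ratr p) (ratr q) (X n s)).
    rewrite ramp1//; apply: le_trans (ltW hn); exact/Xmono/ltW.
  have h2 : I (fun s => ramp (ratr p) (ratr q) (X m s)) <= t.
    have := @Rint_P01_itv R 0 t; rewrite subr0 => <- //; last exact: ltW.
    apply: Rint_ae_le => //.
    exists (~` `[0, 1[%classic); split; [by apply: measurableC; exact: mI01|exact: P01_outside|].
    move=> s /= + h; apply; rewrite indicE mem_setE in_itv/=.
    move: h; rewrite in_itv/= => /andP[-> _] /=.
    have [s1|s1] /= := ltP (s : R) t; first by case/andP: (ramp01 (ratr p) (ratr q) (X m s)).
    rewrite ramp0//; apply: (le_trans (ltW hm)); exact/Xmono.
  by move=> /(le_trans (ler_norm _)); lra.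
have Dc pq : countable (D pq).
  have [[t Dt]|nD] := pselect (exists t, D pq t); last first.
    rewrite (_ : D pq = set0)//; apply/seteqP; split => // t Dt; exfalso; apply: nD.
    by exists t.
  apply: (@sub_countable _ _ _ [set t]); last exact: countable1.
  apply: subset_card_le => s Ds /=.
  by case: (ltgtP s t) => // h; exfalso; [exact: D1 Ds Dt h|exact: D1 Dt Ds h].
pose E := \bigcup_(pq in [set: rat * rat]) D pq.
have cE : countable E by apply: bigcup_countable.
have cvgX : {ae P01 R, forall t, cvgn (fun n => X n t)}.
  exists (E `|` ~` `[0, 1[%classic); split.
  - apply: measurableU; first exact: countable_measurable.
    by apply: measurableC; exact: mI01.
  - have mE : measurable (E : set RM) by exact: countable_measurable.
    have mC : measurable (~` `[0, 1[%classic : set RM) by apply: measurableC; exact: mI01.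
    apply: null_set_setU => //; last exact: P01_outside.
    apply: subset_measure0 (countable_lebesgue_measure0 cE) => //.
    by apply: measurableI => //; exact: mI01.
  move=> t /= nc; apply: contrapT => /not_orP[nE /contrapT]; rewrite in_itv/= => t01.
  apply: nc; apply: (@cvg_no_gap R _ M) => [n|p q pq]; first exact: Xbd.
  apply: contrapT => /not_orP[h1 h2]; apply: nE; exists (p, q) => //; split=> //; split => //.
  split => N; apply: contrapT => h; [apply: h1|apply: h2]; exists N => n nN;
    rewrite leNgt; apply/negP => hlt; apply: h; exists n => //.
(* The upper limit is measurable everywhere and is the limit wherever there is one. *)
pose Y (t : RM) : RM := limn_sup (fun n => X n t).
have mX n : measurable_fun setT (X n : RM -> R) by exact: (Xe n id).1.
have mY : measurable_fun setT Y.
  apply: measurable_fun_limn_sup => // t _.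
  - by exists M => _ [n _ <-]; apply: le_trans (ler_norm _) (Xbd n t).
  - by exists (- M) => _ [n _ <-]; have := Xbd n t; rewrite ler_norml => /andP[].
have XY : {ae P01 R, forall t, (fun n => X n t : R) @ \oo --> (Y t : R)}.
  by apply: filterS cvgX => t ct; rewrite /Y (cvg_limn_supE ct).
have Ybd : {ae P01 R, forall t, `|Y t : R| <= M}.
  apply: filterS XY => t ct.
  apply: (@cvgr_to_le _ _ _ _ _ _ M (cvg_norm ct)).
  by apply: nearW => n; exact: Xbd.
have eG (G : {poly R}) : ebd (P01 R) (fun t => G.[Y t]).
  have mG : measurable_fun setT (fun x : R => G.[x]).
    by apply: continuous_measurable_fun => x; exact: continuous_horner.
  split; first exact: (measurableT_comp mG mY).
  exists (\sum_(i < size G) `|G`_i| * M ^+ i).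
  apply: filterS Ybd => t hY; rewrite horner_coef.
  apply: le_trans (ler_norm_sum _ _ _) _; apply: ler_sum => i _.
  by rewrite normrM normrX ler_wpM2l// lerXn2r ?nnegrE// ltW.
exists (law mY); split.
  change (P01 R (Y @^-1` (~` `[- M, M]%classic)) = 0%E).
  have [N [mN N0 hN]] := Ybd.
  apply: subset_measure0 N0 => //.
    rewrite -[X in measurable X]setTI; apply: mY => //.
    by apply: measurableC; exact: measurable_itv.
  by move=> t /= h; apply: hN => /= h'; apply: h; rewrite in_itv/= -ler_norml.
move=> G n sG n0.
transitivity (I (fun t => G.[Y t])).
  congr fine; rewrite integral_pushforward//.
  - by apply/measurable_EFinP; apply: continuous_measurable_fun => x; exact: continuous_horner.
  - rewrite preimage_setT; exact: (ebd_integrable (eG G)).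
have hc : (fun m => I (fun t => G.[X m t])) @ \oo --> I (fun t => G.[Y t]).
  apply: (@Rint_dct _ _ _ _ _ _ (\sum_(i < size G) `|G`_i| * M ^+ i)).
  - by move=> m; exact: (Xe m (horner G)).1.
  - exact: (eG G).1.
  - apply: filterS XY => t ct; apply: (@continuous_cvg _ _ _ _ _ _ (horner G)) => //.
    exact: continuous_horner.
  - apply: aeW => t m; rewrite horner_coef.
    apply: le_trans (ler_norm_sum _ _ _) _; apply: ler_sum => i _.
    by rewrite normrM normrX ler_wpM2l// lerXn2r ?nnegrE ?(ltW M0)//; exact: Xbd.
apply: (cvg_unique _ hc) => //; apply: cvg_near_cst.
exists n => // m /= nm; rewrite XI.
by apply: (@quad_stable _ b n m.+1) => //; exact: leq_trans (leqnSn m).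
Qed.
End SpectralMeasure.

(** * Polynomial approximation of indicators of closed sets *)

Section DistSet.
Variables (R : realType) (K : set R).
Hypothesis K0 : K !=set0.

Definition sdist (x : R) := inf [set `|x - k| | k in K].

Let has_inf_dist x : has_inf [set `|x - k| | k in K].
Proof.
split; first by have [k Kk] := K0; exists `|x - k|, k.
by exists 0 => _ [k _ <-].
Qed.

Lemma sdist_ge0 x : 0 <= sdist x.
Proof.
apply: lb_le_inf; first by case: (has_inf_dist x).
by move=> _ [k _ <-].
Qed.

Lemma sdist_le x k : K k -> sdist x <= `|x - k|.
Proof. by move=> Kk; apply: ge_inf; [case: (has_inf_dist x)|exists k]. Qed.

Lemma sdist_lip x y : `|sdist x - sdist y| <= `|x - y|.
Proof.
have h u v : sdist u - `|u - v| <= sdist v.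
  apply: lb_le_inf; first by case: (has_inf_dist v).
  move=> _ [k Kk <-]; rewrite lerBlDl; apply: le_trans (sdist_le u Kk) _.
  exact: ler_distD.
have := h x y; have := h y x; rewrite (distrC y) ler_norml; lra.
Qed.

Lemma sdist0 x : K x -> sdist x = 0.
Proof.
move=> Kx; apply/eqP; rewrite eq_le sdist_ge0 andbT.
by have := sdist_le x Kx; rewrite subrr normr0.
Qed.

Lemma sdist_gt0 x : closed K -> ~ K x -> 0 < sdist x.
Proof.
move=> cK nK; rewrite lt_neqAle sdist_ge0 andbT; apply/negP => /eqP e.
apply: nK; apply: cK => U /nbhs_ballP[r /= r0 rU].
have [_ [k Kk <-] hk] := inf_adherent r0 (has_inf_dist x).
by exists k; split => //; apply: rU; move: hk; rewrite -/(sdist x) -e add0r.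
Qed.

End DistSet.

Section CompactSupport.
Variables (R : realType) (M : R).
Local Notation RM := (measurableTypeR R).
Variable mu : {finite_measure set RM -> \bar R}.
Hypothesis M0 : 0 < M.
Hypothesis hmu : mu (~` `[- M, M]%classic) = 0%E.
Local Notation I f := (Rintegral mu setT f).

Lemma ae_support (p : R -> Prop) : (forall x, `|x| <= M -> p x) -> {ae mu, forall x, p x}.
Proof.
move=> h; exists (~` `[- M, M]%classic); split => //.
  by apply: measurableC; exact: measurable_itv.
by move=> x /= np; rewrite in_itv/= -ler_norml => hx; apply: np; exact: h.
Qed.

Lemma measurable_horner (G : {poly R}) : measurable_fun setT (fun x : RM => G.[x]).
Proof. by apply: continuous_measurable_fun => x; exact: continuous_horner. Qed.

Lemma horner_bound (G : {poly R}) (x : R) : `|x| <= M ->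
  `|G.[x]| <= \sum_(i < size G) `|G`_i| * M ^+ i.
Proof.
move=> hx; rewrite horner_coef.
apply: le_trans (ler_norm_sum _ _ _) _; apply: ler_sum => i _.
by rewrite normrM normrX ler_wpM2l// lerXn2r ?nnegrE ?(ltW M0).
Qed.

Lemma ebd_poly (G : {poly R}) : ebd mu (fun x : RM => G.[x]).
Proof.
split; first exact: measurable_horner.
by eexists; apply: ae_support => x; exact: horner_bound.
Qed.

Lemma ebd_lip (f : R -> R) L : (forall x y, `|f x - f y| <= L * `|x - y|) ->
  (forall x, `|f x| <= 1) -> ebd mu (f : RM -> R).
Proof.
move=> hf f1; apply: (@ebd_bounded _ _ _ mu _ 1) => //.
have L0 : 0 <= L by have := hf 1 0; rewrite subr0 normr1 mulr1; apply: le_trans.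
apply: continuous_measurable_fun => x; apply/cvgrPdist_le => e e0.
have d0 : 0 < e / (L + 1) by rewrite divr_gt0// ltr_wpDl.
exists (e / (L + 1)) => // y /= hy; apply: le_trans (hf _ _) _.
have h1 : (L + 1) * `|x - y| <= e by rewrite mulrC -ler_pdivlMr ?ltr_wpDl// ltW.
by have := normr_ge0 (x - y); nra.
Qed.

(** Ramps of the distance to K are Lipschitz and converge pointwise to the indicator, as K is
    closed; dominated convergence gives convergence in L^2. One ramp is then replaced by a uniformly
    close polynomial. *)
Lemma approx_closed (K : set R) (eta : R) : closed K -> 0 < eta ->
  exists P : {poly R},
  [/\ forall x, K x -> `|x| <= M -> 1 <= P.[x],
      forall x, `|x| <= M -> `|P.[x]| <= 2 &
      I (fun x => (P.[x] - \1_K x) ^+ 2) <= eta].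
Proof.
move=> cK e0.
have [K0|K0] := pselect (K !=set0); last first.
  exists 0; split.
  - by move=> x Kx; exfalso; apply: K0; exists x.
  - by move=> x _; rewrite horner0 normr0.
  - rewrite (_ : (fun x => _) = fun=> 0); first by rewrite Rint_cst mul0r ltW.
    apply/funext => x; rewrite horner0 indicE memNset ?subrr ?expr0n//.
    by move=> Kx; apply: K0; exists x.
have mK : measurable (K : set RM) by exact: closed_measurable.
pose chi (j : nat) (x : R) : R := ramp 0 j.+1%:R^-1 (sdist K x).
have jp j : 0 < j.+1%:R^-1 :> R by rewrite invr_gt0.
have chi_lip j x y : `|chi j x - chi j y| <= j.+1%:R * `|x - y|.
  apply: le_trans (ramp_lip _ _ (jp j)) _.
  by rewrite subr0 invrK ler_wpM2l// sdist_lip.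
have chi01 j x : 0 <= chi j x <= 1 by exact: ramp01.
have chiE j : ebd mu (chi j : RM -> R).
  apply: (ebd_lip (chi_lip j)) => x; have /andP[h1 h2] := chi01 j x.
  by rewrite ger0_norm.
have indE : ebd mu (\1_K : RM -> R) by exact: ebd_indic.
have hcvg : (fun j => I (fun x => (chi j x - \1_K x) ^+ 2)) @ \oo --> I (fun=> 0).
  apply: (@Rint_dct _ _ _ _ _ _ 1).
  - by move=> j; exact: (ebdX 2 (ebdB (chiE j) indE)).1.
  - exact: measurable_cst.
  - apply: aeW => x; apply: cvg_near_cst.
    have [Kx|nK] := pselect (K x).
      apply: nearW => j; rewrite /chi sdist0// ramp1// indicE mem_set// subrr expr0n//.
    have d0 := sdist_gt0 K0 cK nK.
    have [N hN] : exists N : nat, (sdist K x)^-1 < N%:R.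
      by exists (Num.trunc (sdist K x)^-1).+1; exact: truncnS_gt.
    exists N => // j /= Nj; rewrite /chi ramp0//; last first.
      rewrite -[leRHS]invrK lef_pV2 ?posrE ?invr_gt0 ?ltr0n//.
      by apply: le_trans (ltW hN) _; rewrite ler_nat ltnW// ltnS.
    by rewrite indicE memNset// subrr expr0n.
  - apply: aeW => x j; have /andP[h1 h2] := chi01 j x.
    have h3 : 0 <= (\1_K x : R) <= 1 by rewrite indicE; case: (_ \in _) => /=; lra.
    by rewrite ger0_norm ?sqr_ge0//; move: h3; nra.
rewrite Rint_cst mul0r in hcvg.
have e4 : 0 < eta / 4 by lra.
have /cvgrPdist_lt /(_ _ e4) [j _ /(_ j (leqnn j))] := hcvg.
rewrite sub0r normrN /= => hj.
pose m := fine (mu setT).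
have m0 : 0 <= m by rewrite fine_ge0.
(* The bound 1 / 2 keeps |P| <= 2; the other one makes the error term 8 e^2 m below at most eta /
   4. *)
pose e := Num.min (1 / 2) (eta / (16 * (m + 1))).
have e0' : 0 < e by rewrite lt_min divr_gt0 ?divr_gt0 ?mulr_gt0 ?ltr_wpDl.
have e12 : e <= 1 / 2 by rewrite ge_min lexx.
have em : 16 * (m * e) <= eta.
  have : e <= eta / (16 * (m + 1)) by rewrite ge_min lexx orbT.
  rewrite ler_pdivlMr ?mulr_gt0 ?ltr_wpDl//; nra.
have [P0 hP0] := lipschitz_weierstrass M0 e0' (chi_lip j).
(* Raising the approximation by its error puts it above the ramp, hence above 1 on K. *)
pose P := P0 + e%:P.
have hP x : `|x| <= M -> chi j x <= P.[x] <= chi j x + 2 * e.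
  by move=> /hP0; rewrite /P !hornerE ler_norml => /andP[h1 h2]; apply/andP; split; lra.
exists P; split.
- by move=> x Kx /hP /andP[+ _]; apply: le_trans; rewrite /chi sdist0// ramp1.
- move=> x /hP; have /andP[h1 h2] := chi01 j x; rewrite ler_norml; lra.
have b1 := ebdX 2 (ebdB (chiE j) indE).
apply: (@le_trans _ _ (I (fun x => 2 * (chi j x - \1_K x) ^+ 2 + 8 * e ^+ 2))).
  apply: Rint_ae_le.
  - by apply: (ebdX 2 (ebdB _ indE)); exact: ebd_poly.
  - by apply: ebdD; [exact: ebdZ|exact: ebd_cst].
  apply: ae_support => x /hP /andP[h1 h2].
  set u := chi j x - \1_K x; have -> : P.[x] - \1_K x = u + (P.[x] - chi j x) by rewrite /u; ring.
  have [h3 h4] : 0 <= P.[x] - chi j x /\ P.[x] - chi j x <= 2 * e by split; lra.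
  set v := P.[x] - chi j x in h3 h4 *.
  have h5 : v ^+ 2 <= 4 * e ^+ 2 by nra.
  have := sqr_ge0 (u - v); nra.
rewrite RintD; [|by apply: ebdZ|exact: ebd_cst]; rewrite RintZ// Rint_cst.
have h : I (fun x => (chi j x - \1_K x) ^+ 2) <= eta / 4 by apply: le_trans (ler_norm _) (ltW hj).
by rewrite -/m; nra.
Qed.

End CompactSupport.

(** * Boundedness in measure *)

Section RationalBounds.
Variables (R : realType) (b : nat -> R).
Local Notation leb := (@lebesgue_measure R).

(** The residues of Q n / P n are positive and sum to 1, so the bound 2 / t is the same for all
    n. *)
Lemma Q_div_P_weak n t : 0 < t -> exists A : set R,
  [/\ measurable A, (leb A <= (2 / t)%:E)%E &
   forall u, u \notin nodes b n -> t < `|(Q b n).[u] / (P b n).[u]| -> A u].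
Proof.
move=> t0; case: n => [|n].
  exists set0; split => //; first by rewrite measure0 lee_fin divr_ge0// ltW.
  by move=> u _; rewrite (_ : Q b 0 = 0)// horner0 mul0r normr0 ltNge ltW.
have [|A [mA lA hA]] := boole_norm (nodes_uniq b n.+1) t0 (w := wt b n.+1).
  by move=> x _; exact: wt_gt0.
exists A; split => //; first by move: lA; rewrite quad1// mulr1.
by move=> u un; rewrite lagrange_nodesQ//; exact: hA.
Qed.

(** The residues of G / P n have absolute sum below eta: this is Cauchy-Schwarz for the quadrature,
    where Pm has norm 1. The proof uses the weighted inequality 2 p g <= eta p^2 + g^2 / eta. *)
Lemma poly_div_P_weak n (G : {poly R}) eta t : (0 < n)%N -> (size G <= n)%N ->
  0 < eta -> quad b n (G ^+ 2) < eta ^+ 2 -> 0 < t ->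
  exists A : set R,
  [/\ measurable A, (leb A <= (8 * eta / t)%:E)%E &
   forall u, u \notin nodes b n -> t < `|G.[u] / (P b n).[u]| -> A u].
Proof.
move=> n0 sG e0 hq t0.
pose c x := wt b n x * (Pm b n).[x] * G.[x].
have [|A [mA lA hA]] := boole_signed (nodes_uniq b n) t0 (c := c) (S := eta).
  have h1 : \sum_(x <- nodes b n) wt b n x * (Pm b n).[x] ^+ 2 = 1.
    case: n n0 {sG hq c} => // n _; rewrite PmS.
    have := gauss_orth b (ltnSn n) (ltnSn n); rewrite eqxx -[true%:R]/(1 : R) => <-.
    by apply: eq_bigr => x _; rewrite expr2.
  apply: (@le_lt_trans _ _ (\sum_(x <- nodes b n) (eta / 2 * (wt b n x * (Pm b n).[x] ^+ 2)
     + (2 * eta)^-1 * (wt b n x * (G ^+ 2).[x])))).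
    apply: ler_sum => x _; rewrite /c horner_exp normrM normrM (ger0_norm (wt_ge0 _ _ _)).
    have -> : eta / 2 * (wt b n x * (Pm b n).[x] ^+ 2) +
       (2 * eta)^-1 * (wt b n x * G.[x] ^+ 2) =
       wt b n x * ((eta * (Pm b n).[x] ^+ 2 + G.[x] ^+ 2 / eta) / 2).
      by field; rewrite gt_eqF.
    rewrite -mulrA ler_wpM2l ?wt_ge0// -(real_normK (num_real (Pm b n).[x])).
    rewrite -(real_normK (num_real G.[x])).
    move: (`|(Pm b n).[x]|) (`|G.[x]|) => p g; rewrite ler_pdivlMr//.
    have -> : eta * p ^+ 2 + g ^+ 2 / eta = p * g * 2 + (eta * p - g) ^+ 2 / eta.
      by field; rewrite gt_eqF.
    by rewrite lerDl divr_ge0 ?sqr_ge0// ltW.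
  rewrite big_split /= -!mulr_sumr h1 -/(quad b n (G ^+ 2)).
  have : (2 * eta)^-1 * quad b n (G ^+ 2) < (2 * eta)^-1 * eta ^+ 2.
    by rewrite ltr_pM2l// invr_gt0 mulr_gt0.
  have -> : (2 * eta)^-1 * eta ^+ 2 = eta / 2 by field; rewrite gt_eqF.
  by lra.
exists A; split => // u un; rewrite lagrange_nodes//; exact: hA.
Qed.

Lemma measurable_nodes n : measurable ([set` nodes b n] : set R).
Proof.
have h : countable [set` nodes b n] by apply: finite_set_countable; exact: finite_seq.
exact: countable_measurable.
Qed.

Lemma lebesgue_nodes n : leb [set` nodes b n] = 0%E.
Proof. by apply: countable_lebesgue_measure0; apply: finite_set_countable; exact: finite_seq. Qed.

End RationalBounds.

(** * Bounds in measure for the polynomials of shifted potentials *)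

Section Tightness.
Variables (R : realType).
Local Notation leb := (@lebesgue_measure R).
Local Notation RM := (measurableTypeR R).

(** The spectral measure of the operator at the first site, characterised by Gauss sums and with
    support in [-M, M]. *)
Definition spectral_of (b : nat -> R) (M : R) (mu : {finite_measure set RM -> \bar R}) :=
  [/\ 0 < M, mu (~` `[- M, M]%classic) = 0%E &
  forall (G : {poly R}) n, (size G <= n)%N -> (0 < n)%N ->
    Rintegral mu setT (fun x => G.[x]) = quad b n G].

Lemma spectral_sqr b M mu n : spectral_of b M mu ->
  Rintegral mu setT (fun x => (P b n ^+ 2).[x]) = 1.
Proof.
move=> [M0 hmu hq].
rewrite (hq _ (size (P b n ^+ 2) + n.+1)%N) ?leq_addr// ?addnS//.
rewrite /quad; have nl : (n < (size (P b n ^+ 2) + n).+1)%N by rewrite ltnS leq_addl.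
have := gauss_orth b nl nl; rewrite eqxx -[true%:R]/(1 : R) => <-.
by apply: eq_bigr => x _; rewrite horner_exp expr2.
Qed.

(** Markov's inequality for the square of [P b n], whose integral is 1, followed by the comparison
    of mu with Lebesgue measure on S. *)
Lemma leb_P_large b M mu n (S : set RM) (delta sigma : R) : spectral_of b M mu ->
  measurable S -> 0 < delta -> 0 < sigma ->
  (forall A : set RM, measurable A -> A `<=` S -> (delta%:E * leb A <= mu A)%E) ->
  let A := S `&` [set x | sigma < (P b n ^+ 2).[x]] in
  measurable A /\ (leb A <= ((delta * sigma)^-1)%:E)%E.
Proof.
move=> hs mS d0 s0 hS A.
have [M0 hmu hq] := hs.
have mB : measurable ([set x | sigma < (P b n ^+ 2).[x]] : set RM).
  have mh : measurable_fun setT (fun x : RM => (P b n ^+ 2).[x]) by exact: measurable_horner.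
  have := mh measurableT `]sigma, +oo[%classic (measurable_itv _).
  rewrite setTI; congr measurable; apply/seteqP; split => x /=; rewrite in_itv/= andbT//.
have mA : measurable A by exact: measurableI.
split => //.
have h := hS A mA (@subIsetl _ _ _).
have h2 : fine (mu [set x | sigma < (P b n ^+ 2).[x]]) <= sigma^-1.
  have := @markov_ebd _ _ _ mu (fun x : RM => (P b n ^+ 2).[x]) sigma
    (ebd_poly M0 hmu _) _ s0.
  rewrite (spectral_sqr n hs) mul1r; apply.
  by apply: aeW => x; rewrite horner_exp sqr_ge0.
have h3 : (mu A <= (sigma^-1)%:E)%E.
  apply: (@le_trans _ _ (mu [set x | sigma < (P b n ^+ 2).[x]])).
    by apply: le_measure; rewrite ?inE//; exact: subIsetr.
  by rewrite -[leLHS]fineK ?fin_num_measure// lee_fin.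
rewrite invfM EFinM -lee_pdivrMl// ?invr_gt0// invrK.
exact: le_trans h h3.
Qed.

(* By pA_shift the polynomials of the shifted potential are p_m q_N - q_m p_N. *)
Lemma tight_shift b M mu (S : set RM) (delta kappa : R) : spectral_of b M mu ->
  measurable S -> 0 < delta -> 0 < kappa ->
  (forall A : set RM, measurable A -> A `<=` S -> (delta%:E * leb A <= mu A)%E) ->
  exists s : R, 0 < s /\ forall m n, exists A : set R,
    [/\ measurable A, (leb A <= kappa%:E)%E &
     forall u, S u -> ~ A u -> `|(P (fun k => b (m.+1 + k)%N) n).[u]| <= s].
Proof.
move=> hs mS d0 k0 hS.
(* Four exceptional sets of measure at most kappa / 4 are spent: 2 / t for each of the two quotients
   Q / P, and (delta sigma)^-1 for each of the two polynomials. *)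
pose t := 8 / kappa; pose sigma := 4 / (delta * kappa).
have t0 : 0 < t by rewrite divr_gt0.
have s0 : 0 < sigma by rewrite divr_gt0// mulr_gt0.
exists (2 * t * sigma); split; first by apply: mulr_gt0 => //; apply: mulr_gt0.
move=> m n; set N := (m.+1 + n)%N.
have [A1 [mA1 lA1 hA1]] := Q_div_P_weak b N t0.
have [A2 [mA2 lA2 hA2]] := Q_div_P_weak b m t0.
have [mA3 lA3] := leb_P_large N hs mS d0 s0 hS.
have [mA4 lA4] := leb_P_large m hs mS d0 s0 hS.
set A3 := S `&` _ in mA3 lA3; set A4 := S `&` _ in mA4 lA4.
have mN1 := measurable_nodes b N; have mN2 := measurable_nodes b m.
exists (((A1 `|` A2) `|` (A3 `|` A4)) `|` ([set` nodes b N] `|` [set` nodes b m])).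
have sub (A B : set R) (x y : R) : measurable A -> measurable B ->
    (leb A <= x%:E)%E -> (leb B <= y%:E)%E -> (leb (A `|` B) <= (x + y)%:E)%E.
  move=> mA mB hx hy.
  have H : (leb (A `|` B) <= leb A + leb B)%E by exact: measureU2.
  by apply: (le_trans H); rewrite EFinD; exact: leeD.
split.
- by do ![apply: measurableU => //].
- have -> : kappa = ((2 / t + 2 / t) + ((delta * sigma)^-1 + (delta * sigma)^-1)) + (0 + 0).
    by rewrite /t /sigma; field; rewrite !gt_eqF.
  apply: (sub); [by do ![apply: measurableU => //]|by apply: measurableU| |].
    by apply: (sub); [by apply: measurableU|by apply: measurableU| |]; apply: (sub).
  by apply: (sub) => //; rewrite lebesgue_nodes.
move=> u Su /not_orP[/not_orP[/not_orP[nA1 nA2] /not_orP[nA3 nA4]] /not_orP[/negP nN1 /negP nN2]].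
have PQ k (A : set R) : u \notin nodes b k -> ~ A u ->
   (u \notin nodes b k -> t < `|(Q b k).[u] / (P b k).[u]| -> A u) ->
   `|(Q b k).[u]| <= t * `|(P b k).[u]|.
  move=> un nA hA; have pu : 0 < `|(P b k).[u]| by rewrite normr_gt0 -mem_nodes.
  by rewrite -ler_pdivrMr// -normrV ?unitfE -?normr_gt0// -normrM leNgt; apply/negP => /(hA un).
have q1 := PQ _ _ nN1 nA1 (hA1 u); have q2 := PQ _ _ nN2 nA2 (hA2 u).
have Pb k : ~ (S `&` [set x | sigma < (P b k ^+ 2).[x]]) u -> `|(P b k).[u]| ^+ 2 <= sigma.
  move=> h; rewrite real_normK ?num_real// leNgt; apply/negP => h'; apply: h; split => //=.
  by rewrite horner_exp.
have p1 := Pb _ nA3; have p2 := Pb _ nA4.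
have -> : P (fun k => b (m.+1 + k)%N) n = P b m * Q b N - Q b m * P b N.
  exact: (pA_shift (opc b) m.+1 n).
rewrite hornerD hornerN !hornerM.
apply: le_trans (ler_normB _ _) _; rewrite !normrM.
have := normr_ge0 (P b m).[u]; have := normr_ge0 (P b N).[u].
move: (`|(P b m).[u]|) (`|(P b N).[u]|) (`|(Q b m).[u]|) (`|(Q b N).[u]|) q1 q2 p1 p2.
move=> x y z v q1 q2 p1 p2 y0 x0.
have h : x * y <= sigma by have := sqr_ge0 (x - y); nra.
have h1 : x * v <= t * (x * y) by rewrite mulrCA ler_wpM2l.
have h2 : z * y <= t * (x * y) by rewrite mulrA ler_wpM2r.
have h3 : t * (x * y) <= t * sigma by rewrite ler_wpM2l// ltW.
by lra.
Qed.

Lemma P_continuous (b : nat -> R) n (M e : R) : 0 < M -> 0 < e ->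
  exists2 d, 0 < d & forall b' : nat -> R, (forall j, (j < n)%N -> `|b' j - b j| <= d) ->
    forall x, `|x| <= M -> `|(P b' n).[x] - (P b n).[x]| <= e /\
      `|(Pm b' n).[x] - (Pm b n).[x]| <= e.
Proof.
move=> M0; elim: n e => [|n IH] e e0.
  by exists 1 => // b' _ x _; rewrite !P0 !Pm0 !subrr normr0 (ltW e0).
pose C := \sum_(i < size (P b n)) `|(P b n)`_i| * M ^+ i.
have C0 : 0 <= C by rewrite sumr_ge0// => i _; rewrite mulr_ge0// exprn_ge0// ltW.
pose e1 := Num.min e (Num.min (e / (3 * (M + `|b n| + 1))) (e / 3)).
have D0 : 0 < 3 * (M + `|b n| + 1).
  by have := normr_ge0 (b n); lra.
have e10 : 0 < e1 by rewrite !lt_min e0 !divr_gt0.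
have e1e : e1 <= e by rewrite ge_min lexx.
have e1a : e1 * (M + `|b n| + 1) <= e / 3.
  rewrite -ler_pdivlMr; last by have := normr_ge0 (b n); lra.
  apply: (@le_trans _ _ (e / (3 * (M + `|b n| + 1)))).
    by rewrite /e1 !ge_min lexx orbT.
  by rewrite invfM mulrA.
have e1b : e1 <= e / 3 by rewrite /e1 !ge_min lexx !orbT.
have [d d0 hd] := IH e1 e10.
exists (Num.min d (Num.min 1 (e / (3 * (C + 1))))).
  by rewrite !lt_min d0 ltr01 divr_gt0// mulr_gt0// ltr_wpDl.
move=> b' hb' x xM.
have [h1 h2] : `|(P b' n).[x] - (P b n).[x]| <= e1 /\ `|(Pm b' n).[x] - (Pm b n).[x]| <= e1.
  apply: hd => // j jn; apply: le_trans (hb' j (ltnW jn)) _.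
  by rewrite ge_min lexx.
rewrite !PmS; split; last exact: le_trans h1 e1e.
rewrite !PS !hornerE.
have := hb' n (ltnSn n); rewrite !le_min => /and3P[_ hb1 hb2].
have hC : `|(P b n).[x]| <= C by exact: horner_bound.
have hbC : `|b' n - b n| * C <= e / 3.
  have : `|b' n - b n| * (C + 1) <= e / 3.
    by move: hb2; rewrite invfM mulrA ler_pdivlMr// ltr_wpDl.
  by have := normr_ge0 (b' n - b n); nra.
set p' := (P b' n).[x] in h1 *; set p := (P b n).[x] in h1 hC *.
set q' := (Pm b' n).[x] in h2 *; set q := (Pm b n).[x] in h2 *.
have -> : (x - b' n) * p' - q' - ((x - b n) * p - q) =
  (x - b' n) * (p' - p) - (b' n - b n) * p - (q' - q) by ring.
apply: le_trans (ler_normB _ _) _; rewrite -[leRHS]addr0.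
apply: (@le_trans _ _ (`|(x - b' n) * (p' - p)| + `|(b' n - b n) * p| + `|q' - q|)).
  by rewrite lerD2r; exact: ler_normB.
rewrite !normrM.
have h4 : `|x - b' n| <= M + `|b n| + 1.
  have -> : x - b' n = x - b n - (b' n - b n) by ring.
  apply: le_trans (ler_normB _ _) _; have := ler_normB x (b n); lra.
have h5 : `|x - b' n| * `|p' - p| <= e / 3.
  by apply: le_trans e1a; rewrite mulrC; apply: ler_pM.
have h6 : `|b' n - b n| * `|p| <= e / 3 by apply: le_trans hbC; apply: ler_wpM2l.
lra.
Qed.

(* W is a right limit of V; only finitely many sites are looked at. *)
Definition approx_shift (bV bW : nat -> R) :=
  forall N (e : R), 0 < e -> exists m, forall j, (j < N)%N -> `|bV (m.+1 + j)%N - bW j| <= e.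

(** If nu K = 0, then K is covered up to a null set by two sets of measure |K| / 3: one where the
    shifted polynomial exceeds s, one where G / P n exceeds t. Elsewhere |G| <= t (s + 1) = 1 / 2,
    against G >= 1 on K. *)
Lemma closed_gt0 bV bW M mu nu (S K : set RM) (delta : R) :
  spectral_of bV M mu -> spectral_of bW M nu -> approx_shift bV bW ->
  measurable S -> 0 < delta ->
  (forall A : set RM, measurable A -> A `<=` S -> (delta%:E * leb A <= mu A)%E) ->
  closed (K : set R) -> K `<=` S -> K `<=` `[- M, M]%classic -> (0 < leb K)%E ->
  (0 < nu K)%E.
Proof.
move=> hV hW hVW mS d0 hS cK KS KM K0.
rewrite lt_neqAle measure_ge0 andbT; apply/negP => /eqP nK0.
have [M0 hnu hq] := hW.
have mK : measurable K by exact: closed_measurable.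
have Kfin : leb K \is a fin_num.
  rewrite ge0_fin_numE//; apply: (@le_lt_trans _ _ (leb `[- M, M]%classic)).
    by apply: le_measure; rewrite ?inE//; exact: measurable_itv.
  by rewrite lebesgue_measure_itv/=; case: ifP => _; rewrite -?EFinB ltry.
pose k := fine (leb K).
have k0 : 0 < k by rewrite -lte_fin fineK.
have k3 : 0 < k / 3 by lra.
have [s [s0 hs]] := tight_shift hV mS d0 k3 hS.
pose t := (2 * (s + 1))^-1.
have t0 : 0 < t by rewrite invr_gt0; lra.
(* Chosen so that the set of [poly_div_P_weak] has measure 8 eta / t = k / 3. *)
pose eta := k * t / 24.
have e0 : 0 < eta by rewrite divr_gt0// mulr_gt0.
have e20 : 0 < eta ^+ 2 / 2 by rewrite divr_gt0// exprn_gt0.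
have [G [G1 G2 G3]] := approx_closed M0 hnu cK e20.
(* The degree n depends on G, hence on s. This is legitimate because s bounds the polynomials of all
   degrees and all shifts. *)
pose n := (size (G ^+ 2) + size G).+1.
have hG : quad bW n (G ^+ 2) < eta ^+ 2.
  rewrite -hq; [|by rewrite leqW// leq_addr|by []].
  apply: (@le_lt_trans _ _ (eta ^+ 2 / 2)); last by have := exprn_gt0 2 e0; lra.
  apply: le_trans G3; rewrite le_eqVlt; apply/orP; left; apply/eqP.
  apply: Rint_ae_eq.
  - exact: measurable_horner.
  - exact: (ebdX 2 (ebdB (ebd_poly M0 hnu G) (ebd_indic _ mK))).1.
  - exists K; split => // x /= hx; apply: contrapT => nKx; apply: hx.
    by rewrite indicE memNset// subr0 horner_exp.
have sG : (size G <= n)%N by rewrite leqW// leq_addl.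
have [A2 [mA2 lA2 hA2]] := @poly_div_P_weak R bW n G eta t isT sG e0 hG t0.
have [d d0' hd] := P_continuous bW n M0 ltr01.
have [m hm] := hVW n d d0'.
have [A1 [mA1 lA1 hA1]] := hs m n.
have sub : K `<=` (A1 `|` A2) `|` [set` nodes bW n].
  move=> u Ku; apply: contrapT => /not_orP[/not_orP[nA1 nA2] /negP un].
  have uM : `|u| <= M by have := KM _ Ku; rewrite /= in_itv/= -ler_norml.
  have h1 := hA1 u (KS _ Ku) nA1.
  have [h2 _] := hd _ hm u uM.
  have h3 : `|(P bW n).[u]| <= s + 1.
    have := ler_distD (P (fun k => bV (m.+1 + k)%N) n).[u] (P bW n).[u] 0.
    rewrite !subr0 distrC; lra.
  have pu : 0 < `|(P bW n).[u]| by rewrite normr_gt0 -mem_nodes.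
  have h4 : `|G.[u]| <= t * `|(P bW n).[u]|.
    by rewrite -ler_pdivrMr// -normrV ?unitfE -?normr_gt0// -normrM leNgt; apply/negP => /(hA2 u un).
  have h5 : t * `|(P bW n).[u]| <= 1 / 2.
    apply: (@le_trans _ _ (t * (s + 1))); first by rewrite ler_wpM2l// ltW.
    by rewrite /t le_eqVlt; apply/orP; left; apply/eqP; field; rewrite gt_eqF//; lra.
  have := G1 u Ku uM; have := ler_norm G.[u]; lra.
have mN := measurable_nodes bW n.
have : (leb K <= (k / 3 + 8 * eta / t)%:E + 0)%E.
  have H1 : (leb K <= leb ((A1 `|` A2) `|` [set` nodes bW n]))%E.
    by apply: le_measure; rewrite ?inE//; do ![apply: measurableU => //].
  have H2 : (leb ((A1 `|` A2) `|` [set` nodes bW n]) <= leb (A1 `|` A2) + leb [set` nodes bW n])%E.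
    by apply: measureU2 => //; exact: measurableU.
  have H3 : (leb (A1 `|` A2) <= leb A1 + leb A2)%E by exact: measureU2.
  apply: (le_trans H1); apply: (le_trans H2); rewrite lebesgue_nodes; apply: leeD => //.
  by apply: (le_trans H3); rewrite EFinD; exact: leeD.
rewrite adde0 -[leLHS]fineK// lee_fin -/k.
have -> : 8 * eta / t = k / 3 by rewrite /eta; field; rewrite gt_eqF.
lra.
Qed.

End Tightness.

(** * Square-summable sequences and the Schroedinger operator *)

Section SquareSummable.
Variable R : realType.
Local Notation C := R[i].
Local Notation Re := (@complex.Re R).
Local Notation Im := (@complex.Im R).
Implicit Types (u v w : nat -> C) (f g : nat -> R).

Lemma nneg_series_cvg f K : (forall n, 0 <= f n) -> (forall n, series f n <= K) ->
  cvgn (series f) /\ limn (series f) <= K.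
Proof.
move=> f0 fK.
have nd : nondecreasing_seq (series f).
  by apply: nondecreasing_series => n _ _; exact: f0.
have cf : cvgn (series f).
  by apply: nondecreasing_is_cvgn => //; exists K => _ [n _ <-].
by split => //; apply: limr_le => //; exact: nearW.
Qed.

Lemma series_le_lim f n : (forall n, 0 <= f n) -> cvgn (series f) -> series f n <= limn (series f).
Proof.
move=> f0 cf; apply: nondecreasing_cvgn_le => //.
by apply: nondecreasing_series => k _ _; exact: f0.
Qed.

Lemma series_dominated_cvg f g : (forall n, `|f n| <= g n) -> cvgn (series g) -> cvgn (series f).
Proof.
move=> fg cg; apply: normed_cvg; apply: series_le_cvg cg => n /=; [by []|exact: le_trans (fg n)|exact: fg].
Qed.

Lemma lim_seriesD' f g : cvgn (series f) -> cvgn (series g) ->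
  limn (series (fun k => f k + g k)) = limn (series f) + limn (series g).
Proof.
move=> cf cg; rewrite -limD//; congr (limn _).
by apply/funext => n; rewrite /= /series/= big_split.
Qed.

Lemma lim_seriesZ' (c : R) f : cvgn (series f) ->
  limn (series (fun k => c * f k)) = c * limn (series f).
Proof.
move=> cf; exact: (lim_seriesZ c cf).
Qed.

(* nc is the squared modulus, and rd the real scalar product on C = R^2. *)
Definition nc (z : C) : R := Re z ^+ 2 + Im z ^+ 2.
Definition rd (z t : C) : R := Re z * Re t + Im z * Im t.

Lemma nc_ge0 z : 0 <= nc z. Proof. by rewrite addr_ge0 ?sqr_ge0. Qed.

Lemma normc_sqr z : Normc.normc z ^+ 2 = nc z.
Proof. by case: z => a b; rewrite /= sqr_sqrtr// addr_ge0 ?sqr_ge0. Qed.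

Lemma Re_mul_conj z t : Re (z * conjc t) = rd z t.
Proof. by case: z t => a b [c d]; rewrite /rd /=; ring. Qed.

Lemma rdzz z : rd z z = nc z. Proof. by rewrite /rd /nc; ring. Qed.

Definition nsq u : R := limn (series (fun k => nc (u k))).
(** The real part of [l2dot]. It determines the moments in [spectral_measure], which are real by
    symmetry of the operator. *)
Definition rdot u v : R := limn (series (fun k => rd (u k) (v k))).

Lemma l2E u : l2 u <-> cvgn (series (fun k => nc (u k))).
Proof. by rewrite /l2 /=; under eq_fun do rewrite normc_sqr. Qed.

Lemma l2normE u : l2norm u = Num.sqrt (nsq u).
Proof. by rewrite /l2norm; under eq_fun do rewrite normc_sqr. Qed.

Lemma Re_l2dot u v : Re (l2dot u v) = rdot u v.
Proof. by rewrite /l2dot /=; under eq_fun do rewrite Re_mul_conj. Qed.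

Lemma nsq_ge0 u : l2 u -> 0 <= nsq u.
Proof.
move=> /l2E cu; have := series_le_lim 0 (fun k => nc_ge0 (u k)) cu.
by rewrite /series /= big_geq.
Qed.

Lemma rd_le z t : `|rd z t| <= (nc z + nc t) / 2.
Proof.
rewrite /rd /nc; move: (Re z) (Im z) (Re t) (Im t) => a b c d.
have := sqr_ge0 (a - c); have := sqr_ge0 (b - d).
have := sqr_ge0 (a + c); have := sqr_ge0 (b + d).
by rewrite ler_norml => h1 h2 h3 h4; apply/andP; split; nra.
Qed.

Lemma cvg_rd u v : l2 u -> l2 v -> cvgn (series (fun k => rd (u k) (v k))).
Proof.
move=> /l2E cu /l2E cv.
apply: (@series_dominated_cvg _ (fun k => (nc (u k) + nc (v k)) / 2)).
  by move=> n; exact: rd_le.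
have := @is_cvg_seriesZ _ _ (2^-1) (is_cvg_seriesD cu cv).
rewrite (_ : _ *: _ = fun n => (nc (u n) + nc (v n)) / 2)//.
by apply/funext => n; rewrite mulrC.
Qed.

Lemma nsq_rdot u : nsq u = rdot u u.
Proof. by rewrite /nsq /rdot; under eq_fun do rewrite -rdzz. Qed.

Definition addu u v : nat -> C := fun k => u k + v k.
Definition scu (c : C) u : nat -> C := fun k => c * u k.
Definition subu u v : nat -> C := fun k => u k - v k.

Lemma subuE u v : subu u v = addu u (scu (-1) v).
Proof. by apply/funext => k; rewrite /subu /addu /scu mulN1r. Qed.

Lemma nc_add z t : nc (z + t) <= 2 * nc z + 2 * nc t.
Proof.
rewrite /nc; case: z t => a b [c d] /=.
have := sqr_ge0 (a - c); have := sqr_ge0 (b - d); nra.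
Qed.

Lemma nc_mul z t : nc (z * t) = nc z * nc t.
Proof. by rewrite /nc; case: z t => a b [c d] /=; ring. Qed.

Lemma l2_dom u (K : R) v : l2 v -> (forall k, nc (u k) <= K * nc (v k)) -> l2 u.
Proof.
move=> /l2E cv h; apply/l2E.
apply: (@series_dominated_cvg _ (fun k => K * nc (v k))).
  by move=> n; rewrite ger0_norm ?nc_ge0.
exact: (@is_cvg_seriesZ _ _ K cv).
Qed.

Lemma l2D u v : l2 u -> l2 v -> l2 (addu u v).
Proof.
move=> /l2E cu /l2E cv; apply/l2E.
apply: (@series_dominated_cvg _ (fun k => 2 * (nc (u k) + nc (v k)))).
  move=> n; rewrite ger0_norm ?nc_ge0// mulrDr; exact: nc_add.
exact: (@is_cvg_seriesZ _ _ 2 (is_cvg_seriesD cu cv)).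
Qed.

Lemma l2Z c u : l2 u -> l2 (scu c u).
Proof. by move=> hu; apply: (@l2_dom _ (nc c) u) => // k; rewrite /scu nc_mul. Qed.

Lemma l2B u v : l2 u -> l2 v -> l2 (subu u v).
Proof. by move=> hu hv; rewrite subuE; apply: l2D => //; exact: l2Z. Qed.

Lemma rdot_sym u v : rdot u v = rdot v u.
Proof. by rewrite /rdot; congr (limn (series _)); apply/funext => k; rewrite /rd; ring. Qed.

Lemma rdotDl u v w : l2 u -> l2 v -> l2 w -> rdot (addu u v) w = rdot u w + rdot v w.
Proof.
move=> hu hv hw; rewrite /rdot -lim_seriesD'; [|exact: cvg_rd|exact: cvg_rd].
congr (limn (series _)); apply/funext => k; rewrite /rd /addu.
by case: (u k) (v k) (w k) => a b [c d] [e f] /=; ring.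
Qed.

Lemma rdotZl (r : R) u w : l2 u -> l2 w -> rdot (scu r%:C%C u) w = r * rdot u w.
Proof.
move=> hu hw; rewrite /rdot -lim_seriesZ'; last exact: cvg_rd.
congr (limn (series _)); apply/funext => k; rewrite /rd /scu.
by case: (u k) (w k) => a b [c d] /=; ring.
Qed.

Lemma rdot_adj c u w : rdot (scu c u) w = rdot u (scu (conjc c) w).
Proof.
rewrite /rdot; congr (limn (series _)); apply/funext => k; rewrite /rd /scu.
by case: c (u k) (w k) => a b [c d] [e f] /=; ring.
Qed.

Lemma rdotBl u v w : l2 u -> l2 v -> l2 w -> rdot (subu u v) w = rdot u w - rdot v w.
Proof.
move=> hu hv hw; rewrite subuE rdotDl//; last exact: l2Z.
have -> : -1 = (-1 : R)%:C%C :> C by rewrite rmorphN1.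
by rewrite rdotZl// mulN1r.
Qed.

Lemma rdotDr u v w : l2 u -> l2 v -> l2 w -> rdot w (addu u v) = rdot w u + rdot w v.
Proof. by move=> hu hv hw; rewrite rdot_sym rdotDl// !(rdot_sym w). Qed.

Lemma rdotBr u v w : l2 u -> l2 v -> l2 w -> rdot w (subu u v) = rdot w u - rdot w v.
Proof. by move=> hu hv hw; rewrite rdot_sym rdotBl// !(rdot_sym w). Qed.

Lemma rdotZr (r : R) u w : l2 u -> l2 w -> rdot w (scu r%:C%C u) = r * rdot w u.
Proof. by move=> hu hw; rewrite rdot_sym rdotZl// rdot_sym. Qed.

Lemma nsqB u v : l2 u -> l2 v -> nsq (subu u v) = nsq u - 2 * rdot u v + nsq v.
Proof.
move=> hu hv; have hs := l2B hu hv.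
rewrite !nsq_rdot rdotBl// !rdotBr// (rdot_sym v u); ring.
Qed.

Lemma nsqD u v : l2 u -> l2 v -> nsq (addu u v) = nsq u + 2 * rdot u v + nsq v.
Proof.
move=> hu hv; have hs := l2D hu hv.
rewrite !nsq_rdot rdotDl// !rdotDr// (rdot_sym v u); ring.
Qed.

Lemma nsqZ c u : l2 u -> nsq (scu c u) = nc c * nsq u.
Proof.
move=> /l2E hu; rewrite /nsq -lim_seriesZ'//; congr (limn (series _)).
by apply/funext => k; rewrite /scu nc_mul.
Qed.

Lemma nsq_add_le u v : l2 u -> l2 v -> nsq (addu u v) <= 2 * nsq u + 2 * nsq v.
Proof.
move=> hu hv; have := nsq_ge0 (l2B hu hv); rewrite nsqB// nsqD//; lra.
Qed.

Lemma cauchy_schwarz u v : l2 u -> l2 v -> rdot u v ^+ 2 <= nsq u * nsq v.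
Proof.
move=> hu hv.
have h (s t : R) : 0 <= s ^+ 2 * nsq u - 2 * (s * t * rdot u v) + t ^+ 2 * nsq v.
  have := nsq_ge0 (l2B (@l2Z s%:C%C _ hu) (@l2Z t%:C%C _ hv)).
  rewrite nsqB; [|exact: l2Z|exact: l2Z].
  rewrite !nsqZ// rdotZl//; last exact: l2Z.
  rewrite rdotZr// /nc /= expr0n /= !addr0; lra.
have n0 := nsq_ge0 hu; have m0 := nsq_ge0 hv.
have [e|e] := eqVneq (nsq v) 0.
  (* For nsq v = 0 the quadratic form at this choice of s and t equals minus the square of
     [rdot u v]. *)
  rewrite e mulr0; have := h (rdot u v) ((nsq u + 1) / 2 ); rewrite e mulr0 addr0.
  by have := sqr_ge0 (rdot u v); nra.
have := h (nsq v) (rdot u v).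
have vp : 0 < nsq v by rewrite lt_neqAle eq_sym e m0.
have -> : nsq v ^+ 2 * nsq u - 2 * (nsq v * rdot u v * rdot u v) + rdot u v ^+ 2 * nsq v =
  nsq v * (nsq u * nsq v - rdot u v ^+ 2) by ring.
by rewrite pmulr_rge0// subr_ge0.
Qed.

Lemma nc_coord u k : l2 u -> nc (u k) <= nsq u.
Proof.
move=> /l2E cu; apply: le_trans (series_le_lim k.+1 (fun k => nc_ge0 (u k)) cu).
by rewrite /series /= big_nat_recr//= lerDr sumr_ge0// => i _; exact: nc_ge0.
Qed.

(** Coordinatewise convergence. Limits are unique for it and the operator, which couples only
    neighbouring sites, is continuous for it; hence it serves to identify limits. *)
Definition cvgu (w : nat -> nat -> C) (y : nat -> C) := forall k,
  (fun j => Re (w j k)) @ \oo --> Re (y k) /\ (fun j => Im (w j k)) @ \oo --> Im (y k).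

Lemma cvgu_unique (w : nat -> nat -> C) y y' : cvgu w y -> cvgu w y' -> y = y'.
Proof.
move=> h h'; apply/funext => k; have [h1 h2] := h k; have [h3 h4] := h' k.
apply/eqP; rewrite eq_complex; apply/andP; split; apply/eqP.
  exact: cvg_unique h1 h3.
exact: cvg_unique h2 h4.
Qed.

Lemma cvg_nc (w : nat -> C) y : (fun j => Re (w j)) @ \oo --> Re y ->
  (fun j => Im (w j)) @ \oo --> Im y -> (fun j => nc (w j)) @ \oo --> nc y.
Proof. by move=> h1 h2; apply: cvgD; rewrite expr2; under eq_fun do rewrite expr2; apply: cvgM. Qed.

Lemma cvg_series_at (F : nat -> nat -> R) f n :
  (forall k, (fun j => F j k) @ \oo --> f k) -> (fun j => series (F j) n) @ \oo --> series f n.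
Proof.
move=> h; elim: n => [|n IH].
  by rewrite /series /= big_geq//; under eq_fun do rewrite big_geq//; exact: cvg_cst.
rewrite seriesSr; under eq_fun do rewrite seriesSr.
exact: cvgD.
Qed.

(** Fatou for series: each partial sum passes to the limit under the common bound. *)
Lemma nsq_fatou (w : nat -> nat -> C) y (K : R) : cvgu w y -> (forall j, l2 (w j)) ->
  (\forall j \near \oo, nsq (w j) <= K) -> l2 y /\ nsq y <= K.
Proof.
move=> cw hw hK; rewrite l2E; apply: nneg_series_cvg; first by move=> k; exact: nc_ge0.
move=> n.
have h : (fun j => series (fun k => nc (w j k)) n) @ \oo --> series (fun k => nc (y k)) n.
  apply: cvg_series_at => k; by apply: cvg_nc; case: (cw k).
apply: (@cvgr_to_le _ _ _ _ _ _ K h); apply: filterS hK => j; apply: le_trans.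
by have /l2E cj := hw j; exact: (series_le_lim n (fun k => nc_ge0 (w j k)) cj).
Qed.

Lemma cvgu_sub (w : nat -> nat -> C) y v : cvgu w y -> cvgu (fun j => subu v (w j)) (subu v y).
Proof.
move=> h k; have [h1 h2] := h k; rewrite /subu.
have e1 z t : Re (z - t) = Re z - Re t by case: z t => a b [].
have e2 z t : Im (z - t) = Im z - Im t by case: z t => a b [].
split; [under eq_fun do rewrite e1; rewrite e1|under eq_fun do rewrite e2; rewrite e2];
 by apply: cvgB => //; exact: cvg_cst.
Qed.

(** Coordinates converge since each is bounded by the norm; applying [nsq_fatou] to w j - w i as i
    grows turns this into norm convergence. *)
Lemma l2_complete (w : nat -> nat -> C) : (forall j, l2 (w j)) ->
  (forall e : R, 0 < e -> exists N, forall i j, (N <= i)%N -> (N <= j)%N ->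
     nsq (subu (w i) (w j)) <= e) ->
  exists y, [/\ l2 y, cvgu w y & (fun j => nsq (subu (w j) y)) @ \oo --> 0].
Proof.
move=> hw hc.
have cv (p : C -> R) (k : nat) : (forall z t, `|p z - p t| ^+ 2 <= nc (z - t)) ->
    cvgn (fun j => p (w j k)).
  move=> hp; apply/cauchy_cvgP/cauchy_exP => e e0.
  have e2 : 0 < e ^+ 2 / 2 by rewrite divr_gt0// exprn_gt0.
  have [N hN] := hc _ e2.
  exists (p (w N k)); exists N => // j /= Nj; rewrite /ball /=.
  have h : `|p (w N k) - p (w j k)| ^+ 2 < e ^+ 2.
    apply: le_lt_trans (hp _ _) _.
    apply: le_lt_trans (nc_coord k (l2B (hw N) (hw j))) _.
    apply: le_lt_trans (hN _ _ (leqnn N) Nj) _.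
    by have := exprn_gt0 2 e0; lra.
  by move: h; rewrite ltr_pXn2r ?nnegrE// ltW.
pose y k : C := (limn (fun j => Re (w j k)) +i* limn (fun j => Im (w j k)))%C.
have wy : cvgu w y.
  move=> k; split; rewrite /y /=; apply: cv => z t; rewrite real_normK ?num_real// /nc;
    case: z t => a b [c d] /=; [rewrite lerDl|rewrite lerDr]; exact: sqr_ge0.
have key e : 0 < e -> exists N, forall j, (N <= j)%N ->
    l2 (subu (w j) y) /\ nsq (subu (w j) y) <= e.
  move=> e0; have [N hN] := hc _ e0; exists N => j Nj.
  apply: (nsq_fatou (cvgu_sub (w j) wy)).
    by move=> i; exact: l2B.
  by exists N => // i /= Ni; exact: hN.
have ly : l2 y.
  have [N /(_ N (leqnn N)) [h _]] := key 1 ltr01.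
  have -> : y = subu (w N) (subu (w N) y).
    by apply/funext => k; rewrite /subu opprB addrC subrK.
  exact: l2B.
exists y; split => //; apply/cvgrPdist_le => e e0.
have [N hN] := key e e0; exists N => // j /= Nj.
have [h1 h2] := hN _ Nj; rewrite sub0r normrN ger0_norm//; exact: nsq_ge0.
Qed.

End SquareSummable.

(** * The operator on square-summable sequences and its polynomials *)

Section Operator.
Variables (R : realType) (V : nat -> R) (B : R).
Hypothesis hV : forall n, `|V n.+1| <= B.
Local Notation C := R[i].
Local Notation H := (schrodinger V).
Implicit Types (u v w : nat -> C) (F G : {poly R}).

Let B0 : 0 <= B. Proof. exact: le_trans (hV 0%N). Qed.

(** A crude norm bound: three terms are squared with the factor 3, and 3 (2 + B^2) <= (3 (1 +
    B))^2. *)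
Definition opbound : R := 3 * (1 + B).

Lemma opbound_ge : B + 2 <= opbound. Proof. by rewrite /opbound; have := B0; lra. Qed.
Lemma opbound_gt0 : 0 < opbound. Proof. by have := opbound_ge; have := B0; lra. Qed.

Lemma HD u v : H (addu u v) = addu (H u) (H v).
Proof. by apply/funext => -[|k]; rewrite /schrodinger /addu; ring. Qed.

Lemma HZ c u : H (scu c u) = scu c (H u).
Proof. by apply/funext => -[|k]; rewrite /schrodinger /scu; ring. Qed.

Lemma HB u v : H (subu u v) = subu (H u) (H v).
Proof. by rewrite !subuE HD HZ. Qed.

Lemma nc_H u k : nc (H u k) <=
  3 * (nc (u k.+1) + (if k is k'.+1 then nc (u k') else 0) + B ^+ 2 * nc (u k)).
Proof.
have h2 : (V k.+1) ^+ 2 <= B ^+ 2.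
  by rewrite -real_normK ?num_real// lerXn2r ?nnegrE// hV.
have key (z t y : C) : nc (z + t + (V k.+1)%:C%C * y) <= 3 * (nc z + nc t + B ^+ 2 * nc y).
  have h3 : (V k.+1) ^+ 2 * nc y <= B ^+ 2 * nc y by rewrite ler_wpM2r ?nc_ge0.
  apply: (@le_trans _ _ (3 * (nc z + nc t + (V k.+1) ^+ 2 * nc y))); last by lra.
  rewrite /nc; case: z t y {h3} => a b [c d] [e f] /=.
  have := sqr_ge0 (a - c); have := sqr_ge0 (a - V k.+1 * e); have := sqr_ge0 (c - V k.+1 * e).
  have := sqr_ge0 (b - d); have := sqr_ge0 (b - V k.+1 * f); have := sqr_ge0 (d - V k.+1 * f).
  by nra.
case: k h2 key => [|k] h2 key; last exact: key.
have := key (u 1%N) 0 (u 0%N); rewrite /nc /= !expr0n /= !addr0 => h.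
by rewrite /schrodinger; apply: le_trans h; rewrite le_eqVlt eqxx.
Qed.

Lemma H_bound u : l2 u -> l2 (H u) /\ nsq (H u) <= opbound ^+ 2 * nsq u.
Proof.
move=> hu; have /l2E cu := hu.
have [h1 h2] : cvgn (series (fun k => nc (H u k))) /\ nsq (H u) <= opbound ^+ 2 * nsq u.
  apply: nneg_series_cvg; first by move=> k; exact: nc_ge0.
  move=> n.
  have s1 : series (fun k => nc (u k.+1)) n <= nsq u.
    apply: le_trans (series_le_lim n.+1 (fun k => nc_ge0 (u k)) cu).
    by rewrite /series /= [leRHS]big_nat_recl//= lerDr nc_ge0.
  have s2 : series (fun k => if k is k'.+1 then nc (u k') else 0) n <= nsq u.
    case: n {s1} => [|n]; first by rewrite /series /= big_geq// nsq_ge0.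
    rewrite /series /= big_nat_recl//= add0r.
    exact: (series_le_lim n (fun k => nc_ge0 (u k)) cu).
  have s3 : series (fun k => nc (u k)) n <= nsq u.
    exact: (series_le_lim n (fun k => nc_ge0 (u k)) cu).
  apply: (@le_trans _ _ (3 * (nsq u + nsq u + B ^+ 2 * nsq u))).
    apply: (@le_trans _ _ (3 * (series (fun k => nc (u k.+1)) n +
      series (fun k => if k is k'.+1 then nc (u k') else 0) n +
      B ^+ 2 * series (fun k => nc (u k)) n))).
      rewrite /series /= mulr_sumr -!big_split mulr_sumr /=.
      by apply: ler_sum => k _; exact: nc_H.
    by have := ler_wpM2l (sqr_ge0 B) s3; lra.
  have := nsq_ge0 hu; have := B0; rewrite /opbound => b0 n0.
  have : 3 * (2 + B ^+ 2) <= (3 * (1 + B)) ^+ 2 by nra.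
  by move=> /(ler_wpM2r n0); lra.
by split => //; apply/l2E.
Qed.

Lemma l2H u : l2 u -> l2 (H u). Proof. by case/H_bound. Qed.

Lemma l2_iter u n : l2 u -> l2 (iter n H u).
Proof. by move=> hu; elim: n => //= n; exact: l2H. Qed.

Lemma nsq_iter u n : l2 u -> nsq (iter n H u) <= (opbound ^+ 2) ^+ n * nsq u.
Proof.
move=> hu; elim: n => [|n IH]; first by rewrite expr0 mul1r.
have [_ h] := H_bound (@l2_iter u n hu); apply: (le_trans h).
by rewrite [X in _ <= X * _]exprS -[leRHS]mulrA ler_wpM2l// sqr_ge0.
Qed.

(** Green's formula: the difference of the partial sums telescopes to a boundary term, which tends
    to 0 with the entries of u and v. *)
Lemma H_sym u v : l2 u -> l2 v -> rdot (H u) v = rdot u (H v).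
Proof.
move=> hu hv; have hHu := l2H hu; have hHv := l2H hv.
apply/eqP; rewrite -subr_eq0; apply/eqP.
have c1 : cvgn (series (fun k => rd (H u k) (v k))) by exact: cvg_rd.
have c2 : cvgn (series (fun k => rd (u k) (H v k))) by exact: cvg_rd.
rewrite /rdot -limB//.
pose D n := rd (u n.+1) (v n) - rd (u n) (v n.+1).
have e n : series (fun k => rd (H u k) (v k)) n.+1 - series (fun k => rd (u k) (H v k)) n.+1 = D n.
  elim: n => [|n IH].
    rewrite /series /= !big_nat1 /D /schrodinger /rd.
    by case: (u 0%N) (u 1%N) (v 0%N) (v 1%N) => a b [c d] [a' b'] [c' d'] /=; ring.
  rewrite !(seriesSr _ n.+1) opprD addrACA [in LHS]IH /D /schrodinger /rd.
  by case: (u n) (u n.+1) (u n.+2) (v n) (v n.+1) (v n.+2) =>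
    a b [c d] [e f] [a' b'] [c' d'] [e' f'] /=; ring.
apply/cvg_lim => //; rewrite -(cvg_shiftS _ _) /=.
have -> : (fun n => (series (fun k => rd (H u k) (v k)) \- series (fun k => rd (u k) (H v k))) n.+1) = D.
  by apply/funext => n; rewrite -e.
have t0 w : l2 w -> (fun n => nc (w n)) @ \oo --> 0 by move=> /l2E; exact: cvg_series_cvg_0.
have tu := t0 _ hu; have tv := t0 _ hv.
have tu1 : (fun n => nc (u n.+1)) @ \oo --> 0 by rewrite (cvg_shiftS (fun n => nc (u n))).
have tv1 : (fun n => nc (v n.+1)) @ \oo --> 0 by rewrite (cvg_shiftS (fun n => nc (v n))).
pose E n := (nc (u n.+1) + nc (v n)) + (nc (u n) + nc (v n.+1)).
have tE : E @ \oo --> 0.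
  have -> : 0 = (0 + 0) + (0 + 0) :> R by rewrite !addr0.
  by apply: cvgD; apply: cvgD.
apply/cvgrPdist_le => eps e0.
have /cvgrPdist_le /(_ _ e0) := tE; apply: filterS => n.
rewrite !sub0r !normrN; apply: le_trans.
have E0 : 0 <= E n by apply: addr_ge0; apply: addr_ge0; exact: nc_ge0.
rewrite (ger0_norm E0) /D; apply: le_trans (ler_normB _ _) _.
have := rd_le (u n.+1) (v n); have := rd_le (u n) (v n.+1); rewrite /E in E0 *.
have := nc_ge0 (u n); have := nc_ge0 (u n.+1); have := nc_ge0 (v n); have := nc_ge0 (v n.+1).
lra.
Qed.

Lemma H_sym_iter u v n : l2 u -> l2 v -> rdot (iter n H u) v = rdot u (iter n H v).
Proof.
move=> hu; elim: n v => //= n IH v hv.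
rewrite H_sym//; last exact: l2_iter.
by rewrite IH; [rewrite -iterSr -iterS|exact: l2H].
Qed.

Definition pH G u : nat -> C := fun k => \sum_(i < size G) (G`_i)%:C%C * iter i H u k.

Lemma pH_wide n G u : (size G <= n)%N ->
  pH G u = fun k => \sum_(i < n) (G`_i)%:C%C * iter i H u k.
Proof.
move=> sG; apply/funext => k; rewrite /pH -(subnKC sG) big_split_ord /=.
rewrite [X in _ = _ + X]big1 ?addr0// => i _.
by rewrite nth_default ?leq_addr// mul0r.
Qed.

Lemma pHD F G u : pH (F + G) u = addu (pH F u) (pH G u).
Proof.
pose n := maxn (size F) (size G).
rewrite (pH_wide _ (size_polyD F G)) (@pH_wide n F) ?leq_maxl// (@pH_wide n G) ?leq_maxr//.
apply/funext => k; rewrite /addu -big_split; apply: eq_bigr => i _ /=.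
by rewrite coefD rmorphD /= mulrDl.
Qed.

Lemma pHZ a G u : pH (a *: G) u = scu a%:C%C (pH G u).
Proof.
rewrite (pH_wide _ (size_scale_leq a G)).
apply/funext => k; rewrite /scu /pH mulr_sumr; apply: eq_bigr => i _ /=.
by rewrite coefZ rmorphM /= mulrA.
Qed.

Lemma pH_Zr c G u : pH G (scu c u) = scu c (pH G u).
Proof.
have e i : iter i H (scu c u) = scu c (iter i H u) by elim: i => //= i ->; rewrite HZ.
apply/funext => k; rewrite /scu /pH mulr_sumr; apply: eq_bigr => i _ /=.
by rewrite e /scu mulrCA.
Qed.

Lemma pH_Dr G u v : pH G (addu u v) = addu (pH G u) (pH G v).
Proof.
have e i : iter i H (addu u v) = addu (iter i H u) (iter i H v).
  by elim: i => //= i ->; rewrite HD.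
apply/funext => k; rewrite /addu /pH -big_split; apply: eq_bigr => i _ /=.
by rewrite e /addu mulrDr.
Qed.

Lemma H_sum n (c : nat -> C) (w : nat -> nat -> C) :
  H (fun k => \sum_(i < n) c i * w i k) = fun k => \sum_(i < n) c i * H (w i) k.
Proof.
by apply/funext => -[|k]; rewrite /schrodinger mulr_sumr -!big_split;
  apply: eq_bigr => i _ /=; ring.
Qed.

Lemma pHX G u : pH (G * 'X) u = H (pH G u).
Proof.
have s : (size (G * 'X)%R <= (size G).+1)%N.
  by apply: leq_trans (size_polyMleq _ _) _; rewrite size_polyX addn2.
rewrite (pH_wide _ s).
transitivity (fun k => \sum_(i < size G) (G`_i)%:C%C * H (iter i H u) k); last first.
  exact: esym (@H_sum (size G) (fun i => (G`_i)%:C%C) (fun i => iter i H u)).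
apply/funext => k.
rewrite big_ord_recl coefMX eqxx /= mul0r add0r; apply: eq_bigr => i _.
by rewrite /bump /= coefMX.
Qed.

Lemma pHXn n G u : pH (G * 'X^n) u = iter n H (pH G u).
Proof. by elim: n => [|n IH]; rewrite ?expr0 ?mulr1// exprSr mulrA pHX IH. Qed.

Lemma pH_H G u : pH G (H u) = H (pH G u).
Proof.
transitivity (fun k => \sum_(i < size G) (G`_i)%:C%C * H (iter i H u) k); last first.
  exact: esym (@H_sum (size G) (fun i => (G`_i)%:C%C) (fun i => iter i H u)).
apply/funext => k; rewrite /pH; apply: eq_bigr => i _.
by rewrite -iterSr.
Qed.

Lemma pH1 u : pH 1 u = u.
Proof.
by apply/funext => k; rewrite /pH size_poly1 big_ord1 coefC /= mul1r.
Qed.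

Lemma pHB F G u : pH (F - G) u = subu (pH F u) (pH G u).
Proof.
by rewrite pHD -scaleN1r pHZ subuE; congr (addu _ (scu _ _)); rewrite rmorphN1.
Qed.

Lemma l2_pH G u : l2 u -> l2 (pH G u).
Proof.
move=> hu; elim/poly_ind: G => [|G c IH].
  by apply: (@l2_dom _ _ 0 u) => // k; rewrite /pH size_poly0 big_ord0 mul0r /nc /= expr0n /= addr0.
rewrite pHD pHX -alg_polyC pHZ pH1; apply: l2D; [exact: l2H|exact: l2Z].
Qed.

(** By symmetry the product of H^i u and H^j u depends on i + j only, so the Gram matrix is the
    Hankel matrix of the moments. *)
Lemma rdot_pH_sum u (m : nat -> R) F G : l2 u ->
  (forall k, rdot (iter k H u) u = m k) ->
  rdot (pH F u) (pH G u) = \sum_(i < size F) \sum_(j < size G) F`_i * G`_j * m (i + j)%N.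
Proof.
move=> hu hm.
have suml n (c : nat -> R) (w : nat -> nat -> C) v : (forall i, l2 (w i)) -> l2 v ->
    l2 (fun k => \sum_(i < n) (c i)%:C%C * w i k) /\
    rdot (fun k => \sum_(i < n) (c i)%:C%C * w i k) v = \sum_(i < n) c i * rdot (w i) v.
  move=> hw hv; elim: n => [|n [IH1 IH2]].
    have e : (fun k => \sum_(i < 0) (c i)%:C%C * w i k) = scu (0 : R)%:C%C v.
      by apply/funext => k; rewrite big_ord0 /scu mul0r.
    by rewrite e big_ord0 rdotZl// mul0r; split => //; exact: l2Z.
  have e : (fun k => \sum_(i < n.+1) (c i)%:C%C * w i k) =
     addu (fun k => \sum_(i < n) (c i)%:C%C * w i k) (scu (c n)%:C%C (w n)).
    by apply/funext => k; rewrite big_ord_recr.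
  have hn : l2 (scu (c n)%:C%C (w n)) by exact: l2Z.
  rewrite e big_ord_recr /= rdotDl// IH2 rdotZl//; split => //; exact: l2D.
rewrite [LHS](suml (size F) (fun i => F`_i) (fun i => iter i H u) (pH G u)
  (fun i => @l2_iter u i hu) (@l2_pH G u hu)).2.
apply: eq_bigr => i _; rewrite rdot_sym.
rewrite (suml (size G) (fun i => G`_i) (fun i => iter i H u) (iter i H u)
  (fun i => @l2_iter u i hu) (@l2_iter u i hu)).2.
rewrite mulr_sumr; apply: eq_bigr => j _.
rewrite mulrA; congr (_ * _).
by rewrite -H_sym_iter ?hm// -?iterD ?hm//; exact: l2_iter.
Qed.

Section WithMeasure.
Local Notation RM := (measurableTypeR R).
Variables (u : nat -> C) (mu : {finite_measure set RM -> \bar R}).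
Hypotheses (hu : l2 u) (hmu : spectral_measure H u mu).
Local Notation I f := (Rintegral mu setT f).

Lemma spectral_moment k : rdot (iter k H u) u = I (fun x : RM => (x : R) ^+ k).
Proof. by have [_ /(_ k) h] := hmu; rewrite -Re_l2dot h. Qed.

Lemma spectral_support0 : exists2 M : R, 0 < M & mu (~` `[- M, M]%classic) = 0%E.
Proof.
have [[M hM] _] := hmu; exists (`|M| + 1); first by rewrite ltr_wpDl.
apply: subset_measure0 hM.
- by apply: measurableC; exact: measurable_itv.
- by apply: measurableC; exact: measurable_itv.
move=> x h h'; apply: h; move: h'; rewrite /= !in_itv/= => /andP[h1 h2].
by have hn := ler_norm M; apply/andP; split; lra.
Qed.

Lemma spectral_ebd G : ebd mu (fun x : RM => G.[x]).
Proof. by have [M M0 hM] := spectral_support0; exact: ebd_poly M0 hM G. Qed.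

Lemma rdot_pH F G : rdot (pH F u) (pH G u) = I (fun x : RM => F.[x] * G.[x]).
Proof.
rewrite (rdot_pH_sum F G hu spectral_moment).
have eX k : ebd mu (fun x : RM => (x : R) ^+ k).
  by have := spectral_ebd 'X^k; under eq_fun do rewrite hornerXn.
transitivity (I (fun x : RM => \sum_(i < size F) \sum_(j < size G) F`_i * G`_j * (x : R) ^+ (i + j))).
  rewrite Rint_sum; last by move=> i; apply: ebd_sum => j; exact: ebdZ.
  apply: eq_bigr => i _; rewrite Rint_sum; last by move=> j; exact: ebdZ.
  by apply: eq_bigr => j _; rewrite RintZ.
congr Rintegral; apply/funext => x.
rewrite !horner_coef mulr_suml; apply: eq_bigr => i _.
rewrite mulr_sumr; apply: eq_bigr => j _; rewrite exprD; ring.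
Qed.

Lemma nsq_pH G : nsq (pH G u) = I (fun x : RM => G.[x] ^+ 2).
Proof. by rewrite nsq_rdot rdot_pH; congr Rintegral; apply/funext => x; rewrite expr2. Qed.

(** [spectral_measure] only provides some compact support. Markov's inequality for x^(2 (n + 1))
    bounds the outer mass by (opbound / M1)^(2 (n + 1)) times |u|^2, and n tends to infinity. *)
Lemma spectral_support (M1 : R) : opbound < M1 -> mu (~` `[- M1, M1]%classic) = 0%E.
Proof.
move=> hM; set A := ~` _.
have mA : measurable (A : set RM) by apply: measurableC; exact: measurable_itv.
have o0 := opbound_gt0; have M10 : 0 < M1 by lra.
pose q := (opbound ^+ 2) / (M1 ^+ 2).
have hq : `|q| < 1.
  rewrite ger0_norm; last by rewrite divr_ge0// sqr_ge0.
  by rewrite ltr_pdivrMr ?exprn_gt0// mul1r ltrXn2r// ltW.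
have h n : fine (mu A) <= q ^+ n.+1 * nsq u.
  have t0 : 0 < (M1 ^+ 2) ^+ n.+1 by rewrite !exprn_gt0.
  have eb : ebd mu (fun x : RM => ('X^(n.+1) : {poly R}).[x] ^+ 2).
    by apply: ebdX; exact: spectral_ebd.
  have := markov_ebd eb _ t0; rewrite -nsq_pH -(mul1r 'X^_) pHXn pH1 => hm.
  apply: le_trans (_ : fine (mu [set x : RM | (M1 ^+ 2) ^+ n.+1 < (1 * 'X^(n.+1) : {poly R}).[x] ^+ 2]) <= _).
    have mB : measurable ([set x : RM | (M1 ^+ 2) ^+ n.+1 < (1 * 'X^(n.+1) : {poly R}).[x] ^+ 2]).
      rewrite mul1r; have := eb.1 measurableT `](M1 ^+ 2) ^+ n.+1, +oo[%classic (measurable_itv _).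
      rewrite setTI; congr measurable; apply/seteqP; split => x /=; rewrite in_itv/= andbT//.
    apply: fine_le; rewrite ?fin_num_measure//.
    apply: le_measure; rewrite ?inE// => x /= hx.
    have hx1 : M1 ^+ 2 < (x : R) ^+ 2.
      rewrite -(real_normK (num_real (x : R))) ltrXn2r ?ltW//.
      by move: hx; rewrite /A /= in_itv/= -ler_norml => /negP; rewrite -ltNge.
    by rewrite mul1r hornerXn [ltRHS]exprAC ltrXn2r// sqr_ge0.
  apply: le_trans (hm _) _; first by apply: aeW => x; exact: sqr_ge0.
  rewrite ler_pdivrMr// /q expr_div_n mulrAC divfK ?gt_eqF//.
  exact: nsq_iter.
have c : (fun n => q ^+ n.+1 * nsq u) @ \oo --> 0.
  rewrite -(mul0r (nsq u)); apply: cvgM; last exact: cvg_cst.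
  rewrite (cvg_shiftS (fun n => q ^+ n)); exact: cvg_expr.
have : fine (mu A) <= 0.
  by rewrite -(cvg_lim _ c)//; apply: limr_ge; [apply/cvg_ex; exists 0|exact: nearW].
move=> h0; apply/eqP; rewrite eq_le measure_ge0 andbT.
by rewrite -[leLHS]fineK ?fin_num_measure.
Qed.

End WithMeasure.

End Operator.

(** * Measures with bounded density and the Hahn comparison of two measures *)

Section Density.
Context d (T : measurableType d) (R : realType) (mu : {finite_measure set T -> \bar R}).
Local Open Scope charge_scope.
Local Open Scope ereal_scope.

Definition bounded_density (h : T -> R) (K : R) :=
  measurable_fun setT h /\ forall x, (0 <= h x <= K)%R.

(** The measure h mu. The proof that h is bounded is an argument of the term, so that the finite
    measure structure can be attached to it. *)
Definition dens (h : T -> R) (K : R) of bounded_density h K : set T -> \bar R :=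
  fun A => \int[mu]_(x in A) (h x)%:E.

Variables (h : T -> R) (K : R) (hK : bounded_density h K).

Lemma density_ebd : ebd mu h.
Proof.
case: hK => mh hb; apply: (@ebd_bounded _ _ _ mu h K) => // x.
by have /andP[h1 h2] := hb x; rewrite ger0_norm.
Qed.

Let h_int : mu.-integrable setT (EFin \o h). Proof. exact/ebd_integrable/density_ebd. Qed.

Let dens0 : dens hK set0 = 0. Proof. by rewrite /dens integral_set0. Qed.

Let dens_ge0 A : 0 <= dens hK A.
Proof.
by apply: integral_ge0 => x _; rewrite lee_fin; case: hK => _ /(_ x) /andP[].
Qed.

Let dens_sigma_additive : semi_sigma_additive (dens hK).
Proof.
move=> /= A mA tA mUA; rewrite /dens/= integral_bigcup//=; last first.
  by apply: (integrableS _ _ (subsetT _)) => //; exact: h_int.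
apply: is_cvg_ereal_nneg_natsum_cond => n _ _; exact: dens_ge0.
Qed.

HB.instance Definition _ := isMeasure.Build _ _ _ (dens hK)
  dens0 dens_ge0 dens_sigma_additive.

Let dens_fin : fin_num_fun (dens hK).
Proof.
move=> A mA; rewrite /dens; apply: integrable_fin_num => //.
by apply: (integrableS measurableT) => //; exact: h_int.
Qed.

HB.instance Definition _ := Measure_isFinite.Build _ _ _ (dens hK) dens_fin.

Lemma dens_dominated : dens hK `<< mu.
Proof.
apply/null_content_dominatesP => A mA A0; rewrite /dens; apply: null_set_integral => //.
by apply: measurable_funTS; apply/measurable_EFinP; case: hK.
Qed.

(** By uniqueness h agrees almost everywhere with the Radon-Nikodym derivative of [dens], and the
    change of variables for that derivative applies. *)
Lemma Rintegral_dens (f : T -> R) : ebd mu f -> ebd (dens hK : {finite_measure set T -> \bar R}) f ->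
  Rintegral (dens hK) setT f = Rintegral mu setT (fun x => f x * h x)%R.
Proof.
move=> ef ef'; rewrite /Rintegral; congr fine.
pose nu : {finite_measure set T -> \bar R} := dens hK.
rewrite -[LHS](@Radon_Nikodym_change_of_variables _ _ _ nu mu dens_dominated) //; last first.
  exact: ebd_integrable.
have numu : (charge_of_finite_measure nu) `<< mu by exact: dens_dominated.
have ae : ae_eq mu setT ('d (charge_of_finite_measure nu) '/d mu) (EFin \o h).
  apply: integral_ae_eq => //.
  - exact: Radon_Nikodym_integrable.
  - by apply/measurable_EFinP; case: hK.
  - by move=> E _ mE; rewrite -Radon_Nikodym_integral.
apply: ae_eq_integral => //.
- apply: emeasurable_funM; first by apply/measurable_EFinP; case: ef.
  exact: measurable_int (Radon_Nikodym_integrable numu).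
- by apply/measurable_EFinP; apply: measurable_funM; [case: ef|case: hK].
- by apply: filterS ae => x hx Dx; rewrite /= hx// EFinM.
Qed.

End Density.

Section Hahn.
Context d (T : measurableType d) (R : realType).
Variables (mu nu : {finite_measure set T -> \bar R}) (c : R).
Local Open Scope ereal_scope.

(** D is the positive set in a Hahn decomposition of the signed measure mu - c nu. *)
Lemma hahn_compare : exists D : set T, [/\ measurable D,
   forall A, measurable A -> A `<=` D -> c%:E * nu A <= mu A &
   forall A, measurable A -> A `<=` ~` D -> mu A <= c%:E * nu A].
Proof.
pose m1 : {charge set T -> \bar R} := charge_of_finite_measure mu.
pose m2 : {charge set T -> \bar R} := cscale (- c) (charge_of_finite_measure nu).
have [P [N [[mP hP] [mN hN] PN PN0]]] := Hahn_decomposition (cadd m1 m2).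
exists P; split => // A mA AP.
  have : 0 <= mu A + (- c)%:E * nu A := hP A mA AP.
  rewrite -[mu A]fineK ?fin_num_measure// -[nu A]fineK ?fin_num_measure//.
  by rewrite -!EFinM -EFinD !lee_fin mulNr subr_ge0.
have AN : A `<=` N.
  move=> x /AP nP; have : (P `|` N) x by rewrite PN.
  by case.
have : mu A + (- c)%:E * nu A <= 0 := hN A mA AN.
rewrite -[mu A]fineK ?fin_num_measure// -[nu A]fineK ?fin_num_measure//.
by rewrite -!EFinM -EFinD !lee_fin mulNr subr_le0.
Qed.

End Hahn.

(** * The spectral transform *)

Section Transform.
Variables (R : realType) (V : nat -> R) (B : R).
Hypothesis hV : forall n, `|V n.+1| <= B.
Local Notation C := R[i].
Local Notation H := (schrodinger V).
Local Notation RM := (measurableTypeR R).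
Local Notation b := (fun k => V k.+1).
Variables (M : R) (mu : {finite_measure set RM -> \bar R}).
Hypothesis hmu : spectral_of b M mu.
Local Notation I f := (Rintegral mu setT f).
Implicit Types (u v w : nat -> C) (F G : {poly R}) (g : RM -> R).

Let M0 : 0 < M. Proof. by case: hmu. Qed.
Let musupp : mu (~` `[- M, M]%classic) = 0%E. Proof. by case: hmu. Qed.
Let eP G : ebd mu (fun x : RM => G.[x]). Proof. exact: (ebd_poly M0 musupp). Qed.

Lemma P_orth j k : I (fun x : RM => (P b j).[x] * (P b k).[x]) = (j == k)%:R.
Proof.
have [_ _ hq] := hmu.
pose n := (size (P b j * P b k) + (j + k)).+1.
have -> : (fun x : RM => (P b j).[x] * (P b k).[x]) = fun x => (P b j * P b k).[x].
  by apply/funext => x; rewrite hornerM.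
rewrite (hq _ n)//; last by rewrite /n ltnW// ltnS leq_addr.
have jn : (j < n)%N by rewrite /n; lia.
have kn : (k < n)%N by rewrite /n; lia.
rewrite -(@gauss_orth R b n j k jn kn).
by apply: eq_bigr => x _; rewrite hornerM.
Qed.

Definition pint g n := I (fun x => g x * (P b n).[x]).

(** Membership in the closure of the polynomials in L^2(mu), which is what turns Bessel's inequality
    into Parseval's equality. *)
Definition approximable g := ebd mu g /\
  forall e : R, 0 < e -> exists Q : {poly R}, I (fun x => (g x - Q.[x]) ^+ 2) <= e.

Lemma approximable_poly G : approximable (fun x : RM => G.[x]).
Proof.
split=> // e e0; exists G; rewrite (_ : (fun x => _) = fun=> 0).
  by rewrite Rint_cst mul0r ltW.
by apply/funext => x; rewrite subrr expr0n.
Qed.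

Lemma approximable_polyM G g : approximable g -> approximable (fun x : RM => G.[x] * g x).
Proof.
move=> [eg hg]; split; first exact: ebdM.
move=> e e0; pose K := \sum_(i < size G) `|G`_i| * M ^+ i.
have K0 : 0 <= K by rewrite sumr_ge0// => i _; rewrite mulr_ge0// exprn_ge0// ltW.
have e1 : 0 < e / (K ^+ 2 + 1) by rewrite divr_gt0// ltr_wpDl// sqr_ge0.
have [Q hQ] := hg _ e1; exists (G * Q).
apply: (@le_trans _ _ (I (fun x => K ^+ 2 * (g x - Q.[x]) ^+ 2))).
  apply: Rint_ae_le.
  - by apply: ebdX; apply: ebdB => //; exact: ebdM.
  - by apply: ebdZ; apply: ebdX; exact: ebdB.
  - apply: (ae_support musupp) => x xM; rewrite hornerM -mulrBr exprMn ler_wpM2r ?sqr_ge0//.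
    rewrite -(real_normK (num_real G.[x])) lerXn2r ?nnegrE//.
    exact: horner_bound.
rewrite RintZ; last by apply: ebdX; exact: ebdB.
apply: (@le_trans _ _ (K ^+ 2 * (e / (K ^+ 2 + 1)))); first by rewrite ler_wpM2l// sqr_ge0.
rewrite mulrCA ler_piMr ?(ltW e0)// ler_pdivrMr ?mul1r ?lerDl// ltr_wpDl// sqr_ge0//.
Qed.

(** With c = [pint g] this is Bessel's inequality; with c the coefficients of an approximating
    polynomial it bounds the defect in Parseval's formula. *)
Lemma bessel_identity g N (c : nat -> R) : ebd mu g ->
  I (fun x => (g x - (\sum_(n < N) c n *: P b n).[x]) ^+ 2) =
  I (fun x => g x ^+ 2) - \sum_(n < N) pint g n ^+ 2 + \sum_(n < N) (c n - pint g n) ^+ 2.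
Proof.
move=> eg; set S := \sum_(n < N) _.
have SE x : S.[x] = \sum_(n < N) c n * (P b n).[x].
  by rewrite horner_sum; apply: eq_bigr => i _; rewrite hornerZ.
have -> : (fun x => (g x - S.[x]) ^+ 2) =
  fun x : RM => (g x ^+ 2 - 2 * (g x * S.[x])) + S.[x] ^+ 2.
  by apply/funext => x; ring.
have egS : ebd mu (fun x : RM => g x * S.[x]) by exact: ebdM.
rewrite RintD; [|by apply: ebdB; [exact: ebdX|exact: ebdZ]|exact: ebdX].
rewrite RintB; [|exact: ebdX|exact: ebdZ].
rewrite RintZ//.
have -> : I (fun x : RM => g x * S.[x]) = \sum_(n < N) c n * pint g n.
  transitivity (I (fun x : RM => \sum_(n < N) c n * (g x * (P b n).[x]))).
    congr Rintegral; apply/funext => x; rewrite SE mulr_sumr.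
    by apply: eq_bigr => i _; rewrite mulrCA.
  rewrite Rint_sum; last by move=> i; apply: ebdZ; exact: ebdM.
  by apply: eq_bigr => i _; rewrite RintZ//; exact: ebdM.
have -> : I (fun x : RM => S.[x] ^+ 2) = \sum_(n < N) c n ^+ 2.
  transitivity (I (fun x : RM => \sum_(n < N) \sum_(m < N) (c n * c m) *
     ((P b n).[x] * (P b m).[x]))).
    congr Rintegral; apply/funext => x; rewrite SE expr2 mulr_suml.
    apply: eq_bigr => i _; rewrite mulr_sumr.
    by apply: eq_bigr => j _; ring.
  rewrite Rint_sum; last by move=> i; apply: ebd_sum => j; apply: ebdZ; exact: ebdM.
  apply: eq_bigr => i _; rewrite Rint_sum; last by move=> j; apply: ebdZ; exact: ebdM.
  rewrite (bigD1 i)//= RintZ; last exact: ebdM.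
  rewrite P_orth eqxx mulr1 big1 ?addr0 ?expr2// => j ji.
  rewrite RintZ; last exact: ebdM.
  by rewrite P_orth -[_ == _ :> nat]/(i == j) eq_sym (negPf ji) mulr0.
have -> : \sum_(n < N) (c n - pint g n) ^+ 2 =
  \sum_(n < N) c n ^+ 2 - 2 * (\sum_(n < N) c n * pint g n) + \sum_(n < N) pint g n ^+ 2.
  rewrite mulr_sumr -sumrB -big_split; apply: eq_bigr => i _ /=; ring.
ring.
Qed.

Lemma parseval g : approximable g -> series (fun n => pint g n ^+ 2) @ \oo --> I (fun x => g x ^+ 2).
Proof.
move=> [eg hg].
have ub N : series (fun n => pint g n ^+ 2) N <= I (fun x => g x ^+ 2).
  have := bessel_identity N (pint g) eg.
  rewrite [X in _ = _ - _ + X]big1 ?addr0; last by move=> i _; rewrite subrr expr0n.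
  rewrite -(big_mkord xpredT (fun n => pint g n ^+ 2)) => h.
  rewrite -subr_ge0 -h; apply: Rint_ae_ge0; last by apply: aeW => x; exact: sqr_ge0.
  by apply: ebdX; exact: ebdB.
apply/cvgrPdist_le => e e0; have [Q hQ] := hg e e0.
exists (size Q) => // N /= hN.
have [c hc] := P_basis b hN.
have := bessel_identity N c eg; rewrite -hc => h.
have := ub N; rewrite ger0_norm ?subr_ge0//; move=> _.
have s0 : 0 <= \sum_(n < N) (c n - pint g n) ^+ 2.
  by apply: sumr_ge0 => i _; exact: sqr_ge0.
by move: h; rewrite -(big_mkord xpredT (fun n => pint g n ^+ 2)) /series /=; lra.
Qed.

(* The inverse spectral transform of g1 + i g2. *)
Definition U g1 g2 : nat -> C := fun n => (pint g1 n +i* pint g2 n)%C.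

Lemma U_nsq g1 g2 : approximable g1 -> approximable g2 ->
  l2 (U g1 g2) /\ nsq (U g1 g2) = I (fun x => g1 x ^+ 2) + I (fun x => g2 x ^+ 2).
Proof.
move=> h1 h2.
have e : series (fun k => nc (U g1 g2 k)) =
  series (fun n => pint g1 n ^+ 2) \+ series (fun n => pint g2 n ^+ 2).
  by apply/funext => n; rewrite /series /= -big_split.
have c : series (fun k => nc (U g1 g2 k)) @ \oo -->
    (I (fun x => g1 x ^+ 2) + I (fun x => g2 x ^+ 2)).
  by rewrite e; apply: cvgD; exact: parseval.
by split; [apply/l2E; apply/cvg_ex; eexists; exact: c|apply/cvg_lim].
Qed.

(** The three-term recurrence of the orthonormal polynomials: multiplication by x becomes the
    operator on coefficients, and [Pm] at 0 being zero is the boundary condition. *)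
Lemma pint_rec g n : ebd mu g ->
  pint (fun x : RM => (x : R) * g x) n =
  pint g n.+1 + (if n is m.+1 then pint g m else 0) + b n * pint g n.
Proof.
move=> eg.
have epm G : ebd mu (fun x : RM => g x * G.[x]) by exact: ebdM.
have -> : (if n is m.+1 then pint g m else 0) = I (fun x : RM => g x * (Pm b n).[x]).
  case: n => [|n]; last by rewrite PmS.
  rewrite Pm0 (_ : (fun x => _) = fun=> 0) ?Rint_cst ?mul0r//.
  by apply/funext => x; rewrite horner0 mulr0.
rewrite /pint -RintZ// -RintD// -RintD//; last 2 first.
- exact: ebdD.
- exact: ebdZ.
have gen (p q : {poly R}) c x : (('X - c%:P) * p - q).[x] = (x - c) * p.[x] - q.[x].
  by rewrite !hornerE.
by congr Rintegral; apply/funext => x; rewrite PS gen; ring.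
Qed.

Lemma H_U g1 g2 : ebd mu g1 -> ebd mu g2 ->
  H (U g1 g2) = U (fun x : RM => (x : R) * g1 x) (fun x : RM => (x : R) * g2 x).
Proof.
move=> h1 h2; apply/funext => n; apply/eqP; rewrite eq_complex.
by case: n => [|n]; rewrite /= !pint_rec//=; apply/andP; split; apply/eqP; ring.
Qed.

Lemma iter_U n g1 g2 : ebd mu g1 -> ebd mu g2 ->
  iter n H (U g1 g2) = U (fun x : RM => (x : R) ^+ n * g1 x) (fun x : RM => (x : R) ^+ n * g2 x).
Proof.
have eX k g : ebd mu g -> ebd mu (fun x : RM => (x : R) ^+ k * g x).
  move=> eg; apply: ebdM => //.
  by have := eP 'X^k; under eq_fun do rewrite hornerXn.
move=> h1 h2; elim: n => [|n IH] /=.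
  by under eq_fun do rewrite expr0 mul1r; under [in X in _ = U _ X]eq_fun do rewrite expr0 mul1r.
rewrite IH H_U; [|exact: eX|exact: eX].
by congr U; apply/funext => x; rewrite exprS mulrA.
Qed.

Lemma pH_U G g1 g2 : ebd mu g1 -> ebd mu g2 ->
  pH V G (U g1 g2) = U (fun x : RM => G.[x] * g1 x) (fun x : RM => G.[x] * g2 x).
Proof.
move=> h1 h2.
have eX k g : ebd mu g -> ebd mu (fun x : RM => (x : R) ^+ k * g x).
  move=> eg; apply: ebdM => //.
  by have := eP 'X^k; under eq_fun do rewrite hornerXn.
have key g k : ebd mu g -> pint (fun x : RM => G.[x] * g x) k =
  \sum_(i < size G) G`_i * pint (fun x : RM => (x : R) ^+ i * g x) k.
  move=> eg; rewrite /pint.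
  transitivity (I (fun x : RM => \sum_(i < size G) G`_i * ((x : R) ^+ i * g x * (P b k).[x]))).
    congr Rintegral; apply/funext => x; rewrite horner_coef -mulrA mulr_suml.
    by apply: eq_bigr => i _; ring.
  rewrite Rint_sum; last by move=> i; apply: ebdZ; apply: ebdM => //; exact: eX.
  by apply: eq_bigr => i _; rewrite RintZ//; apply: ebdM => //; exact: eX.
apply/funext => k; rewrite /pH /U !key//.
under eq_bigr do rewrite iter_U// /U.
elim/big_rec3: _ => // i z x y _ ->.
by apply/eqP; rewrite eq_complex /=; apply/andP; split; apply/eqP; ring.
Qed.

Definition trunc N u : nat -> C := fun k => if (k < N)%N then u k else 0.

(** A finitely supported sequence is the transform of the corresponding combination of the [P k].
    Through truncations, statements on arbitrary vectors reduce to transforms of polynomials. *)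
Lemma trunc_U N u : exists G1 G2, trunc N u = U (fun x : RM => G1.[x]) (fun x : RM => G2.[x]).
Proof.
pose S (c : nat -> R) := \sum_(k < N) c k *: P b k.
have hS c k : pint (fun x : RM => (S c).[x]) k = if (k < N)%N then c k else 0.
  rewrite /pint.
  transitivity (I (fun x : RM => \sum_(n < N) c n * ((P b n).[x] * (P b k).[x]))).
    congr Rintegral; apply/funext => x; rewrite horner_sum mulr_suml.
    by apply: eq_bigr => i _; rewrite hornerZ mulrA.
  rewrite Rint_sum; last by move=> i; apply: ebdZ; exact: ebdM.
  transitivity (\sum_(n < N) c n * ((n : nat) == k)%:R).
    by apply: eq_bigr => i _; rewrite RintZ ?P_orth//; exact: ebdM.
  case: ltnP => kN.
    rewrite (bigD1 (Ordinal kN))//= eqxx mulr1 big1 ?addr0// => i.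
    by rewrite -(inj_eq val_inj) /= => /negPf ->; rewrite mulr0.
  by rewrite big1// => i _; rewrite ltn_eqF ?mulr0// (leq_trans (ltn_ord i)).
exists (S (fun k => complex.Re (u k))), (S (fun k => complex.Im (u k))).
apply/funext => k; rewrite /trunc /U !hS; case: ifP => // _.
by case: (u k).
Qed.

Lemma trunc_l2 N u : l2 u -> l2 (trunc N u) /\ nsq (trunc N u) <= nsq u.
Proof.
move=> /l2E cu.
have [h1 h2] : cvgn (series (fun k => nc (trunc N u k))) /\ nsq (trunc N u) <= nsq u.
  apply: nneg_series_cvg; first by move=> k; exact: nc_ge0.
  move=> n; apply: le_trans (series_le_lim n (fun k => nc_ge0 (u k)) cu).
  apply: ler_sum => k _; rewrite /trunc; case: ifP => // _.
  by rewrite [leLHS]/nc /= expr0n /= addr0 nc_ge0.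
by split => //; apply/l2E.
Qed.

Lemma trunc_cvg u : l2 u -> (fun N => nsq (subu u (trunc N u))) @ \oo --> 0.
Proof.
move=> hu; have /l2E cu := hu.
have h N : nsq (subu u (trunc N u)) <= nsq u - series (fun k => nc (u k)) N.
  apply: (nneg_series_cvg _ _).2; first by move=> k; exact: nc_ge0.
  move=> n.
  have -> : series (fun k => nc (subu u (trunc N u) k)) n =
    series (fun k => nc (u k)) n - series (fun k => nc (u k)) (minn n N).
    elim: n => [|n IH]; first by rewrite min0n subrr /series /= big_geq.
    rewrite !seriesSr IH /subu /trunc; case: ifPn => [nN|]; last rewrite -leqNgt => nN.
      rewrite (minn_idPl (ltnW nN)) (minn_idPl nN) seriesSr !subrr.
      by rewrite [X in _ + X]/nc /= expr0n /=; ring.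
    by rewrite (minn_idPr nN) (minn_idPr (leqW nN)) subr0; ring.
  have [nN|nN] := leqP n N.
    by rewrite subrr subr_ge0; exact: (series_le_lim N (fun k => nc_ge0 (u k)) cu).
  by rewrite lerD2r; exact: (series_le_lim n (fun k => nc_ge0 (u k)) cu).
apply: (@squeeze_cvgr _ _ _ _ (cst 0) (fun N => nsq u - series (fun k => nc (u k)) N)).
- apply: nearW => N; rewrite h andbT; apply: nsq_ge0; apply: l2B => //.
  by case: (trunc_l2 N hu).
- exact: cvg_cst.
- by rewrite -[X in _ --> X](subrr (nsq u)); apply: cvgB => //; exact: cvg_cst.
Qed.

Lemma cvgu_trunc u : cvgu (fun N => trunc N u) u.
Proof.
by move=> k; split; apply: cvg_near_cst; exists k.+1 => // N /= kN; rewrite /trunc kN.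
Qed.

Lemma cvgu_H (w : nat -> nat -> C) y : cvgu w y -> cvgu (fun j => H (w j)) (H y).
Proof.
move=> h [|k]; rewrite /schrodinger.
  have [a0 b0] := h 0%N; have [a1 b1] := h 1%N; split.
    have e (z t : C) : complex.Re (z + (V 1%N)%:C%C * t) = complex.Re z + V 1%N * complex.Re t.
      by case: z t => ? ? [? ?] /=; ring.
    under eq_fun do rewrite e; rewrite e; apply: cvgD => //; apply: cvgM => //; exact: cvg_cst.
  have e (z t : C) : complex.Im (z + (V 1%N)%:C%C * t) = complex.Im z + V 1%N * complex.Im t.
    by case: z t => ? ? [? ?] /=; ring.
  under eq_fun do rewrite e; rewrite e; apply: cvgD => //; apply: cvgM => //; exact: cvg_cst.
have [a0 b0] := h k; have [a1 b1] := h k.+1; have [a2 b2] := h k.+2; split.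
  have e (z z' t : C) : complex.Re (z + z' + (V k.+2)%:C%C * t) =
      complex.Re z + complex.Re z' + V k.+2 * complex.Re t.
    by case: z z' t => ? ? [? ?] [? ?] /=; ring.
  under eq_fun do rewrite e; rewrite e; apply: cvgD; [exact: cvgD|].
  by apply: cvgM => //; exact: cvg_cst.
have e (z z' t : C) : complex.Im (z + z' + (V k.+2)%:C%C * t) =
    complex.Im z + complex.Im z' + V k.+2 * complex.Im t.
  by case: z z' t => ? ? [? ?] [? ?] /=; ring.
under eq_fun do rewrite e; rewrite e; apply: cvgD; [exact: cvgD|].
by apply: cvgM => //; exact: cvg_cst.
Qed.

Lemma cvgu_addsc (c : R) (w w' : nat -> nat -> C) y y' : cvgu w y -> cvgu w' y' ->
  cvgu (fun j => addu (w j) (scu c%:C%C (w' j))) (addu y (scu c%:C%C y')).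
Proof.
move=> h h' k; have [a0 b0] := h k; have [a1 b1] := h' k; rewrite /addu /scu; split.
  have e (z t : C) : complex.Re (z + c%:C%C * t) = complex.Re z + c * complex.Re t.
    by case: z t => ? ? [? ?] /=; ring.
  by under eq_fun do rewrite e; rewrite e; apply: cvgD => //; apply: cvgM => //; exact: cvg_cst.
have e (z t : C) : complex.Im (z + c%:C%C * t) = complex.Im z + c * complex.Im t.
  by case: z t => ? ? [? ?] /=; ring.
by under eq_fun do rewrite e; rewrite e; apply: cvgD => //; apply: cvgM => //; exact: cvg_cst.
Qed.

Lemma cvgu_pH G (w : nat -> nat -> C) y : cvgu w y -> cvgu (fun j => pH V G (w j)) (pH V G y).
Proof.
move=> h; elim/poly_ind: G => [|G c IH].
  have e u k : pH V 0 u k = 0 by rewrite /pH size_poly0 big_ord0.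
  by move=> k; split; under eq_fun do rewrite e; rewrite e; exact: cvg_cst.
have e u : pH V (G * 'X + c%:P) u = addu (H (pH V G u)) (scu c%:C%C u).
  by rewrite pHD pHX -alg_polyC pHZ pH1.
rewrite e; under eq_fun do rewrite e.
by apply: cvgu_addsc => //; exact: cvgu_H.
Qed.

(** For transforms of polynomials G(H) is multiplication by G in L^2(mu). Truncations extend the
    bound to all vectors by Fatou. *)
Lemma nsq_pH_le G (K : R) u : l2 u -> (forall x, `|x| <= M -> `|G.[x]| <= K) ->
  nsq (pH V G u) <= K ^+ 2 * nsq u.
Proof.
move=> hu hK.
have hl N : l2 (pH V G (trunc N u)) by apply: (l2_pH hV); case: (trunc_l2 N hu).
suff h N : nsq (pH V G (trunc N u)) <= K ^+ 2 * nsq u.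
  by have [] := nsq_fatou (cvgu_pH G (cvgu_trunc u)) hl (nearW _ h).
have [G1 [G2 hG]] := trunc_U N u.
have [_ h2] := trunc_l2 N hu.
apply: (@le_trans _ _ (K ^+ 2 * nsq (trunc N u))); last by rewrite ler_wpM2l// sqr_ge0.
rewrite hG pH_U//.
rewrite (U_nsq _ _).2; [|exact: approximable_polyM (approximable_poly _)..].
rewrite (U_nsq (approximable_poly _) (approximable_poly _)).2 mulrDr.
have key F : I (fun x : RM => (G.[x] * F.[x]) ^+ 2) <= K ^+ 2 * I (fun x : RM => F.[x] ^+ 2).
  rewrite -RintZ; last exact: ebdX.
  apply: Rint_ae_le; [by apply: ebdX; exact: ebdM|by apply: ebdZ; exact: ebdX|].
  apply: (ae_support musupp) => x xM; rewrite exprMn ler_wpM2r ?sqr_ge0//.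
  by rewrite -(real_normK (num_real G.[x])) lerXn2r ?nnegrE// ?(le_trans _ (hK x xM))// hK.
exact: lerD.
Qed.

End Transform.

Section RealMoments.
Variables (R : realType) (V : nat -> R) (B : R).
Hypothesis hV : forall n, `|V n.+1| <= B.
Local Notation C := R[i].
Local Notation H := (schrodinger V).

(** The imaginary part is the real product of -i H^k u with u. Symmetry of H, and the adjoint of -i
    being its negative, make it equal to its own opposite. *)
Lemma l2dot_iter_real (u : nat -> C) k : l2 u ->
  l2dot (iter k H u) u = (rdot (iter k H u) u)%:C%C.
Proof.
move=> hu; apply/eqP; rewrite eq_complex Re_l2dot eqxx /=; apply/eqP.
have -> : limn (series (fun j => complex.Im (iter k H u j * conjc (u j)))) =
   rdot (scu (- 'i)%C (iter k H u)) u.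
  rewrite /rdot; congr (limn (series _)); apply/funext => j; rewrite /rd /scu.
  by case: (iter k H u j) (u j) => a b [c d] /=; ring.
have hk : l2 (iter k H u) by exact: l2_iter.
set i := (- 'i)%C.
have e : scu i (iter k H u) = iter k H (scu i u) by elim: k {hk} => //= k IH; rewrite -IH HZ.
have h : rdot (scu i (iter k H u)) u = - rdot (scu i (iter k H u)) u.
  rewrite [LHS]rdot_adj.
  have -> : scu (conjc i) u = scu (-1 : R)%:C%C (scu i u).
    by apply/funext => j; rewrite /scu mulrA; congr (_ * _);
      apply/eqP; rewrite eq_complex /=; apply/andP; split; apply/eqP; ring.
  have hi : l2 (scu i u) by exact: l2Z.
  by rewrite rdotZr// mulN1r (H_sym_iter hV)// -e rdot_sym.
lra.
Qed.

End RealMoments.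

(** * Spectral measures of transforms, and their comparison with [mu] *)

Section Transfer.
Variables (R : realType) (V : nat -> R) (B : R).
Hypothesis hV : forall n, `|V n.+1| <= B.
Local Notation C := R[i].
Local Notation H := (schrodinger V).
Local Notation RM := (measurableTypeR R).
Local Notation b := (fun k => V k.+1).
Variables (M : R) (mu : {finite_measure set RM -> \bar R}).
Hypothesis hmu : spectral_of b M mu.
Local Notation I f := (Rintegral mu setT f).
Implicit Types (u v w : nat -> C) (F G : {poly R}) (g : RM -> R).

Let M0 : 0 < M. Proof. by case: hmu. Qed.
Let musupp : mu (~` `[- M, M]%classic) = 0%E. Proof. by case: hmu. Qed.
Let eP G : ebd mu (fun x : RM => G.[x]). Proof. exact: (ebd_poly M0 musupp). Qed.

(** Parseval computes norms of transforms only, so the moments come from polarisation: 4 <H^k u, u>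
    is the difference of the squared norms of (H^k + 1) u and (H^k - 1) u. *)
Lemma U_spectral g1 g2 (K : R) (hd : bounded_density (fun x => g1 x ^+ 2 + g2 x ^+ 2) K) :
  approximable mu g1 -> approximable mu g2 ->
  spectral_measure H (U V mu g1 g2) (dens mu hd).
Proof.
move=> h1 h2; have [e1 _] := h1; have [e2 _] := h2.
have dsupp : dens mu hd (~` `[- M, M]%classic) = 0%E.
  have /null_content_dominatesP := @dens_dominated _ _ _ mu _ _ hd; apply => //.
  by apply: measurableC; exact: measurable_itv.
split; first by exists M.
move=> k; have hu := (U_nsq hmu h1 h2).1.
rewrite (l2dot_iter_real hV)//; congr (_%:C%C).
set u := U V mu g1 g2 in hu *.
have hk : l2 (iter k H u) by exact: (l2_iter hV).
have h4 : 4 * rdot (iter k H u) u = nsq (addu (iter k H u) u) - nsq (subu (iter k H u) u).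
  by rewrite nsqD// nsqB//; ring.
have hX : pH V 'X^k u = iter k H u by rewrite -[X in pH V X](mul1r 'X^k) pHXn pH1.
have eX : ebd mu (fun x : RM => (x : R) ^+ k).
  by have := eP 'X^k; under eq_fun do rewrite hornerXn.
have nsqG G : nsq (pH V G u) = I (fun x : RM => G.[x] ^+ 2 * (g1 x ^+ 2 + g2 x ^+ 2)).
  rewrite /u (pH_U hmu)// (U_nsq hmu _ _).2; [|exact: (approximable_polyM hmu)..].
  rewrite -RintD; [|by apply: ebdX; exact: ebdM|by apply: ebdX; exact: ebdM].
  by congr Rintegral; apply/funext => x; rewrite !exprMn mulrDr.
apply: (@mulfI _ (4 : R)); first by rewrite gt_eqF.
have eG G : ebd mu (fun x : RM => G.[x] ^+ 2 * (g1 x ^+ 2 + g2 x ^+ 2)).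
  by apply: ebdM; [exact: ebdX|apply: ebdD; exact: ebdX].
have eh : ebd mu (fun x => g1 x ^+ 2 + g2 x ^+ 2) by apply: ebdD; exact: ebdX.
rewrite h4; have -> : addu (iter k H u) u = pH V ('X^k + 1) u by rewrite pHD hX pH1.
have -> : subu (iter k H u) u = pH V ('X^k - 1) u by rewrite pHB hX pH1.
rewrite !nsqG -RintB// Rintegral_dens//; last first.
  have -> : (fun x : RM => (x : R) ^+ k) = fun x : RM => ('X^k : {poly R}).[x].
    by apply/funext => x; rewrite hornerXn.
  exact: (ebd_poly M0 dsupp).
rewrite -RintZ; last exact: ebdM.
congr Rintegral; apply/funext => x.
have -> : ('X^k + 1 : {poly R}).[x] = (x : R) ^+ k + 1 by rewrite hornerD hornerXn hornerC.
have -> : ('X^k - 1 : {poly R}).[x] = (x : R) ^+ k - 1.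
  by rewrite hornerD hornerN hornerXn hornerC.
move: ((x : R) ^+ k) (g1 x) (g2 x) => a c d; ring.
Qed.

(** The first site is cyclic, so every spectral measure is dominated by mu. With P close to the
    indicator of K, nu K is at most |P(H) u|^2; on a truncation of u this is controlled by the small
    L^2(mu) norm of P, on the remainder by |P| <= 2. *)
Lemma null_transfer_closed u (nu : {finite_measure set RM -> \bar R}) (K : set R) :
  opbound B < M -> l2 u -> spectral_measure H u nu -> closed K -> mu K = 0%E -> nu K = 0%E.
Proof.
move=> hM hu hnu cK K0.
have mK : measurable (K : set RM) by exact: closed_measurable.
have nusupp := spectral_support hV hu hnu hM.
have ePn G : ebd nu (fun x : RM => G.[x]) by exact: (ebd_poly M0 nusupp).
suff h (e : R) : 0 < e -> fine (nu K) <= e.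
  apply/eqP; rewrite eq_le measure_ge0 andbT -[leLHS]fineK ?fin_num_measure// lee_fin.
  by apply/ler_addgt0Pr => e /h; rewrite add0r.
(* Splitting the vector doubles squared norms, and |P|^2 <= 4 on the remainder: 2 * 4 * e / 16 = e /
   2, and the truncation contributes 2 * e / 4. *)
move=> e0; have e16 : 0 < e / 16 by rewrite divr_gt0.
have /cvgrPdist_le /(_ _ e16) [N _ /(_ N (leqnn N))] := trunc_cvg hu.
rewrite sub0r normrN => hN; have {}hN := le_trans (ler_norm _) hN.
have [G1 [G2 hG]] := trunc_U hmu N u.
have [lt _] := trunc_l2 N hu.
pose bd G := \sum_(i < size G) `|G`_i| * M ^+ i.
have bd0 G : 0 <= bd G by rewrite sumr_ge0// => i _; rewrite mulr_ge0// exprn_ge0// ltW.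
pose Cb := bd G1 ^+ 2 + bd G2 ^+ 2.
have Cb0 : 0 <= Cb by rewrite addr_ge0// sqr_ge0.
have eta0 : 0 < e / (4 * (Cb + 1)) by rewrite divr_gt0// mulr_gt0// ltr_wpDl.
have [P [P1 P2 P3]] := approx_closed M0 musupp cK eta0.
have IP2 : I (fun x : RM => P.[x] ^+ 2) <= e / (4 * (Cb + 1)).
  apply: le_trans P3; rewrite le_eqVlt; apply/orP; left; apply/eqP.
  apply: Rint_ae_eq.
  - by case: (ebdX 2 (eP P)).
  - by case: (ebdX 2 (ebdB (eP P) (ebd_indic mu mK))).
  - exists K; split => // x /= hx; apply: contrapT => nKx; apply: hx.
    by rewrite indicE memNset// subr0.
apply: (@le_trans _ _ (nsq (pH V P u))).
  rewrite (nsq_pH hV hu hnu) -Rint_indic//.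
  apply: Rint_ae_le; [exact: ebd_indic|exact: ebdX|].
  apply: (ae_support nusupp) => x xM; rewrite indicE.
  have [/set_mem Kx|_] := boolP (x \in K); last by rewrite sqr_ge0.
  by have := P1 x Kx xM => h; rewrite /= exprn_ege1.
have dec : u = addu (trunc N u) (subu u (trunc N u)).
  by apply/funext => k; rewrite /addu /subu addrC subrK.
rewrite dec pH_Dr.
have lB : l2 (subu u (trunc N u)) by exact: l2B.
have l1 : l2 (pH V P (trunc N u)) by exact: (l2_pH hV).
have l3 : l2 (pH V P (subu u (trunc N u))) by exact: (l2_pH hV).
apply: (le_trans (nsq_add_le l1 l3)).
have a1 := nsq_pH_le hV hmu lB P2.
have a2 : nsq (pH V P (trunc N u)) <= Cb * I (fun x : RM => P.[x] ^+ 2).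
  rewrite hG (pH_U hmu)// (U_nsq hmu _ _).2;
    [|by apply: (approximable_polyM hmu); exact: (approximable_poly hmu)..].
  have key F : I (fun x : RM => (P.[x] * F.[x]) ^+ 2) <= bd F ^+ 2 * I (fun x : RM => P.[x] ^+ 2).
    rewrite -RintZ; last exact: ebdX.
    apply: Rint_ae_le; [by apply: ebdX; exact: ebdM|by apply: ebdZ; exact: ebdX|].
    apply: (ae_support musupp) => x xM; rewrite exprMn mulrC ler_wpM2r ?sqr_ge0//.
    by rewrite -(real_normK (num_real F.[x])) lerXn2r ?nnegrE// horner_bound.
  by rewrite /Cb mulrDl; apply: lerD.
have a3 : Cb * I (fun x : RM => P.[x] ^+ 2) <= e / 4.
  apply: (@le_trans _ _ (Cb * (e / (4 * (Cb + 1))))); first by rewrite ler_wpM2l.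
  have -> : Cb * (e / (4 * (Cb + 1))) = (e / 4) * (Cb / (Cb + 1)).
    by field; rewrite gt_eqF// ltr_wpDl.
  rewrite ler_piMr ?divr_ge0 ?(ltW e0)// ler_pdivrMr ?ltr_wpDl// mul1r lerDl//.
lra.
Qed.

(** Inner regularity of Lebesgue measure gives compact subsets that exhaust A up to a null set,
    which is also nu-null; so one of them has positive nu-mass. *)
Lemma inner_closed (nu : {finite_measure set RM -> \bar R}) (A : set RM) :
  nu `<< (@lebesgue_measure R) -> measurable A -> A `<=` `[- M, M]%classic ->
  nu A != 0%E -> exists K : set R, [/\ closed K, K `<=` A & nu K != 0%E].
Proof.
move=> /null_content_dominatesP nul mA AM nA.
have finA : (@lebesgue_measure R A < +oo)%E.
  apply: (@le_lt_trans _ _ (@lebesgue_measure R `[- M, M]%classic)).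
    by apply: le_measure; rewrite ?inE//; exact: measurable_itv.
  by rewrite lebesgue_measure_itv/=; case: ifP => _; rewrite -?EFinB ltry.
have hK n : exists K : set R, [/\ compact K, K `<=` A &
    (@lebesgue_measure R (A `\` K) < (n.+1%:R^-1)%:E)%E].
  have n0 : 0 < n.+1%:R^-1 :> R by rewrite invr_gt0.
  by have [K [h1 h2 h3]] := lebesgue_regularity_inner mA finA n0; exists K.
have [K hK'] := choice hK.
apply: contrapT => hn.
have K0 n : nu (K n) = 0%E.
  have [cK KA _] := hK' n; apply/eqP; apply/negP => /negP nK; apply: hn; exists (K n).
  by split => //; apply: compact_closed => //; exact: Rhausdorff.
have mK n : measurable (K n : set RM).
  by have [cK _ _] := hK' n; exact: compact_measurable.
pose U0 := \bigcup_n K n.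
have mU : measurable (U0 : set RM) by exact: bigcup_measurable.
have E0 : @lebesgue_measure R (A `\` U0) = 0%E.
  apply/eqP; rewrite eq_le measure_ge0 andbT.
  apply/lee_addgt0Pr => e e0; rewrite add0e.
  have [n hn'] : exists n : nat, e^-1 < n%:R.
    by exists (Num.trunc e^-1).+1; exact: truncnS_gt.
  have [_ _ hl] := hK' n.
  apply: (@le_trans _ _ (@lebesgue_measure R (A `\` K n))).
    apply: le_measure; rewrite ?inE; [exact: measurableD|exact: measurableD|].
    by move=> x [Ax nU]; split => // Kx; apply: nU; exists n.
  apply: le_trans (ltW hl) _; rewrite lee_fin -[leRHS]invrK lef_pV2 ?posrE ?invr_gt0//.
  by apply: le_trans (ltW hn') _; rewrite ler_nat leqnSn.
have nE0 := nul _ (measurableD mA mU) E0.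
move/eqP: nA; apply; apply/eqP; rewrite eq_le measure_ge0 andbT.
have nU0 : nu U0 = 0%E.
  apply/eqP; rewrite eq_le measure_ge0 andbT.
  have := @measure_sigma_subadditive _ _ _ nu U0 K mK mU (@subset_refl _ _).
  by move=> h; apply: (le_trans h); rewrite eseries0// => i _ _; exact: K0.
have H1 : (nu A <= nu ((A `\` U0) `|` U0))%E.
  apply: le_measure; rewrite ?inE//; first by apply: measurableU => //; exact: measurableD.
  by move=> x Ax; have [h|h] := pselect (U0 x); [right|left].
have H2 : (nu ((A `\` U0) `|` U0) <= nu (A `\` U0) + nu U0)%E.
  by apply: measureU2 => //; exact: measurableD.
by apply: (le_trans H1); apply: (le_trans H2); rewrite nU0 adde0 nE0.
Qed.

Lemma null_transfer u (nu : {finite_measure set RM -> \bar R}) (A : set RM) :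
  opbound B < M -> l2 u -> spectral_measure H u nu -> nu `<< (@lebesgue_measure R) ->
  measurable A -> A `<=` `[- M, M]%classic -> mu A = 0%E -> nu A = 0%E.
Proof.
move=> hM hu hnu nul mA AM A0; apply/eqP; apply/negP => /negP nA.
have [K [cK KA nK]] := inner_closed nul mA AM nA.
have mK : measurable (K : set RM) by exact: closed_measurable.
move/eqP: nK; apply; apply: (null_transfer_closed hM hu hnu cK).
exact: subset_measure0 A0.
Qed.

End Transfer.

(** * Inversion off the support *)

Section Resolvent.
Variables (R : realType) (V : nat -> R) (B : R).
Hypothesis hV : forall n, `|V n.+1| <= B.
Local Notation C := R[i].
Local Notation H := (schrodinger V).
Local Notation RM := (measurableTypeR R).
Variables (z : C) (eps : R).
Hypothesis eps0 : 0 < eps.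
Implicit Types (u v w : nat -> C) (F G : {poly R}).

(** The function |x - z|^2 of real x. With it the functional calculus uses real polynomials only,
    although z is complex. *)
Definition dist2 : {poly R} := ('X - (complex.Re z)%:P) ^+ 2 + (complex.Im z ^+ 2)%:P.

Lemma dist2E x : dist2.[x] = (x - complex.Re z) ^+ 2 + complex.Im z ^+ 2.
Proof. by rewrite /dist2 hornerD horner_exp hornerXsubC hornerC. Qed.

(* When no ac vector charges {|x - z| < eps}, H - z is inverted on ac vectors by
   (H - conjc z) h(H) with h = cutinv, a limit of polynomials in H. *)
Definition cutdist x : R := Num.max dist2.[x] (eps ^+ 2).
Definition cutinv x : R := (cutdist x)^-1.

Lemma cutdist_ge x : eps ^+ 2 <= cutdist x. Proof. by rewrite le_max lexx orbT. Qed.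
Lemma cutdist_gt0 x : 0 < cutdist x. Proof. exact: lt_le_trans (exprn_gt0 _ eps0) (cutdist_ge x). Qed.
Lemma cutinv_gt0 x : 0 < cutinv x. Proof. by rewrite invr_gt0 cutdist_gt0. Qed.
Lemma cutinv_le x : cutinv x <= (eps ^+ 2)^-1.
Proof. by rewrite lef_pV2 ?posrE ?cutdist_gt0 ?exprn_gt0// cutdist_ge. Qed.

(** The factor |x - Re z| + |y - Re z| from the difference of squares is absorbed by |t - Re z| eps
    <= cutdist t, and the lower bound eps^2 of [cutdist] supplies the rest of eps^3. *)
Lemma cutinv_lip x y : `|cutinv x - cutinv y| <= (2 / eps ^+ 3) * `|x - y|.
Proof.
have mx := cutdist_gt0 x; have my := cutdist_gt0 y.
set a := complex.Re z.
have hx t : `|t - a| * eps <= cutdist t.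
  have h1 : `|t - a| ^+ 2 <= cutdist t.
    by rewrite real_normK ?num_real// le_max dist2E lerDl sqr_ge0.
  have h2 := cutdist_ge t; have := sqr_ge0 (`|t - a| - eps); nra.
have hd : `|cutdist x - cutdist y| <= `|x - y| * (`|x - a| + `|y - a|).
  apply: (@le_trans _ _ `|dist2.[x] - dist2.[y]|).
    rewrite /cutdist; move: (eps ^+ 2) (dist2.[x]) (dist2.[y]) => e s t.
    have n0 := normr_ge0 (s - t); have n1 := ler_norm (s - t).
    have n2 := ler_norm (t - s); rewrite distrC in n2.
    move: (`|s - t|) n0 n1 n2 => N n0 n1 n2; rewrite ler_norml.
    rewrite /Num.max; case: (ltP s e) => h1; case: (ltP t e) => h2; apply/andP; split; lra.
  rewrite !dist2E -/a (_ : _ - _ = (x - y) * ((x - a) + (y - a))); last by ring.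
  by rewrite normrM ler_wpM2l// ler_normD.
have -> : cutinv x - cutinv y = (cutdist y - cutdist x) / (cutdist x * cutdist y).
  by rewrite /cutinv; field; rewrite !gt_eqF.
rewrite normrM normfV (gtr0_norm (mulr_gt0 mx my)) ler_pdivrMr ?mulr_gt0// distrC.
apply: le_trans hd _; rewrite (mulrC _ `|x - y|) -mulrA ler_wpM2l//.
have e3 : 0 < eps ^+ 3 by rewrite exprn_gt0.
rewrite mulrAC ler_pdivlMr// exprS.
have h1 := hx x; have h2 := hx y; have h3 := cutdist_ge x; have h4 := cutdist_ge y.
have g1 : `|x - a| * eps * eps ^+ 2 <= cutdist x * cutdist y.
  by apply: ler_pM => //; [rewrite mulr_ge0// ltW|exact: sqr_ge0].
have g2 : `|y - a| * eps * eps ^+ 2 <= cutdist y * cutdist x.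
  by apply: ler_pM => //; [rewrite mulr_ge0// ltW|exact: sqr_ge0].
lra.
Qed.

Local Notation M1 := (opbound B + 1).

Let M10 : 0 < M1. Proof. by have := opbound_gt0 hV; lra. Qed.

Lemma approx_inv j : exists G : {poly R}, forall x, `|x| <= M1 -> `|G.[x] - cutinv x| <= j.+1%:R^-1.
Proof. by apply: (lipschitz_weierstrass M10 _ cutinv_lip); rewrite invr_gt0. Qed.

Definition ipoly j : {poly R} := projT1 (cid (approx_inv j)).

Lemma ipolyP j x : `|x| <= M1 -> `|(ipoly j).[x] - cutinv x| <= j.+1%:R^-1.
Proof. by rewrite /ipoly; case: cid => G /=; apply. Qed.

Lemma ipoly_cvg x : `|x| <= M1 -> (fun j => (ipoly j).[x]) @ \oo --> cutinv x.
Proof.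
move=> hx; apply/cvgrPdist_le => e e0.
have [N hN] : exists N : nat, e^-1 < N%:R.
  by exists (Num.trunc e^-1).+1; exact: truncnS_gt.
exists N => // j /= Nj; rewrite distrC; apply: le_trans (ipolyP j hx) _.
rewrite -[leRHS]invrK lef_pV2 ?posrE ?invr_gt0//.
by apply: le_trans (ltW hN) _; rewrite ler_nat ltnW.
Qed.

Lemma ipoly_bound j x : `|x| <= M1 -> `|(ipoly j).[x]| <= (eps ^+ 2)^-1 + 1.
Proof.
move=> hx; have h1 := ipolyP j hx; have h2 := cutinv_le x; have h3 := cutinv_gt0 x.
have h4 : j.+1%:R^-1 <= 1 :> R by rewrite invf_le1// ler1n.
have h5 := le_trans h1 h4; move: (ler_distD (cutinv x) (ipoly j).[x] 0).
by rewrite !subr0 (gtr0_norm h3); move: (_^-1) h2 => E h2; lra.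
Qed.

Local Notation S z u := (shift_op H z u).

Lemma shiftE t u : S t u = subu (H u) (scu t u). Proof. by []. Qed.

Lemma l2_shift t u : l2 u -> l2 (S t u).
Proof. by move=> hu; rewrite shiftE; apply: l2B; [exact: (l2H hV)|exact: l2Z]. Qed.

Lemma shift_adj t u v : l2 u -> l2 v -> rdot (S (conjc t) u) v = rdot u (S t v).
Proof.
move=> hu hv; have h1 := l2H hV hu; have h2 := l2H hV hv.
have h3 : l2 (scu (conjc t) u) by exact: l2Z.
have h4 : l2 (scu t v) by exact: l2Z.
by rewrite !shiftE rdotBl// rdotBr// (H_sym hV)// rdot_adj conjcK.
Qed.

Lemma pH_shift G t u : pH V G (S t u) = S t (pH V G u).
Proof. by rewrite !shiftE !subuE pH_Dr pH_H !pH_Zr. Qed.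

Lemma shift_shift G u : S z (S (conjc z) (pH V G u)) = pH V (G * dist2) u /\
  S (conjc z) (S z (pH V G u)) = pH V (G * dist2) u.
Proof.
pose a := complex.Re z; pose c := complex.Im z.
have e : G * dist2 = (G * 'X) * 'X + (- (a + a)) *: (G * 'X) + (a * a + c * c) *: G.
  rewrite /dist2 -/a -/c (expr2 c) -!mul_polyC polyCN !polyCD !polyCM; ring.
rewrite e !pHD !pHZ !pHX; set f := pH V G u.
split; apply/funext => k; rewrite shiftE /subu.
  rewrite shiftE HB HZ /subu /addu /scu.
  have -> : (- (a + a))%:C%C = - (z + conjc z).
    by rewrite /a; case: z => p q; apply/eqP; rewrite eq_complex /=; apply/andP; split; apply/eqP; ring.
  have -> : (a * a + c * c)%:C%C = z * conjc z.
    by rewrite /a /c; case: z => p q; apply/eqP; rewrite eq_complex /=; apply/andP; split; apply/eqP; ring.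
  ring.
rewrite shiftE HB HZ /subu /addu /scu.
have -> : (- (a + a))%:C%C = - (z + conjc z).
  by rewrite /a; case: z => p q; apply/eqP; rewrite eq_complex /=; apply/andP; split; apply/eqP; ring.
have -> : (a * a + c * c)%:C%C = z * conjc z.
  by rewrite /a /c; case: z => p q; apply/eqP; rewrite eq_complex /=; apply/andP; split; apply/eqP; ring.
ring.
Qed.

Definition rseq u j := S (conjc z) (pH V (ipoly j) u).

(** [spectrum_on] asks for a function on all sequences; where the approximants do not converge
    coordinatewise the value is the zero sequence. *)
Definition resolvent : operator R := fun u =>
  if pselect (exists y, cvgu (rseq u) y) is left h then projT1 (cid h) else fun=> 0.

Lemma resolventE u y : cvgu (rseq u) y -> resolvent u = y.
Proof.
move=> hy; rewrite /resolvent; case: pselect => [h|]; last by case; exists y.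
by case: cid => y' hy' /=; exact: cvgu_unique hy' hy.
Qed.

Lemma cvgu_nsq (w : nat -> nat -> C) y : (forall j, l2 (w j)) -> l2 y ->
  (fun j => nsq (subu (w j) y)) @ \oo --> 0 -> cvgu w y.
Proof.
move=> hw hy h k.
have key (p : C -> R) : (forall s t, `|p s - p t| ^+ 2 <= nc (s - t)) ->
    (fun j => p (w j k)) @ \oo --> p (y k).
  move=> hp; apply/cvgrPdist_lt => e e0.
  have e2 : 0 < e ^+ 2 by rewrite exprn_gt0.
  have /cvgrPdist_lt /(_ _ e2) := h; apply: filterS => j.
  rewrite sub0r normrN => hj; rewrite distrC.
  have : `|p (w j k) - p (y k)| ^+ 2 < e ^+ 2.
    apply: le_lt_trans (hp _ _) _.
    apply: le_lt_trans (nc_coord k (l2B (hw j) hy)) _.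
    exact: le_lt_trans (ler_norm _) hj.
  by rewrite ltr_pXn2r ?nnegrE// ltW.
split; apply: key => s t; rewrite real_normK ?num_real// /nc;
    case: s t => a b [c d] /=; [rewrite lerDl|rewrite lerDr]; exact: sqr_ge0.
Qed.

Lemma cvg0_sqr (f g : nat -> R) (K : R) : (forall j, f j ^+ 2 <= K * g j) ->
  g @ \oo --> 0 -> f @ \oo --> 0.
Proof.
move=> h hg; apply/cvgrPdist_lt => e e0.
have hKg : (fun j => K * g j) @ \oo --> 0.
  by rewrite -(mulr0 K); apply: cvgM => //; exact: cvg_cst.
have e2 : 0 < e ^+ 2 by rewrite exprn_gt0.
have /cvgrPdist_lt /(_ _ e2) := hKg; apply: filterS => j.
rewrite !sub0r !normrN => hj.
have : `|f j| ^+ 2 < e ^+ 2.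
  rewrite real_normK ?num_real//; apply: le_lt_trans (h j) _.
  exact: le_lt_trans (ler_norm _) hj.
by rewrite ltr_pXn2r ?nnegrE// ltW.
Qed.

Lemma moment_cvg k (w : nat -> nat -> C) y : (forall j, l2 (w j)) -> l2 y ->
  (fun j => nsq (subu (w j) y)) @ \oo --> 0 ->
  (fun j => rdot (iter k H (w j)) (w j)) @ \oo --> rdot (iter k H y) y.
Proof.
move=> hw hy h.
pose e j := subu (w j) y.
have he j : l2 (e j) by exact: l2B.
have dec j : w j = addu y (e j) by apply/funext => i; rewrite /addu /e /subu addrC subrK.
have itD u v : iter k H (addu u v) = addu (iter k H u) (iter k H v).
  by elim: k => //= n ->; rewrite HD.
have hk u : l2 u -> l2 (iter k H u) by move=> hu; exact: (l2_iter hV).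
have -> : (fun j => rdot (iter k H (w j)) (w j)) = fun j =>
   rdot (iter k H y) y + (2 * rdot (iter k H y) (e j) + rdot (iter k H (e j)) (e j)).
  apply/funext => j; rewrite [in LHS]dec itD.
  have hky := hk _ hy; have hke := hk _ (he j); have hej := he j.
  rewrite rdotDl//; last exact: l2D.
  rewrite (rdotDr hy hej hky) (rdotDr hy hej hke).
  have -> : rdot (iter k H (e j)) y = rdot (iter k H y) (e j).
    by rewrite (H_sym_iter hV)// rdot_sym.
  ring.
rewrite -[X in _ --> X]addr0; apply: cvgD; first exact: cvg_cst.
rewrite -[X in _ --> X]addr0; apply: cvgD.
  rewrite -(mulr0 2); apply: cvgM; first exact: cvg_cst.
  apply: (@cvg0_sqr _ (fun j => nsq (e j)) (nsq (iter k H y))) => // j.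
  by apply: cauchy_schwarz => //; exact: hk.
have h2 : (fun j => nsq (e j) * nsq (e j)) @ \oo --> 0.
  by rewrite -(mulr0 0); apply: cvgM.
apply: (@cvg0_sqr _ (fun j => nsq (e j) * nsq (e j)) ((opbound B ^+ 2) ^+ k)) => // j.
apply: le_trans (cauchy_schwarz (hk _ (he j)) (he j)) _.
by rewrite mulrA ler_wpM2r ?nsq_ge0//; exact: (nsq_iter hV).
Qed.

Section OneVector.
Variables (u : nat -> C) (nu : {finite_measure set RM -> \bar R}).
Hypotheses (hu : l2 u) (hnu : spectral_measure H u nu).
Hypothesis nuI : nu [set x : RM | dist2.[x] < eps ^+ 2] = 0%E.
Local Notation I f := (Rintegral nu setT f).

Let nusupp : nu (~` `[- M1, M1]%classic) = 0%E.
Proof. by apply: (spectral_support hV hu hnu); rewrite ltrDl. Qed.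

Let eP G : ebd nu (fun x : RM => G.[x]). Proof. exact: (ebd_poly M10 nusupp). Qed.

Lemma rseq_l2 j : l2 (rseq u j).
Proof. by apply: l2_shift; exact: (l2_pH hV). Qed.

Lemma rdot_shift F G : rdot (S (conjc z) (pH V F u)) (S (conjc z) (pH V G u)) =
  I (fun x : RM => F.[x] * (G * dist2).[x]).
Proof.
have hF : l2 (pH V F u) by exact: (l2_pH hV).
have hG : l2 (pH V G u) by exact: (l2_pH hV).
by rewrite shift_adj//; [rewrite (shift_shift G u).1 (rdot_pH hV hu hnu)|exact: l2_shift].
Qed.

Lemma nsq_shift G : nsq (S (conjc z) (pH V G u)) = I (fun x : RM => G.[x] ^+ 2 * dist2.[x]).
Proof.
by rewrite nsq_rdot rdot_shift; congr Rintegral; apply/funext => x; rewrite hornerM expr2 mulrA.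
Qed.

Lemma measurable_cutinv : measurable_fun setT (cutinv : RM -> R).
Proof.
have e0 : 0 < eps ^+ 2 by rewrite exprn_gt0.
(* The factor eps^2 brings [cutinv] below 1, as [ebd_lip] requires. *)
have L : forall x y, `|eps ^+ 2 * cutinv x - eps ^+ 2 * cutinv y| <= (eps ^+ 2 * (2 / eps ^+ 3)) * `|x - y|.
  by move=> x y; rewrite -mulrBr normrM (gtr0_norm e0) -[leRHS]mulrA ler_pM2l//; exact: cutinv_lip.
have [|m _] := @ebd_lip R nu (fun x => eps ^+ 2 * cutinv x) _ L.
  move=> x; rewrite gtr0_norm ?mulr_gt0 ?cutinv_gt0//.
  have := cutinv_le x; rewrite -(ler_pM2l e0) divff// gt_eqF//.
have -> : (cutinv : RM -> R) = fun x => (eps ^+ 2)^-1 * (eps ^+ 2 * cutinv x).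
  by apply/funext => x; rewrite mulKf// gt_eqF.
by apply: measurable_funM => //; exact: measurable_cst.
Qed.

Lemma ebd_cutinv : ebd nu (cutinv : RM -> R).
Proof.
apply: (@ebd_bounded _ _ _ nu _ (eps ^+ 2)^-1); first exact: measurable_cutinv.
by move=> x; rewrite gtr0_norm ?cutinv_gt0// cutinv_le.
Qed.

Lemma integral_ipoly_cvg F :
  (fun j => I (fun x : RM => F.[x] * (ipoly j).[x] ^+ 2)) @ \oo -->
  I (fun x : RM => F.[x] * cutinv x ^+ 2).
Proof.
apply: (@Rint_dct _ _ _ _ _ _ ((\sum_(i < size F) `|F`_i| * M1 ^+ i) * ((eps ^+ 2)^-1 + 1) ^+ 2)).
- by move=> j; case: (ebdM (eP F) (ebdX 2 (eP (ipoly j)))).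
- by case: (ebdM (eP F) (ebdX 2 ebd_cutinv)).
- apply: (ae_support nusupp) => x xM; apply: cvgM; first exact: cvg_cst.
  rewrite expr2; under eq_fun do rewrite expr2.
  by apply: cvgM; exact: ipoly_cvg.
- apply: (ae_support nusupp (p := fun x => forall n, _)) => x xM j.
  rewrite normrM; apply: ler_pM => //; first exact: horner_bound.
  by rewrite normrX lerXn2r ?nnegrE ?addr_ge0 ?invr_ge0 ?sqr_ge0//; exact: ipoly_bound.
Qed.

Lemma rseq_cauchy (e : R) : 0 < e -> exists N, forall i j, (N <= i)%N -> (N <= j)%N ->
  nsq (subu (rseq u i) (rseq u j)) <= e.
Proof.
move=> e0.
pose D := \sum_(i < size dist2) `|dist2`_i| * M1 ^+ i.
have D0 : 0 <= D by rewrite sumr_ge0// => i _; rewrite mulr_ge0// exprn_ge0// ltW.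
pose m := fine (nu setT).
have m0 : 0 <= m by rewrite fine_ge0.
pose K := 4 * (D + 1) * (m + 1).
have K0 : 0 < K by rewrite !mulr_gt0// ltr_wpDl.
have [N hN] : exists N : nat, K / e < N%:R.
  by exists (Num.trunc (K / e)).+1; exact: truncnS_gt.
exists N => i j Ni Nj.
have -> : subu (rseq u i) (rseq u j) = S (conjc z) (pH V (ipoly i - ipoly j) u).
  rewrite /rseq pHB !shiftE HB; apply/funext => k; rewrite /subu /scu; ring.
rewrite nsq_shift.
have n0 : 0 < N.+1%:R :> R by [].
pose d := N.+1%:R^-1 : R.
have d0 : 0 < d by rewrite invr_gt0.
have d1 : d <= 1 by rewrite invf_le1// ler1n.
apply: (@le_trans _ _ (I (fun=> 4 * d * D))).
  apply: Rint_ae_le; [by apply: ebdM => //; exact: ebdX|exact: ebd_cst|].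
  apply: (ae_support nusupp) => x xM.
  have hb k : (N <= k)%N -> `|(ipoly k).[x] - cutinv x| <= d.
    move=> Nk; apply: le_trans (ipolyP k xM) _; rewrite lef_pV2 ?posrE//.
    by rewrite ler_nat ltnS.
  have h1 : `|(ipoly i - ipoly j).[x]| <= 2 * d.
    have := ler_distD (cutinv x) (ipoly i).[x] (ipoly j).[x].
    have := hb _ Ni; have := hb _ Nj; rewrite [X in X <= _]distrC hornerD hornerN; lra.
  have h2 : dist2.[x] <= D by apply: le_trans (ler_norm _) _; exact: horner_bound.
  have h3 : 0 <= dist2.[x] by rewrite dist2E addr_ge0// sqr_ge0.
  apply: ler_pM => //; first exact: sqr_ge0.
  rewrite -real_normK ?num_real//.
  have := normr_ge0 (ipoly i - ipoly j).[x]; move: h1; nra.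
rewrite Rint_cst -/m.
apply: (@le_trans _ _ (K * d)).
  rewrite /K; have h4 : D * m <= (D + 1) * (m + 1) by nra.
  by have := ler_wpM2l (ltW d0) h4; lra.
rewrite /d ler_pdivrMr// mulrC -ler_pdivrMr//.
by apply: ltW; apply: lt_trans hN _; rewrite ltr_nat.
Qed.

Lemma resolvent_cvg : [/\ l2 (resolvent u), cvgu (rseq u) (resolvent u) &
  (fun j => nsq (subu (rseq u j) (resolvent u))) @ \oo --> 0].
Proof.
have [y [h1 h2 h3]] := l2_complete rseq_l2 rseq_cauchy.
by rewrite (resolventE h2).
Qed.

(** The square modulus of (x - conj z) h(x) with h = [cutinv]: the density with respect to nu of the
    spectral measure of [resolvent u]. *)
Definition rdensity (x : RM) : R := dist2.[x] * cutinv x ^+ 2.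

Lemma rdensity_bounded : bounded_density rdensity (eps ^+ 2)^-1.
Proof.
split.
  by case: (ebdM (eP dist2) (ebdX 2 ebd_cutinv)).
move=> x; have h0 : 0 <= dist2.[x] by rewrite dist2E addr_ge0// sqr_ge0.
have h1 := cutinv_gt0 x; have h2 := cutinv_le x.
have h3 : dist2.[x] * cutinv x <= 1.
  by rewrite /cutinv ler_pdivrMr ?cutdist_gt0// mul1r le_max lexx.
rewrite /rdensity expr2 mulrA; apply/andP; split.
  by rewrite !mulr_ge0// ltW.
apply: le_trans h2; apply: ler_piMl => //; exact: ltW.
Qed.

Lemma resolvent_moment k : rdot (iter k H (resolvent u)) (resolvent u) =
  I (fun x : RM => (x : R) ^+ k * rdensity x).
Proof.
have [h1 h2 h3] := resolvent_cvg.
have c1 := @moment_cvg k _ _ rseq_l2 h1 h3.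
have c2 := @integral_ipoly_cvg ('X^k * dist2 : {poly R}).
have e : (fun j => rdot (iter k H (rseq u j)) (rseq u j)) =
  (fun j => I (fun x : RM => ('X^k * dist2).[x] * (ipoly j).[x] ^+ 2)).
  apply/funext => j; rewrite /rseq.
  have -> : iter k H (S (conjc z) (pH V (ipoly j) u)) = S (conjc z) (pH V (ipoly j * 'X^k) u).
    by rewrite pHXn; elim: k {c1 c2} => //= k ->; rewrite !shiftE HB HZ.
  rewrite rdot_shift; congr Rintegral; apply/funext => x.
  by rewrite !hornerM; ring.
rewrite e in c1; rewrite (cvg_unique (@Rhausdorff R) c1 c2).
congr Rintegral; apply/funext => x.
by rewrite hornerM hornerXn /rdensity -mulrA.
Qed.

Lemma resolvent_spectral :
  spectral_measure H (resolvent u) (dens nu rdensity_bounded).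
Proof.
have [h1 h2 h3] := resolvent_cvg.
have dsupp : dens nu rdensity_bounded (~` `[- M1, M1]%classic) = 0%E.
  have /null_content_dominatesP := @dens_dominated _ _ _ nu _ _ rdensity_bounded; apply => //.
  by apply: measurableC; exact: measurable_itv.
split; first by exists M1.
move=> k; rewrite (l2dot_iter_real hV)// resolvent_moment; congr (_%:C%C).
rewrite Rintegral_dens//.
  by have := eP 'X^k; under eq_fun do rewrite hornerXn.
have -> : (fun x : RM => (x : R) ^+ k) = fun x : RM => ('X^k : {poly R}).[x].
  by apply/funext => x; rewrite hornerXn.
exact: (ebd_poly M10 dsupp).
Qed.

Lemma nsq_total : nsq u = fine (nu setT).
Proof.
rewrite -[u in LHS](pH1 V) (nsq_pH hV hu hnu).
rewrite (_ : (fun x => _) = fun=> 1); first by rewrite Rint_cst mul1r.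
by apply/funext => x; rewrite hornerC expr1n.
Qed.

Lemma nsq_resolvent : nsq (resolvent u) <= (eps ^+ 2)^-1 * nsq u.
Proof.
rewrite nsq_rdot (resolvent_moment 0) nsq_total -Rint_cst.
have ed := density_ebd nu rdensity_bounded.
apply: Rint_le; [|exact: ebd_cst|].
  by under eq_fun do rewrite expr0 mul1r.
by move=> x; rewrite expr0 mul1r; case: rdensity_bounded => _ /(_ x) /andP[].
Qed.

(** The limit multiplier [cutinv] times [dist2] is 1 outside the set |x - z| < eps, and that set is
    nu-null: this is where the hypothesis on nu enters. *)
Lemma ipoly_dist2_cvg : cvgu (fun j => pH V (ipoly j * dist2) u) u.
Proof.
apply: cvgu_nsq => //; first by move=> j; exact: (l2_pH hV).
have -> : (fun j => nsq (subu (pH V (ipoly j * dist2) u) u)) =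
   fun j => I (fun x : RM => ((ipoly j).[x] * dist2.[x] - 1) ^+ 2).
  apply/funext => j; rewrite -[X in subu _ X](pH1 V) -pHB (nsq_pH hV hu hnu).
  by congr Rintegral; apply/funext => x; rewrite hornerD hornerN hornerM hornerC.
have e1 : ebd nu (fun x : RM => (cutinv x * dist2.[x] - 1) ^+ 2).
  by apply: ebdX; apply: ebdB; [exact: ebdM ebd_cutinv (eP _)|exact: ebd_cst].
have -> : 0 = I (fun x : RM => (cutinv x * dist2.[x] - 1) ^+ 2).
  rewrite (@Rint_ae_eq _ _ _ nu _ (fun=> 0)) ?Rint_cst ?mul0r//; first by case: e1.
  exists [set x : RM | dist2.[x] < eps ^+ 2]; split => //.
    have md : measurable_fun setT (fun x : RM => dist2.[x]) by exact: measurable_horner.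
    have := md measurableT `]-oo, eps ^+ 2[%classic (measurable_itv _).
    by rewrite setTI; congr measurable; apply/seteqP; split => x /=; rewrite in_itv/=.
  move=> x /= hx; rewrite ltNge; apply/negP => hle; apply: hx.
  rewrite /cutinv /cutdist (max_idPl hle) mulVf ?subrr ?expr0n//.
  by rewrite gt_eqF// (lt_le_trans (exprn_gt0 2 eps0)).
pose D := \sum_(i < size dist2) `|dist2`_i| * M1 ^+ i.
have D0 : 0 <= D by rewrite sumr_ge0// => i _; rewrite mulr_ge0// exprn_ge0// ltW.
apply: (@Rint_dct _ _ _ _ _ _ ((((eps ^+ 2)^-1 + 1) * D + 1) ^+ 2)).
- move=> j; have [] // : ebd nu (fun x : RM => ((ipoly j).[x] * dist2.[x] - 1) ^+ 2).
  by apply: ebdX; apply: ebdB; [exact: ebdM|exact: ebd_cst].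
- by case: e1.
- apply: (ae_support nusupp) => x xM; rewrite expr2; under eq_fun do rewrite expr2.
  have c1 : (fun j => (ipoly j).[x] * dist2.[x] - 1) @ \oo --> cutinv x * dist2.[x] - 1.
    apply: cvgB; last exact: cvg_cst.
    by apply: cvgM; [exact: ipoly_cvg|exact: cvg_cst].
  exact: cvgM.
- apply: (ae_support nusupp (p := fun x => forall n, _)) => x xM j.
  rewrite normrX lerXn2r ?nnegrE//.
    by rewrite addr_ge0// mulr_ge0// addr_ge0// invr_ge0 sqr_ge0.
  apply: le_trans (ler_normB _ _) _; rewrite normr1 lerD2r normrM.
  by apply: ler_pM => //; [exact: ipoly_bound|exact: horner_bound].
Qed.

Lemma cvgu_shift t (w : nat -> nat -> C) y : cvgu w y -> cvgu (fun j => S t (w j)) (S t y).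
Proof.
move=> h; have h' := cvgu_H V h; move=> k.
have [a1 b1] := h k; have [a2 b2] := h' k; rewrite /shift_op; case: t => p q.
have e1 (s r : C) : complex.Re (s - (p +i* q)%C * r) =
   complex.Re s - (p * complex.Re r - q * complex.Im r) by case: s r => ? ? [? ?].
have e2 (s r : C) : complex.Im (s - (p +i* q)%C * r) =
   complex.Im s - (p * complex.Im r + q * complex.Re r) by case: s r => ? ? [? ?].
split; [under eq_fun do rewrite e1; rewrite e1|under eq_fun do rewrite e2; rewrite e2].
  by apply: cvgB => //; apply: cvgB; apply: cvgM => //; exact: cvg_cst.
by apply: cvgB => //; apply: cvgD; apply: cvgM => //; exact: cvg_cst.
Qed.

Lemma shift_resolvent : S z (resolvent u) = u.
Proof.
have [_ h2 _] := resolvent_cvg.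
apply: cvgu_unique (cvgu_shift z h2) _.
rewrite (_ : (fun j => _) = fun j => pH V (ipoly j * dist2) u); first exact: ipoly_dist2_cvg.
by apply/funext => j; rewrite /rseq (shift_shift _ u).1.
Qed.

Lemma resolvent_shift : resolvent (S z u) = u.
Proof.
apply: resolventE.
rewrite (_ : rseq _ = fun j => pH V (ipoly j * dist2) u); first exact: ipoly_dist2_cvg.
by apply/funext => j; rewrite /rseq pH_shift (shift_shift _ u).2.
Qed.

End OneVector.

(** The conditions in [spectrum_on] concern one vector at a time, so each is checked with the
    spectral measure of that vector. The result is again ac because its spectral measure has a
    density with respect to nu. *)
Lemma not_sigma_ac :
  (forall u (nu : {finite_measure set RM -> \bar R}), l2 u -> spectral_measure H u nu ->
     nu `<< (@lebesgue_measure R) -> nu [set x : RM | dist2.[x] < eps ^+ 2] = 0%E) ->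
  ~ sigma_ac V z.
Proof.
move=> h0; rewrite /sigma_ac /ac_spectrum /spectrum_on /=; apply; exists resolvent.
split.
- move=> u [hu [nu [hnu nul]]].
  have nuI := h0 u nu hu hnu nul.
  have [h1 _ _] := resolvent_cvg hu hnu; split => //.
  exists (dens nu (rdensity_bounded hu hnu)); split; first exact: resolvent_spectral.
  exact: null_dominates_trans (dens_dominated _) nul.
- by move=> u [hu [nu [hnu nul]]]; exact: (resolvent_shift hu hnu (h0 u nu hu hnu nul)).
- by move=> u [hu [nu [hnu nul]]]; exact: (shift_resolvent hu hnu (h0 u nu hu hnu nul)).
exists eps^-1 => u [hu [nu [hnu nul]]].
have nuI := h0 u nu hu hnu nul.
have hn := nsq_resolvent hu hnu.
have n0 := nsq_ge0 hu.
rewrite !l2normE -(ger0_norm (_ : 0 <= eps^-1)) ?invr_ge0 ?(ltW eps0)//.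
rewrite -sqrtr_sqr -sqrtrM ?sqr_ge0// ler_wsqrtr//.
by rewrite exprVn; exact: hn.
Qed.

End Resolvent.

(** * Right limits *)

Section RestrictedLebesgue.
Variables (R : realType) (M : R).
Local Notation RM := (measurableTypeR R).
Local Notation leb := (@lebesgue_measure R).

Lemma mIM : measurable (`[- M, M]%classic : set RM). Proof. exact: measurable_itv. Qed.

Lemma finIM : (leb `[(- M)%R, M%R]%classic < +oo)%E.
Proof. by rewrite lebesgue_measure_itv/=; case: ifP => _; rewrite -?EFinB ltry. Qed.

(** Lebesgue measure cut down to a finite measure, as the Hahn comparison demands. *)
Definition lebM : {finite_measure set RM -> \bar R} := mfrestr mIM finIM.

Lemma lebM_E (A : set RM) : A `<=` `[- M, M]%classic -> lebM A = leb A.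
Proof. by move=> AM; rewrite /lebM /= /mfrestr /mrestr setIidl. Qed.

Lemma lebM_dominated : lebM `<< leb.
Proof.
apply/null_content_dominatesP => A mA A0; rewrite /lebM /= /mfrestr /mrestr.
by apply: subset_measure0 A0 => //; apply: measurableI => //; exact: mIM.
Qed.

End RestrictedLebesgue.

(** * Inclusion of ac spectra for right limits *)

Section RightLimit.
Variable R : realType.
Local Notation C := R[i].
Local Notation RM := (measurableTypeR R).
Local Notation leb := (@lebesgue_measure R).
Local Notation sites V := (fun k : nat => V k.+1).

Lemma spectral_of_exists (V : nat -> R) B M : (forall n, `|V n.+1| <= B) -> B + 2 <= M ->
  exists mu, spectral_of (sites V) M mu.
Proof.
move=> hV BM; have [mu [h1 h2]] := @spectral_exists R (sites V) B hV.
have B0 : 0 <= B by exact: le_trans (hV 0%N).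
exists mu; split => //; first by lra.
apply: subset_measure0 h1.
- by apply: measurableC; exact: measurable_itv.
- by apply: measurableC; exact: measurable_itv.
move=> x h h'; apply: h; move: h'; rewrite /= !in_itv/= => /andP[h3 h4].
by apply/andP; split; lra.
Qed.

Lemma bigcup_null (nu : {measure set RM -> \bar R}) (F : nat -> set RM) :
  (forall n, measurable (F n)) -> (forall n, nu (F n) = 0%E) -> nu (\bigcup_n F n) = 0%E.
Proof.
move=> mF F0; apply/eqP; rewrite eq_le measure_ge0 andbT.
have mU : measurable (\bigcup_n F n) by exact: bigcup_measurable.
have h := @measure_sigma_subadditive _ _ _ nu _ F mF mU (@subset_refl _ _).
by apply: (le_trans h); rewrite eseries0// => i _ _; exact: F0.
Qed.

(** Let D n be the set where mu dominates Lebesgue measure over n + 1. If all A [&] D n were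
    Lebesgue-null, they would be nu-null; off their union mu vanishes, hence so does nu, and nu A =
    0 would follow. *)
Lemma lower_density_set (V : nat -> R) B M mu u (nu : {finite_measure set RM -> \bar R})
    (A : set RM) :
  (forall n, `|V n.+1| <= B) -> opbound B < M -> spectral_of (sites V) M mu ->
  l2 u -> spectral_measure (schrodinger V) u nu -> nu `<< leb ->
  measurable A -> A `<=` `[- M, M]%classic -> nu A != 0%E ->
  exists S (delta : R), [/\ measurable S, S `<=` A, 0 < delta, leb S != 0%E &
    forall A' : set RM, measurable A' -> A' `<=` S -> (delta%:E * leb A' <= mu A')%E].
Proof.
move=> hV hM hmu hu hnu nul mA AM nA.
have hD n := hahn_compare mu (lebM M) n.+1%:R^-1.
have [D hD'] := choice hD.
have mD n : measurable (D n) by case: (hD' n).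
have [[n hn]|hall] := pselect (exists n, leb (A `&` D n) != 0%E).
  exists (A `&` D n), n.+1%:R^-1; split => //.
  - exact: measurableI.
  move=> A' mA' A'S; have [_ h _] := hD' n.
  by rewrite -(@lebM_E _ M)//; [apply: h => // x /A'S[]|move=> x /A'S[/AM]].
exfalso; move/eqP: nA; apply.
have /null_content_dominatesP nul' := nul.
have AD0 n : leb (A `&` D n) = 0%E.
  by apply/eqP; apply/negP => /negP h; apply: hall; exists n.
pose E := A `\` \bigcup_n D n.
have mE : measurable E by apply: measurableD => //; exact: bigcup_measurable.
have EM : E `<=` `[- M, M]%classic by move=> x [/AM].
have muE : mu E = 0%E.
  apply/eqP; rewrite eq_le measure_ge0 andbT.
  apply/lee_addgt0Pr => e e0; rewrite add0e.
  pose l := fine (lebM M E).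
  have l0 : 0 <= l by rewrite fine_ge0.
  have [n hn] : exists n : nat, l / e < n%:R.
    by exists (Num.trunc (l / e)).+1; exact: truncnS_gt.
  have [_ _ h] := hD' n.
  have h1 : (mu E <= n.+1%:R^-1%:E * lebM M E)%E.
    by apply: h => // x [_ nU] Dx; apply: nU; exists n.
  apply: (le_trans h1); rewrite -[lebM M E]fineK ?fin_num_measure// -EFinM lee_fin -/l.
  rewrite mulrC ler_pdivrMr// mulrC -ler_pdivrMr//.
  by apply: ltW; apply: lt_le_trans hn _; rewrite ler_nat.
have nE : nu E = 0%E := null_transfer hV hmu hM hu hnu nul mE EM muE.
have nU : nu (\bigcup_n (A `&` D n)) = 0%E.
  have mAD n : measurable (A `&` D n) by exact: measurableI.
  by apply: (@bigcup_null nu (fun n => A `&` D n)) => // n; exact: (nul' _ (mAD n) (AD0 n)).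
have mU : measurable (\bigcup_n (A `&` D n)).
  by apply: bigcup_measurable => n _; exact: measurableI.
apply: (@subset_measure0 _ _ _ nu A (E `|` \bigcup_n (A `&` D n))) => //.
- exact: measurableU.
- move=> x Ax; have [[n _ Dx]|h] := pselect ((\bigcup_n D n) x); [right|by left].
  by exists n.
- exact: null_set_setU.
Qed.

(** The set where mu dominates n + 1 times Lebesgue measure has Lebesgue measure at most that of a
    fraction mu(R) / (n + 1), so some n leaves a non-null part of S; there mu is dominated by
    Lebesgue measure. *)
Lemma upper_density_closed (mu : {finite_measure set RM -> \bar R}) M (S : set RM) :
  measurable S -> S `<=` `[- M, M]%classic -> leb S != 0%E ->
  exists K : set R, [/\ closed K, K `<=` S, leb K != 0%E &
    forall A : set RM, measurable A -> A `<=` K -> leb A = 0%E -> mu A = 0%E].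
Proof.
move=> mS SM lS.
have hE n := hahn_compare mu (lebM M) n.+1%:R.
have [E hE'] := choice hE.
have mE n : measurable (E n) by case: (hE' n).
have [n hn] : exists n, leb (S `\` E n) != 0%E.
  apply: contrapT => hall; move/eqP: lS; apply.
  have z n : leb (S `\` E n) = 0%E.
    by apply/eqP; apply/negP => /negP h; apply: hall; exists n.
  apply/eqP; rewrite eq_le measure_ge0 andbT.
  apply/lee_addgt0Pr => e e0; rewrite add0e.
  pose l := fine (mu setT).
  have l0 : 0 <= l by rewrite fine_ge0.
  have [n hn] : exists n : nat, l / e < n%:R.
    by exists (Num.trunc (l / e)).+1; exact: truncnS_gt.
  have [_ h _] := hE' n.
  have mSE : measurable (S `&` E n) by exact: measurableI.
  have h1 : (n.+1%:R%:E * lebM M (S `&` E n) <= mu (S `&` E n))%E.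
    by apply: h => //; exact: subIsetr.
  have h2 : (mu (S `&` E n) <= mu setT)%E by apply: le_measure; rewrite ?inE.
  have h3 := le_trans h1 h2.
  have e1 : leb S = lebM M (S `&` E n).
    rewrite lebM_E; last by move=> x [/SM].
    transitivity (leb (S `\` E n) + leb (S `&` E n))%E; first exact: measureDI.
    by rewrite z add0e.
  rewrite e1; move: h3.
  rewrite -[lebM M _]fineK ?fin_num_measure// -[mu setT]fineK ?fin_num_measure//.
  rewrite -EFinM !lee_fin -/l => h3.
  rewrite mulrC in h3; rewrite -ler_pdivlMr// in h3; apply: (le_trans h3).
  rewrite ler_pdivrMr// mulrC -ler_pdivrMr//.
  by apply: ltW; apply: lt_le_trans hn _; rewrite ler_nat.
have mSE : measurable (S `\` E n) by exact: measurableD.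
have SEM : S `\` E n `<=` `[- M, M]%classic by move=> x [/SM].
have lSE : lebM M (S `\` E n) != 0%E by rewrite lebM_E.
have [K [cK KS lK]] := inner_closed (@lebM_dominated R M) mSE SEM lSE.
exists K; split => //.
- by move=> x /KS[].
- by rewrite -(@lebM_E _ M)// => x /KS /SEM.
move=> A mA AK A0; have [_ _ h] := hE' n.
apply/eqP; rewrite eq_le measure_ge0 andbT.
apply: le_trans (h A mA _) _; first by move=> x /AK /KS[].
by rewrite lebM_E ?A0 ?mule0// => x /AK /KS /SEM.
Qed.

Lemma dens_dominated_on (mu : {finite_measure set RM -> \bar R}) (K : set RM) (h : RM -> R) c
   (hd : bounded_density h c) : measurable K -> (forall x, ~ K x -> h x = 0) ->
  (forall A : set RM, measurable A -> A `<=` K -> leb A = 0%E -> mu A = 0%E) ->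
  dens mu hd `<< leb.
Proof.
move=> mK h0 hK; apply/null_content_dominatesP => A mA A0; rewrite /dens.
have mAK : measurable (A `&` K) by exact: measurableI.
rewrite (@ae_eq_integral _ _ _ mu A (cst 0%E)) ?integral0//.
  by apply: measurable_funTS; apply/measurable_EFinP; case: hd.
exists (A `&` K); split => //.
  have AK0 : leb (A `&` K) = 0%E by exact: subset_measure0 A0.
  exact: (hK _ mAK (@subIsetr _ _ _) AK0).
move=> x /= hx; apply: contrapT => nAK; apply: hx => Ax.
by rewrite h0// => Kx; apply: nAK.
Qed.

(** Multiplication by x - z, split into real and imaginary parts. The zero component is written as
    values of the polynomial 0, so that [approximable_poly] covers it. *)
Lemma shift_U_indic (V : nat -> R) B M mu (K : set R) (z : C) :
  (forall n, `|V n.+1| <= B) -> spectral_of (sites V) M mu -> measurable (K : set RM) ->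
  shift_op (schrodinger V) z (U V mu \1_K (fun x : RM => (0 : {poly R}).[x])) =
  U V mu (fun x : RM => ('X - (complex.Re z)%:P).[x] * \1_K x)
         (fun x : RM => (- complex.Im z)%:P.[x] * \1_K x).
Proof.
move=> hV hmu mK; have [M0 ms _] := hmu.
have eK : ebd mu (\1_K : RM -> R) by exact: ebd_indic.
have eP G : ebd mu (fun x : RM => G.[x]) by exact: (ebd_poly M0 ms).
have eKP n : ebd mu (fun x : RM => \1_K x * (P (sites V) n).[x]) by exact: ebdM.
apply/funext => n; rewrite shiftE /subu (H_U hmu)// /scu.
have z0 : pint V mu (fun x : RM => (0 : {poly R}).[x]) n = 0.
  rewrite /pint (_ : (fun x => _) = fun=> 0) ?Rint_cst ?mul0r//.
  by apply/funext => x; rewrite horner0 mul0r.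
have z1 : pint V mu (fun x : RM => (x : R) * (0 : {poly R}).[x]) n = 0.
  rewrite /pint (_ : (fun x => _) = fun=> 0) ?Rint_cst ?mul0r//.
  by apply/funext => x; rewrite horner0 mulr0 mul0r.
have e1 : pint V mu (fun x : RM => ('X - (complex.Re z)%:P).[x] * \1_K x) n =
  pint V mu (fun x : RM => (x : R) * \1_K x) n - complex.Re z * pint V mu \1_K n.
  rewrite /pint -RintZ// -RintB; [|apply: ebdM => //; apply: ebdM => //|exact: ebdZ].
    by congr Rintegral; apply/funext => x; rewrite hornerXsubC; ring.
  by have := eP 'X; under eq_fun do rewrite hornerX.
have e2 : pint V mu (fun x : RM => (- complex.Im z)%:P.[x] * \1_K x) n =
  - (complex.Im z * pint V mu \1_K n).
  rewrite /pint -mulNr -RintZ//.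
  by congr Rintegral; apply/funext => x; rewrite hornerC mulrA.
rewrite /U z0 z1 e1 e2; case: (z) => p q.
by apply/eqP; rewrite eq_complex /=; apply/andP; split; apply/eqP; ring.
Qed.

Lemma approximable_indic M (mu : {finite_measure set RM -> \bar R}) (K : set R) :
  0 < M -> mu (~` `[- M, M]%classic) = 0%E -> closed K -> approximable mu (\1_K : RM -> R).
Proof.
move=> M0 ms cK; split; first by apply: ebd_indic; exact: closed_measurable.
move=> e e0; have [G [_ _ h]] := approx_closed M0 ms cK e0.
exists G; apply: le_trans h; rewrite le_eqVlt; apply/orP; left; apply/eqP.
by congr Rintegral; apply/funext => x; rewrite -sqrrN opprB.
Qed.

Lemma sqrt_scale (e a c : R) : 0 <= e -> a <= e ^+ 2 * c -> Num.sqrt a <= e * Num.sqrt c.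
Proof.
move=> e0 h; rewrite -{1}(ger0_norm e0) -sqrtr_sqr -sqrtrM ?sqr_ge0//.
exact: ler_wsqrtr.
Qed.

(** An inverse T for W is turned into [not_sigma_ac] for V. An ac vector of V charging the disc
    around z leads to K inside that disc; the transform v of its indicator satisfies |(H_W - z) v|
    <= eps |v|, whence |v| <= |v| / 2. *)
Theorem sigma_ac_right_limit (V W : nat -> R) (B : R) :
  (forall n, `|V n.+1| <= B) -> (forall n, `|W n.+1| <= B) ->
  approx_shift (sites V) (sites W) -> sigma_ac V `<=` sigma_ac W.
Proof.
move=> hV hW hVW z zV; rewrite /sigma_ac /ac_spectrum /spectrum_on /= => -[T [T1 T2 T3 [c hc]]].
(* The constant c is an arbitrary real, possibly not positive. *)
pose c' := Num.max c 1.
have c'0 : 0 < c' by rewrite lt_max ltr01 orbT.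
pose eps := (2 * c')^-1.
have eps0 : 0 < eps by rewrite invr_gt0 mulr_gt0.
apply: (not_sigma_ac hV eps0 _) zV => u nu hu hnu nul.
apply/eqP; apply/negP => /negP nI.
have B0 : 0 <= B by exact: le_trans (hV 0%N).
pose M := opbound B + 1.
have hM : opbound B < M by rewrite ltrDl.
have BM : B + 2 <= M by have := opbound_ge hV; rewrite /M; lra.
have [muV hmuV] := spectral_of_exists hV BM.
have [muW hmuW] := spectral_of_exists hW BM.
have [M0 msW _] := hmuW.
pose I0 := [set x : RM | (dist2 z).[x] < eps ^+ 2].
have mI0 : measurable I0.
  have md : measurable_fun setT (fun x : RM => (dist2 z).[x]) by exact: measurable_horner.
  have := md measurableT `]-oo, eps ^+ 2[%classic (measurable_itv _).
  by rewrite setTI; congr measurable; apply/seteqP; split => x /=; rewrite in_itv/=.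
pose A := I0 `&` `[- M, M]%classic.
have mA : measurable A by apply: measurableI => //; exact: measurable_itv.
have nA : nu A != 0%E.
  apply/eqP => A0; move/eqP: nI; apply.
  have ns := spectral_support hV hu hnu hM.
  have mC : measurable (~` `[- M, M]%classic : set RM) by apply: measurableC; exact: measurable_itv.
  apply: (@subset_measure0 _ _ _ nu I0 (A `|` ~` `[- M, M]%classic)) => //.
  - exact: measurableU.
  - by move=> x Ix; have [h|h] := pselect (`[- M, M]%classic x); [left|right].
  - exact: null_set_setU.
have [S [delta [mS SA d0 lS hS]]] := lower_density_set hV hM hmuV hu hnu nul mA (@subIsetr _ _ _) nA.
have SM : S `<=` `[- M, M]%classic by move=> x /SA[].
have [K [cK KS lK hK]] := upper_density_closed muW mS SM lS.
have mK : measurable (K : set RM) by exact: closed_measurable.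
have lK0 : (0 < leb K)%E by rewrite lt_neqAle eq_sym lK measure_ge0.
have muK : (0 < muW K)%E.
  by apply: (closed_gt0 hmuV hmuW hVW mS d0 hS cK KS _ lK0) => x /KS /SM.
pose g2 : RM -> R := fun x => (0 : {poly R}).[x].
have ap1 : approximable muW (\1_K : RM -> R) by exact: approximable_indic M0 msW cK.
have ap2 : approximable muW g2 by exact: (approximable_poly hmuW).
have b01 x : (\1_K x : R) ^+ 2 = \1_K x.
  by rewrite indicE; case: (_ \in _); rewrite ?expr1n ?expr0n.
have hd1 : bounded_density (fun x : RM => (\1_K x : R) ^+ 2 + g2 x ^+ 2) 1.
  split.
    have -> : (fun x : RM => (\1_K x : R) ^+ 2 + g2 x ^+ 2) = \1_K.
      by apply/funext => x; rewrite b01 /g2 horner0 expr0n addr0.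
    exact: measurable_indic.
  move=> x; rewrite b01 /g2 horner0 expr0n addr0 indicE.
  by case: (_ \in _); rewrite ?lexx ?ler01.
pose f1 : RM -> R := fun x => ('X - (complex.Re z)%:P).[x] * \1_K x.
pose f2 : RM -> R := fun x => (- complex.Im z)%:P.[x] * \1_K x.
have ap3 : approximable muW f1 by exact: (approximable_polyM hmuW).
have ap4 : approximable muW f2 by exact: (approximable_polyM hmuW).
have fE x : f1 x ^+ 2 + f2 x ^+ 2 = (dist2 z).[x] * \1_K x.
  by rewrite /f1 /f2 !exprMn b01 -mulrDl dist2E hornerXsubC hornerC sqrrN.
have d2 x : 0 <= (dist2 z).[x] by rewrite dist2E addr_ge0// sqr_ge0.
have hd2 : bounded_density (fun x : RM => f1 x ^+ 2 + f2 x ^+ 2) (eps ^+ 2).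
  split.
    have [h3 _] := ap3; have [h4 _] := ap4.
    by case: (ebdD (ebdX 2 h3) (ebdX 2 h4)).
  move=> x; rewrite fE indicE; have [/set_mem Kx|_] := boolP (x \in K).
    have [h _] : A x by exact/SA/KS.
    by rewrite mulr1 d2 /= ltW.
  by rewrite mulr0 lexx sqr_ge0.
pose v := U W muW (\1_K) g2.
have sv := U_spectral hW hmuW hd1 ap1 ap2.
have ss := U_spectral hW hmuW hd2 ap3 ap4.
have [lv nv] := U_nsq hmuW ap1 ap2.
have [ls ns] := U_nsq hmuW ap3 ap4.
have shv : shift_op (schrodinger W) z v = U W muW f1 f2 by exact: (shift_U_indic _ hW hmuW).
have Mv : ac_subspace (schrodinger W) v.
  split; [exact: lv|exists (dens muW hd1); split; first exact: sv].
  apply: (dens_dominated_on hd1 mK _ hK) => x nK.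
  by rewrite b01 /g2 horner0 expr0n addr0 indicE memNset.
have Ms : ac_subspace (schrodinger W) (U W muW f1 f2).
  split; [exact: ls|exists (dens muW hd2); split; first exact: ss].
  apply: (dens_dominated_on hd2 mK _ hK) => x nK.
  by rewrite fE indicE memNset// mulr0.
have hv := T2 v Mv; rewrite shv in hv.
have hn := hc _ Ms; rewrite hv !l2normE in hn.
have nvE : nsq v = fine (muW K).
  rewrite -Rint_indic// nv (_ : (fun x => g2 x ^+ 2) = fun=> 0); last first.
    by apply/funext => x; rewrite /g2 horner0 expr0n.
  by rewrite Rint_cst mul0r addr0; congr Rintegral; apply/funext => x; rewrite b01.
have nv0 : 0 < nsq v by rewrite nvE -lte_fin fineK ?fin_num_measure.
have nsE : nsq (U W muW f1 f2) <= eps ^+ 2 * nsq v.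
  have [h3 _] := ap3; have [h4 _] := ap4.
  rewrite ns -RintD; [|exact: ebdX|exact: ebdX].
  rewrite nvE -Rint_indic// -RintZ; last exact: ebd_indic.
  apply: Rint_le.
  - by apply: ebdD; exact: ebdX.
  - by apply: ebdZ; exact: ebd_indic.
  move=> x; rewrite fE indicE; have [/set_mem Kx|_] := boolP (x \in K).
    have [h _] : A x by exact/SA/KS.
    by rewrite !mulr1 ltW.
  by rewrite !mulr0.
have s1 : Num.sqrt (nsq (U W muW f1 f2)) <= eps * Num.sqrt (nsq v).
  by apply: sqrt_scale => //; exact: ltW.
have s2 : 0 < Num.sqrt (nsq v) by rewrite sqrtr_gt0.
have s3 : c * Num.sqrt (nsq (U W muW f1 f2)) <= c' * (eps * Num.sqrt (nsq v)).
  apply: (@le_trans _ _ (c' * Num.sqrt (nsq (U W muW f1 f2)))).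
    by rewrite ler_wpM2r ?sqrtr_ge0// le_max lexx.
  by rewrite ler_wpM2l// ltW.
have s4 : c' * (eps * Num.sqrt (nsq v)) = Num.sqrt (nsq v) / 2.
  by rewrite /eps; field; rewrite gt_eqF.
have s5 : Num.sqrt (nsq v) <= Num.sqrt (nsq v) / 2 by rewrite -s4; exact: le_trans hn s3.
by move: (Num.sqrt (nsq v)) s2 s5 => t; clear; lra.
Qed.

End RightLimit.

(** * Finite differences modulo 1 *)

Section FiniteDifferences.
Variable R : realType.
Implicit Types (f g h : nat -> R).

Definition fdelta f : nat -> R := fun n => f n.+1 - f n.
Definition fdiff k f : nat -> R := iter k fdelta f.

Lemma fdiffS k f n : fdiff k.+1 f n = fdiff k f n.+1 - fdiff k f n. Proof. by []. Qed.

Lemma newton f j n s : fdiff j f (n + s)%N = \sum_(l < s.+1) 'C(s, l)%:R * fdiff (j + l) f n.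
Proof.
elim: s j => [|s IH] j; first by rewrite addn0 big_ord_recl big_ord0 addn0 bin0 mul1r addr0.
have e : fdiff j f (n + s.+1) = fdiff j f (n + s) + fdiff j.+1 f (n + s).
  by rewrite fdiffS addnS addrC subrK.
rewrite e !IH [in RHS]big_ord_recl /= bin0 addn0.
rewrite [X in X + _]big_ord_recl /= bin0 addn0 -addrA; congr (_ + _).
rewrite [in RHS](eq_bigr (fun i : 'I_s.+1 =>
   'C(s, i.+1)%:R * fdiff (j + i.+1) f n + 'C(s, i)%:R * fdiff (j + i.+1) f n)); last first.
  by move=> i _; rewrite /bump /= add1n binS natrD mulrDl.
rewrite big_split /=; congr (_ + _).
  rewrite big_ord_recr /= bin_small// mul0r addr0.
  by apply: eq_bigr => i _; rewrite /bump /= add1n.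
by apply: eq_bigr => i _; rewrite addnS -addSn.
Qed.

Lemma fdiff_sum k m (c : 'I_m -> R) (F : nat -> nat -> R) n :
  fdiff k (fun x => \sum_(i < m) c i * F i x) n = \sum_(i < m) c i * fdiff k (F i) n.
Proof.
elim: k n => // k IH n; rewrite !fdiffS !IH -sumrB.
by apply: eq_bigr => i _; rewrite fdiffS mulrBr.
Qed.

Lemma fdiff_ext k f g n : (forall m, f m = g m) -> fdiff k f n = fdiff k g n.
Proof. by move=> h; congr fdiff; apply/funext. Qed.

Lemma fdiff_mono k j n : (j < k)%N -> fdiff k (fun x => x%:R ^+ j) n = 0.
Proof.
elim: k j n => // k IH j n jk; rewrite /fdiff iterSr -/(fdiff k _).
rewrite (@fdiff_ext _ _ (fun x : nat => \sum_(i < j) 'C(j, i)%:R * x%:R ^+ i)).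
  rewrite (fdiff_sum k (fun i : 'I_j => 'C(j, i)%:R) (fun i x => x%:R ^+ i)) big1// => i _; rewrite IH ?mulr0//.
  exact: leq_trans (ltn_ord i) _.
move=> m; rewrite /fdelta -addn1 natrD (addrC m%:R) exprDn big_ord_recr /= subnn expr1n mul1r binn mulr1n addrK.
by apply: eq_bigr => i _; rewrite expr1n mul1r mulr_natl.
Qed.

(* x lies in the interval [a, b] modulo 1. *)
Definition nearZ (x a b : R) := exists2 k : R, k \is a Num.int & a <= x - k <= b.

Lemma nearZ_eq x y a b : x - y \is a Num.int -> nearZ x a b -> nearZ y a b.
Proof.
move=> xy [k kZ h]; exists (k - (x - y)); first exact: rpredB.
by have -> : y - (k - (x - y)) = x - k by ring.
Qed.

Lemma nearZ_le x a b a' b' : a' <= a -> b <= b' -> nearZ x a b -> nearZ x a' b'.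
Proof. by move=> aa bb [k kZ /andP[h1 h2]]; exists k => //; apply/andP; split; lra. Qed.

Lemma nearZD x y a b a' b' :
  nearZ x a b -> nearZ y a' b' -> nearZ (x + y) (a + a') (b + b').
Proof.
move=> [k kZ /andP[h1 h2]] [l lZ /andP[h3 h4]]; exists (k + l); first exact: rpredD.
by apply/andP; split; lra.
Qed.

Lemma nearZM n x a b : nearZ x a b -> nearZ (n%:R * x) (n%:R * a) (n%:R * b).
Proof.
move=> [k kZ /andP[h1 h2]]; exists (n%:R * k); first by rewrite rpredM// natr_int.
by rewrite -mulrBr !ler_wpM2l.
Qed.

Lemma nearZ_sum m (c : nat -> nat) (x : nat -> R) e :
  (forall l, (l < m)%N -> nearZ (x l) (- e) e) ->
  nearZ (\sum_(l < m) (c l)%:R * x l) (- ((\sum_(l < m) c l)%:R * e)) ((\sum_(l < m) c l)%:R * e).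
Proof.
elim: m => [|m IH] h.
  by rewrite !big_ord0 mul0r oppr0; exists 0 => //; rewrite subr0 lexx.
rewrite !big_ord_recr /= natrD.
have h1 := IH (fun l lm => h l (ltnW lm)).
apply: nearZ_le (nearZD h1 (nearZM (c m) (h m (ltnSn m)))); lra.
Qed.

(** Subtracting integers lifts y to a real sequence z with steps in [lo, hi]. It reaches k + d / 2,
    where k is the integer in ]z 0, z 0 + 1], within T' steps because lo T' >= 2; the crossing step
    and the T following ones move it by at most hi (T + 1) <= d / 2. *)
Lemma circle_pass (y : nat -> R) T' T lo hi d :
  0 < lo -> 0 <= d <= 1 -> 2 <= lo * T'%:R -> hi * (T.+1)%:R <= d / 2 ->
  (forall t, (t < T' + T)%N -> nearZ (y t.+1 - y t) lo hi) ->
  exists2 t0, (t0 <= T')%N & forall t, (t <= T)%N -> nearZ (y (t0 + t)%N) (d / 2) d.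
Proof.
move=> lo0 /andP[d0 d1] hlo hhi hy.
have /choice[m hm] : forall t, exists m : R, (t < T' + T)%N ->
    m \is a Num.int /\ lo <= y t.+1 - y t - m <= hi.
  move=> t; case: (ltnP t (T' + T)) => [/hy[k kZ h]|_]; first by exists k.
  by exists 0.
pose z t := y t - \sum_(s < t) m s.
have zZ t : (t <= T' + T)%N -> z t - y t \is a Num.int.
  move=> tT; rewrite /z addrAC subrr add0r rpredN; apply: rpred_sum => i _.
  by case: (hm i (leq_trans (ltn_ord i) tT)).
have zS t : (t < T' + T)%N -> lo <= z t.+1 - z t <= hi.
  move=> /hm[_]; rewrite /z big_ord_recr /=.
  by have -> : y t.+1 - (\sum_(i < t) m i + m t) - (y t - \sum_(s < t) m s) = y t.+1 - y t - m t by ring.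
have zlo t : (t <= T' + T)%N -> z 0%N + lo * t%:R <= z t.
  elim: t => [|t IH] h; first by rewrite mulr0 addr0.
  have /andP[h1 _] := zS _ h; have := IH (ltnW h).
  by rewrite -natr1 mulrDr; lra.
have zinc t0 t : (t0 + t <= T' + T)%N -> z t0 <= z (t0 + t)%N <= z t0 + hi * t%:R.
  elim: t => [|t IH] h; first by rewrite addn0 mulr0 addr0 lexx.
  rewrite addnS in h *.
  have /andP[h1 h2] := zS _ h; have /andP[h3 h4] := IH (ltnW h).
  by rewrite -natr1 mulrDr; apply/andP; split; lra.
pose k : R := (Num.floor (z 0%N))%:~R + 1.
have kZ : k \is a Num.int by rewrite rpredD ?intr_int ?rpred1.
have k1 : z 0%N < k by rewrite /k -intrD1 floorD1_gt.
have k2 : k <= z 0%N + 1 by rewrite lerD2r floor_le.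
have ex : exists t, k + d / 2 <= z t.
  by exists T'; apply: le_trans (zlo T' (leq_addr _ _)); lra.
have t0P := ex_minnP ex; case: t0P => t0 h0 hmin.
have t0T : (t0 <= T')%N.
  by apply: hmin; apply: le_trans (zlo T' (leq_addr _ _)); lra.
exists t0 => // t tT.
have htT : (t0 + t <= T' + T)%N by exact: leq_add.
apply: (@nearZ_eq (z (t0 + t)%N)); first exact: zZ.
exists k => //.
have /andP[h1 h2] := zinc t0 t htT.
case: t0 h0 hmin t0T htT h1 h2 => [|t0] h0 hmin t0T htT h1 h2.
  by exfalso; lra.
have h3 : z t0 < k + d / 2.
  by rewrite ltNge; apply/negP => /hmin; rewrite ltnn.
have /andP[_ h4] := zS t0 (leq_trans t0T (leq_addr _ _)).
have hi0 : 0 <= hi by have := zS t0 (leq_trans t0T (leq_addr _ _)); lra.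
have h5 : hi * t%:R <= hi * T%:R by apply: ler_wpM2l => //; rewrite ler_nat.
move: hhi; rewrite -natr1 mulrDr mulr1 => hhi.
by apply/andP; split; lra.
Qed.

(** A discrete intermediate value argument: b + k lies in [x N, x N + 1[, and at the first index
    where it is reached the overshoot is at most one step. *)
Lemma slow_pass_up (x : nat -> R) N n1 e b :
  (forall n, (N <= n)%N -> `|x n.+1 - x n| <= e) -> (N <= n1)%N -> x N + 1 <= x n1 ->
  exists2 n, (N <= n)%N & nearZ (x n - b) (- e) e.
Proof.
move=> hx Nn1 h1.
have e0 : 0 <= e by apply: le_trans (hx N (leqnn _)).
pose k : R := (Num.ceil (x N - b))%:~R.
have kZ : k \is a Num.int by rewrite intr_int.
have k1 : x N - b <= k by exact: ceil_ge.
have k2 : k < x N - b + 1 by have := ceilB1_lt (x N - b); rewrite intrB /k; lra.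
have ex : exists n, (N <= n)%N && (b + k <= x n) by exists n1; rewrite Nn1 /=; lra.
have := ex_minnP ex; case=> n /andP[Nn hn] hmin.
exists n => //; exists k => //.
case: (ltnP N n) => [|nN]; last first.
  have nE : n = N by apply/eqP; rewrite eqn_leq Nn nN.
  by rewrite nE in hn *; apply/andP; split; lra.
case: n Nn hn hmin => // n _ hn hmin Nn.
have h3 : x n < b + k.
  rewrite ltNge; apply/negP => h; have := hmin n; rewrite h andbT -ltnS Nn ltnn.
  by move=> /(_ isT).
have := hx n Nn; rewrite ler_norml => /andP[h4 h5].
by apply/andP; split; lra.
Qed.

Lemma slow_pass (x : nat -> R) N e b :
  (forall n, (N <= n)%N -> `|x n.+1 - x n| <= e) ->
  (forall M : R, exists2 n, (N <= n)%N & M <= `|x n|) ->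
  exists2 n, (N <= n)%N & nearZ (x n - b) (- e) e.
Proof.
move=> hx hM; have [n Nn hn] := hM (`|x N| + 1).
have [h0|h0] := leP 0 (x n).
  apply: (slow_pass_up b hx Nn).
  by move: hn; rewrite (ger0_norm h0) => hn; have := ler_norm (x N); lra.
have [||m Nm [k kZ h]] := @slow_pass_up (fun n => - x n) N n e (- b) _ Nn.
- by move=> m Nm; rewrite -opprD normrN hx.
- move: hn; rewrite (ltr0_norm h0) => hn.
  by have := ler_norm (- x N); rewrite normrN; lra.
exists m => //; exists (- k); first by rewrite rpredN.
by move: h => /andP[h1 h2]; apply/andP; split; lra.
Qed.

(** From l C(n, l) = n C(n - 1, l - 1) with n = q r!: as l divides r!, the factor q remains after
    division by l. *)
Lemma dvd_bin q r l : (0 < l)%N -> (l <= r)%N -> (q %| 'C(q * r`!, l))%N.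
Proof.
case: l => // l _ lr; have := mul_bin_diag (q * r`!) l.
have /dvdnP[c hc] : (l.+1 %| r`!)%N by exact: dvdn_fact.
rewrite {1}hc mulnA [in LHS]mulnC mulnA mulnC => /eqP.
by rewrite eqn_pmul2l// => /eqP <-; rewrite dvdn_mull// dvdn_mulr.
Qed.

Definition evsmall f := forall e, 0 < e -> exists N, forall n, (N <= n)%N -> `|f n| <= e.

Lemma evsmall_fdiff f : evsmall f -> forall J e, 0 < e -> exists N, forall n s,
  (N <= n)%N -> (s <= J)%N -> `|fdiff s f n| <= e.
Proof.
move=> hf J e e0; have [N hN] := hf _ (divr_gt0 e0 (exprn_gt0 J (ltr0n R 2))).
exists N => n s Nn sJ.
have h : forall n, (N <= n)%N -> `|fdiff s f n| <= 2 ^+ s * (e / 2 ^+ J).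
  elim: s {sJ} => [|s IH] m Nm; first by rewrite expr0 mul1r hN.
  rewrite fdiffS (le_trans (ler_normB _ _))// exprS -mulrA.
  by have := IH _ Nm; have := IH _ (leqW Nm); lra.
apply: le_trans (h _ Nn) _; rewrite mulrCA ler_piMr ?(ltW e0)//.
by rewrite ler_pdivrMr ?exprn_gt0// mul1r ler_eXn2l// ltr1n.
Qed.

Lemma fdiffD j k f n : fdiff (j + k) f n = fdiff j (fdiff k f) n.
Proof. by rewrite /fdiff iterD. Qed.

Lemma small_scale (A e b : R) : 0 < A -> 0 < e -> 0 <= b ->
  exists c, [/\ 0 < c, c <= A & b * c <= e].
Proof.
move=> A0 e0 b0; exists (Num.min A (e / (b + 1))).
have b1 : 0 < b + 1 by lra.
split; first by rewrite lt_min A0 divr_gt0.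
  by rewrite ge_min lexx.
have h : Num.min A (e / (b + 1)) <= e / (b + 1) by rewrite ge_min lexx orbT.
apply: le_trans (ler_wpM2l b0 h) _.
by rewrite mulrCA ler_piMr ?(ltW e0)// ler_pdivrMr// mul1r; lra.
Qed.

(* e j are rational approximations of the targets; by eZ the steps of h i along
   progressions of difference Q involve, modulo 1, only the h j with j > i. *)
Section Orbit.
Variables (g : nat -> R) (r Q' : nat) (e : nat -> R).
Let Q := Q'.+1.
Hypothesis eZ : forall j l, (0 < l)%N -> (l <= Q)%N -> 'C(Q, l)%:R * e (j + l)%N \is a Num.int.
Hypothesis e0 : forall j, (r < j)%N -> e j = 0.
Hypothesis gsmall : evsmall (fdiff r.+1 g).
Hypothesis glarge : forall (M : R) N, exists2 n, (N <= n)%N & M <= `|fdiff r g n|.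

Let h j n := fdiff j g n - e j.

Let h_step i n : (h i (n + Q)%N - h i n) -
  (Q%:R * h i.+1 n + \sum_(l < Q') 'C(Q, l.+2)%:R * h (i + l.+2)%N n) \is a Num.int.
Proof.
have -> : h i (n + Q)%N - h i n = \sum_(l < Q) 'C(Q, l.+1)%:R * fdiff (i + l.+1) g n.
  rewrite /h newton big_ord_recl bin0 mul1r addn0.
  under eq_bigr => l _ do rewrite lift0.
  by ring.
have -> : Q%:R * h i.+1 n + \sum_(l < Q') 'C(Q, l.+2)%:R * h (i + l.+2)%N n =
    \sum_(l < Q) 'C(Q, l.+1)%:R * h (i + l.+1)%N n.
  rewrite [RHS]big_ord_recl bin1 addn1; congr (_ + _).
rewrite -sumrB; apply: rpred_sum => l _; rewrite -mulrBr /h opprB addrCA subrr addr0.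
exact: eZ.
Qed.

(** Induction on k = r - i. While level i + 1 stays in [d' / 2, d'] and the higher levels within
    kap', the steps of level i along the progression lie in [d' / 4, 2 Q d'] modulo 1 by [h_step],
    and [circle_pass] applies. *)
Lemma orbit_claim k i d kap T N : (i + k = r)%N -> 0 < d -> d <= 1 -> 0 < kap ->
  exists2 n, (N <= n)%N & forall t, (t <= T)%N ->
    nearZ (h i (n + Q * t)) (d / 2) d /\
    forall j, (i < j)%N -> (j <= r)%N -> nearZ (h j (n + Q * t)) (- kap) kap.
Proof.
elim: k i d kap T N => [|k IH] i d kap T N ikr d0 d1 kap0.
  have {}ikr : i = r by rewrite -ikr addn0.
  have [eta [eta0 etad hT]] : exists c, [/\ 0 < c, c <= d / 8 & (Q * T)%:R * c <= d / 8].
    by apply: small_scale; rewrite ?divr_gt0.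
  have [N1 hN1] := gsmall eta0.
  have hsl n : (maxn N N1 <= n)%N -> `|h r n.+1 - h r n| <= eta.
    rewrite geq_max => /andP[_ N1n].
    have -> : h r n.+1 - h r n = fdiff r.+1 g n by rewrite /h fdiffS; ring.
    exact: hN1.
  have hla M : exists2 n, (maxn N N1 <= n)%N & M <= `|h r n|.
    have [n Nn hn] := glarge (M + `|e r|) (maxn N N1); exists n => //.
    have := ler_normB (h r n) (- e r); rewrite normrN opprK subrK; lra.
  (* The centre of [d / 2, d]: the error on arrival and the drift during Q T steps cost at most d /
     8 each. *)
  have [n Nn hn] := slow_pass (3 * d / 4) hsl hla.
  move: (Nn); rewrite geq_max => /andP[Nn' N1n].
  exists n => // t tT; split; last by move=> j ij jr; move: ij; rewrite ikr ltnNge jr.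
  rewrite ikr.
  have hs s : `|h r (n + s)%N - h r n| <= s%:R * eta.
    elim: s => [|s IHs]; first by rewrite addn0 subrr normr0 mul0r.
    have -> : h r (n + s.+1)%N - h r n = (h r (n + s).+1 - h r (n + s)%N) + (h r (n + s)%N - h r n).
      by rewrite addnS; ring.
    rewrite (le_trans (ler_normD _ _))// -natr1 mulrDl mul1r.
    by have := hsl (n + s)%N (leq_trans Nn (leq_addr _ _)); lra.
  have h1 : `|h r (n + Q * t)%N - h r n| <= d / 8.
    apply: le_trans (hs _) _; apply: le_trans hT; rewrite ler_pM2r// ler_nat.
    by rewrite leq_mul2l tT orbT.
  move: h1; rewrite ler_norml => /andP[h1 h2].
  case: hn => m mZ /andP[h3 h4]; exists m => //; apply/andP; split; lra.
have ir : (i.+1 + k = r)%N by rewrite addSnnS.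
have Q1 : (1 : R) <= Q%:R by rewrite ler1n.
(* The choices are made in this order: d' from T, then kap' and T' from d', and the induction
   hypothesis is used for the duration T' + T. *)
have [d' [d'0 d'k hd']] : exists c, [/\ 0 < c, c <= Num.min 1 kap & (2 * Q%:R * T.+1%:R) * c <= d / 2].
  by apply: small_scale => //; rewrite ?lt_min ?kap0 ?divr_gt0 ?mulr_ge0 ?andbT ?ltr01.
move: d'k; rewrite le_min => /andP[d'1 d'k].
pose S := (\sum_(l < Q') 'C(Q, l.+2))%N.
have [kap' [kap'0 kap'k hS]] : exists c, [/\ 0 < c, c <= kap & S%:R * c <= d' / 4].
  by apply: small_scale; rewrite ?divr_gt0.
have [T' hT'] : exists T' : nat, 2 <= d' / 4 * T'%:R.
  exists (Num.truncn (2 / (d' / 4))).+1; rewrite mulrC -ler_pdivrMr ?divr_gt0//.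
  exact/ltW/truncnS_gt.
have [N1 hN1] := evsmall_fdiff gsmall Q kap'0.
have [n Nn hn] := IH i.+1 d' kap' (T' + T)%N (maxn N N1) ir d'0 d'1 kap'0.
move: Nn; rewrite geq_max => /andP[Nn N1n].
have [||||t0 t0T ht0] := @circle_pass (fun t => h i (n + Q * t)%N) T' T (d' / 4) (2 * Q%:R * d') d _ _ hT'.
- by rewrite divr_gt0.
- by rewrite (ltW d0).
- by rewrite mulrAC.
- move=> t tT; have [h1 h2] := hn t (ltnW tT).
  rewrite mulnS (addnC Q) addnA.
  have h3 : nearZ (\sum_(l < Q') 'C(Q, l.+2)%:R * h (i + l.+2)%N (n + Q * t)%N)
      (- (S%:R * kap')) (S%:R * kap').
    apply: (@nearZ_sum Q' (fun l => 'C(Q, l.+2)) (fun l => h (i + l.+2)%N (n + Q * t)%N)).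
    (* Levels above r have target 0 and are differences of the small sequence, so they are close to
       0 itself. *)
    move=> l lQ; case: (leqP (i + l.+2) r) => [lr|lr].
      by apply: h2 => //; rewrite addnS addnS !ltnS leq_addr.
    exists 0 => //; rewrite subr0 /h e0// subr0 -ler_norml.
    have -> : (i + l.+2 = (i + l.+2 - r.+1) + r.+1)%N by rewrite subnK.
    rewrite fdiffD; apply: hN1; first exact: leq_trans N1n (leq_addr _ _).
    by rewrite /Q; clear -lQ ikr; lia.
  have h4 := nearZD (nearZM Q h1) h3.
  apply: nearZ_eq; last apply: nearZ_le h4.
  + by rewrite -opprB rpredN; exact: h_step.
  + have : d' / 2 <= Q%:R * (d' / 2) by rewrite ler_peMl// divr_ge0// ltW.
    by lra.
  + have : d' <= Q%:R * d' by rewrite ler_peMl// ltW.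
    by lra.
exists (n + Q * t0)%N; first exact: leq_trans Nn (leq_addr _ _).
move=> t tT; rewrite -addnA -mulnDr; split; first exact: ht0.
have [h1 h2] := hn (t0 + t)%N (leq_add t0T tT).
move=> j; rewrite leq_eqVlt => /orP[/eqP<- _|ij jr].
  by apply: nearZ_le h1; lra.
by apply: nearZ_le (h2 j ij jr); lra.
Qed.

End Orbit.

Lemma sum_bin s : (\sum_(l < s.+1) 'C(s, l) = 2 ^ s)%N.
Proof. by rewrite (expnDn 1 1); apply: eq_bigr => i _; rewrite !exp1n !muln1. Qed.

(** Newton's formula at s has total weight 2^s, so it suffices that the differences of g at n match
    those of p at 0 within c modulo 1, where 2^J c <= eps. Half of c pays for rational targets, half
    for the orbit. *)
Lemma poly_orbit (g p : nat -> R) r : evsmall (fdiff r.+1 g) ->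
  (forall (M : R) N, exists2 n, (N <= n)%N & M <= `|fdiff r g n|) ->
  (forall l, (r < l)%N -> fdiff l p 0%N = 0) ->
  forall J eps, 0 < eps -> exists2 n, (0 < n)%N &
    forall s, (s <= J)%N -> nearZ (g (n + s)%N - p s) (- eps) eps.
Proof.
move=> gs gl pr J eps eps0.
have [c [c0 c1 hc]] : exists c, [/\ 0 < c, c <= 1 & (2 ^ J)%:R * c <= eps].
  exact: small_scale.
pose q := (Num.truncn (2 / c)).+1.
have q0 : (0 : R) < q%:R by rewrite ltr0n.
have hq : q%:R^-1 <= c / 2.
  by rewrite -[leRHS]invf_div lef_pV2 ?posrE ?divr_gt0//; exact/ltW/truncnS_gt.
(* Rounding down to multiples of 1 / q; with the step q r! this makes every product of a binomial
   and a target an integer. *)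
pose e l : R := if (l <= r)%N then (Num.floor (q%:R * fdiff l p 0%N))%:~R / q%:R else 0.
have he l : `|e l - fdiff l p 0%N| <= c / 2.
  rewrite /e; case: (leqP l r) => [lr|lr]; last by rewrite pr// subrr normr0 divr_ge0// ltW.
  apply: le_trans hq; set x := fdiff _ _ _.
  have -> : (Num.floor (q%:R * x))%:~R / q%:R - x = ((Num.floor (q%:R * x))%:~R - q%:R * x) / q%:R.
    by field; exact: lt0r_neq0.
  rewrite normrM (@ger0_norm _ q%:R^-1) ?invr_ge0 ?(ltW q0)// -[leRHS]mul1r ler_pM2r ?invr_gt0//.
  have := floor_le (q%:R * x); have := floorD1_gt (q%:R * x); rewrite intrD1.
  by rewrite ler_norml => h1 h2; apply/andP; split; lra.
pose Q' := (q * r`!).-1.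
have Q'E : Q'.+1 = (q * r`!)%N by rewrite prednK// muln_gt0 fact_gt0.
have eZ j l : (0 < l)%N -> (l <= Q'.+1)%N -> 'C(Q'.+1, l)%:R * e (j + l)%N \is a Num.int.
  move=> l0 _; rewrite /e; case: leqP => [jl|_]; last by rewrite mulr0.
  have /dvdnP[b ->] : (q %| 'C(Q'.+1, l))%N.
    by rewrite Q'E dvd_bin// (leq_trans _ jl)// leq_addl.
  set F := (Num.floor _)%:~R.
  have -> : (b * q)%:R * (F / q%:R) = b%:R * F by rewrite natrM; field; exact: lt0r_neq0.
  by rewrite rpredM ?natr_int ?intr_int.
have e0 j : (r < j)%N -> e j = 0 by move=> rj; rewrite /e leqNgt rj.
have c2 : 0 < c / 2 by lra.
have [N1 hN1] := evsmall_fdiff gs J c2.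
have c21 : c / 2 <= 1 by lra.
(* Duration 0 is enough at the lowest level; the long stays serve the induction. Beyond [maxn 1 N1]
   the index is positive and the differences above r are small. *)
have [n Nn /(_ 0%N isT)[h1 h2]] :=
  orbit_claim eZ e0 gs gl 0 (maxn 1 N1) (add0n r) c2 c21 c2.
move: Nn h1 h2; rewrite geq_max muln0 addn0 => /andP[n0 N1n] h1 h2.
exists n => // s sJ.
have -> : g (n + s)%N - p s = \sum_(l < s.+1) 'C(s, l)%:R * (fdiff l g n - fdiff l p 0%N).
  rewrite -[g _]/(fdiff 0 g _) newton -[p s]/(fdiff 0 p (0 + s)) newton -sumrB.
  by apply: eq_bigr => l _; rewrite mulrBr.
have h3 : nearZ (\sum_(l < s.+1) 'C(s, l)%:R * (fdiff l g n - fdiff l p 0%N))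
    (- ((\sum_(l < s.+1) 'C(s, l))%:R * c)) ((\sum_(l < s.+1) 'C(s, l))%:R * c).
  apply: (@nearZ_sum s.+1 (fun l => 'C(s, l)) (fun l => fdiff l g n - fdiff l p 0%N)) => l ls.
  have [lr|lr] := leqP l r; last first.
    exists 0 => //; rewrite pr// !subr0 -ler_norml.
    have -> : (l = (l - r.+1) + r.+1)%N by rewrite subnK.
    by rewrite fdiffD (le_trans (hN1 _ _ N1n _)) ?ler_pdivrMr//; [clear -lr ls sJ; lia|lra].
  have h4 : nearZ (fdiff l g n - e l) (- (c / 2)) (c / 2).
    by case: (posnP l) => [->|l0]; [apply: nearZ_le h1; lra|exact: h2].
  case: h4 => k kZ /andP[h4 h5]; exists k => //.
  by have := he l; rewrite ler_norml => /andP[h6 h7]; apply/andP; split; lra.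
rewrite sum_bin in h3.
have h4 : (2 ^ s)%:R * c <= eps.
  by apply: le_trans hc; rewrite ler_pM2r// ler_nat leq_pexp2l.
by apply: nearZ_le h3 => //; rewrite lerN2.
Qed.

(** * Finite differences of powers *)

Section PowerDifferences.
Definition rdelta (F : R -> R) : R -> R := fun x => F (x + 1) - F x.

Lemma is_derive_rdelta k a (x : R) : 0 < x ->
  is_derive x 1 (iter k rdelta (fun y => y `^ a))
    (a * iter k rdelta (fun y => y `^ (a - 1)) x).
Proof.
elim: k x => [|k IH] x x0 /=; first exact: is_derive1_powR.
have h1 := IH x x0.
have x1 : 0 < x + 1 by lra.
have h2 := IH _ x1.
have h3 : is_derive x 1 (fun y : R => y + 1) 1.
  by apply: is_derive_eq; rewrite addr0.
have h4 := @is_derive1_comp R _ (fun y : R => y + 1) x _ _ h2 h3.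
have := is_deriveB h4 h1; rewrite mulr1 -mulrBr; exact.
Qed.

(** The mean value theorem once per difference: each use brings out a factor and lowers the exponent
    by 1, and differences commute with the derivative. *)
Lemma rdelta_powR k a (x : R) : 0 < x -> exists2 y, x <= y &
  iter k rdelta (fun y => y `^ a) x = (\prod_(i < k) (a - i%:R)) * y `^ (a - k%:R).
Proof.
elim: k a x => [|k IH] a x x0.
  by exists x => //; rewrite big_ord0 mul1r subr0.
have xx1 : x < x + 1 by lra.
have [||y hy hE] := @MVT _ (iter k rdelta (fun y => y `^ a))
   (fun y => a * iter k rdelta (fun y => y `^ (a - 1)) y) _ _ xx1.
- by move=> z; rewrite in_itv /= => /andP[xz _]; apply: is_derive_rdelta; lra.
- apply: derivable_within_continuous => z; rewrite in_itv /= => /andP[xz _].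
  have z0 : 0 < z by lra.
  by have [] := is_derive_rdelta k a z0.
have y0 : x < y by move: hy; rewrite in_itv /= => /andP[].
have [z yz hz] := IH (a - 1) y ltac:(lra).
exists z; first by lra.
rewrite iterS {1}/rdelta hE hz.
rewrite big_ord_recl subr0 (addrC x) addrK mulr1 -natr1 -mulrA.
congr (_ * _); congr (_ * _); last by congr (_ `^ _); ring.
by apply: eq_bigr => i _; rewrite lift0 -natr1; ring.
Qed.

Lemma fdiff_rdelta k (F : R -> R) n : fdiff k (fun n => F n%:R) n = iter k rdelta F n%:R.
Proof. by elim: k n => // k IH n; rewrite fdiffS !IH /= /rdelta natr1. Qed.

Lemma fdiff_affine k f a b n :
  fdiff k (fun n => a * f n + b) n = a * fdiff k f n + (k == 0%N)%:R * b.
Proof.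
elim: k n => [|k IH] n; first by rewrite mul1r.
by rewrite !fdiffS !IH mul0r addr0 mulrBr; ring.
Qed.

Lemma powR_large (s M : R) : 0 < s -> exists N : nat, forall x : R, N%:R <= x -> M <= x `^ s.
Proof.
move=> s0; exists (Num.truncn ((`|M|) `^ s^-1)).+1 => x Nx.
apply: le_trans (ler_norm M) _.
have -> : `|M| = (`|M| `^ s^-1) `^ s by rewrite -powRrM mulVf ?lt0r_neq0// powRr1.
have h : `|M| `^ s^-1 <= x by apply: le_trans Nx; exact/ltW/truncnS_gt.
have h0 := powR_ge0 `|M| s^-1.
by apply: ge0_ler_powR => //; rewrite ?nnegrE ?(ltW s0)//; exact: le_trans h.
Qed.

Lemma evsmall_powR (r : nat) (rho alpha theta : R) : rho < r%:R + 1 ->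
  evsmall (fdiff r.+1 (fun n => alpha * n%:R `^ rho + theta)).
Proof.
move=> hr e e0.
pose c := \prod_(i < r.+1) (rho - i%:R).
have [N hN] := @powR_large (r%:R + 1 - rho) ((`|alpha * c| + 1) / e) ltac:(lra).
exists N.+1 => n Nn.
have n0 : (0 : R) < n%:R by rewrite ltr0n; exact: leq_trans Nn.
rewrite fdiff_affine mul0r addr0 (fdiff_rdelta _ (fun x => x `^ rho)).
have [y ny ->] := rdelta_powR r.+1 rho n0.
rewrite -/c mulrA normrM.
have -> : rho - r.+1%:R = - (r%:R + 1 - rho) by rewrite -natr1; ring.
rewrite powRN (@ger0_norm _ (_ ^-1)) ?invr_ge0 ?powR_ge0//.
have hy : (`|alpha * c| + 1) / e <= y `^ (r%:R + 1 - rho).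
  by apply: hN; apply: le_trans ny; rewrite ler_nat ltnW.
have c0 : 0 < `|alpha * c| + 1 by have := normr_ge0 (alpha * c); lra.
have p0 := lt_le_trans (divr_gt0 c0 e0) hy.
rewrite ler_pdivrMr//; move: hy; rewrite ler_pdivrMr// mulrC; lra.
Qed.

(** The factors rho - i with i < r are positive because r < rho, so the leading coefficient does not
    vanish. The constant theta survives the differences only when r = 0. *)
Lemma large_powR (r : nat) (rho alpha theta : R) : r%:R < rho -> alpha != 0 ->
  forall (M : R) N, exists2 n, (N <= n)%N &
    M <= `|fdiff r (fun n => alpha * n%:R `^ rho + theta) n|.
Proof.
move=> hr a0 M N.
pose c := \prod_(i < r) (rho - i%:R).
have c0 : 0 < c.
  apply: prodr_gt0 => i _; rewrite subr_gt0 (le_lt_trans _ hr)// ler_nat.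
  exact/ltnW.
have ac0 : 0 < `|alpha| * c by rewrite mulr_gt0 ?normr_gt0.
have [N1 hN] := @powR_large (rho - r%:R) ((M + `|theta|) / (`|alpha| * c)) ltac:(lra).
exists (maxn N N1).+1; first exact/leqW/leq_maxl.
rewrite fdiff_affine (fdiff_rdelta _ (fun x => x `^ rho)).
have [//|y ny ->] := @rdelta_powR r rho (maxn N N1).+1%:R _.
have hy : (M + `|theta|) / (`|alpha| * c) <= y `^ (rho - r%:R).
  by apply: hN; apply: le_trans ny; rewrite ler_nat; exact/leqW/leq_maxr.
move: hy; rewrite ler_pdivrMr// => hy.
rewrite -/c; set u := alpha * _; set v := _ * theta.
have hu : `|u| = y `^ (rho - r%:R) * (`|alpha| * c).
  by rewrite /u !normrM (ger0_norm (powR_ge0 _ _)) (gtr0_norm c0); ring.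
have hv : `|v| <= `|theta|.
  by rewrite /v normrM ler_piMl// normr_nat; case: (r == 0%N).
have := ler_normB (u + v) v; rewrite addrK; lra.
Qed.

End PowerDifferences.

End FiniteDifferences.

(** * Functions on the circle and the conclusion *)

Section Main.
Variable R : realType.

Lemma to_circle_eq (x y : R) : x - y \is a Num.int -> to_circle x = to_circle y.
Proof. by move=> xy; apply/eqquotP; rewrite /= /eq_mod1. Qed.

Lemma continuous_to_circle : continuous (@to_circle R).
Proof. exact: pi_continuous. Qed.

Lemma continuous_comp_circle (f : circle R -> R) : continuous f -> continuous (fun x => f (to_circle x)).
Proof. by move=> hf x; apply: (@continuous_comp _ _ _ (@to_circle R) f); [exact: continuous_to_circle|exact: hf]. Qed.

Lemma circle_bounded (f : circle R -> R) : continuous f -> exists B, forall t, `|f (to_circle t)| <= B.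
Proof.
move=> /continuous_comp_circle hf.
have hc : {within `[0, 1], continuous (fun x => `|f (to_circle x)|)}.
  apply: continuous_subspaceT => x.
  by apply: continuous_comp (hf x) _; exact: norm_continuous.
have [c _ hB] := EVT_max ler01 hc.
exists (`|f (to_circle c)|) => t.
have -> : to_circle t = to_circle (t - (Num.floor t)%:~R).
  by apply: to_circle_eq; rewrite opprB addrC subrK intr_int.
apply: hB; rewrite in_itv /= subr_ge0 floor_le /=.
by have := floorD1_gt t; rewrite intrD1; lra.
Qed.

Lemma circle_near (F : R -> R) (p : nat -> R) J e : continuous F -> 0 < e ->
  exists2 d, 0 < d & forall s x, (s <= J)%N -> `|x - p s| <= d -> `|F x - F (p s)| <= e.
Proof.
move=> hF e0; have near1 s : exists2 d, 0 < d & forall x, `|x - p s| <= d -> `|F x - F (p s)| <= e.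
  have := hF (p s) => /cvgrPdist_le/(_ e e0) /nbhs_ballP[d /= d0 hd].
  exists (d / 2); first by rewrite divr_gt0.
  move=> x xd; rewrite distrC; apply: hd; rewrite -ball_normE /ball_ /= distrC.
  by apply: le_lt_trans xd _; rewrite ltr_pdivrMr// ltr_pMr// ltr1n.
elim: J => [|J [d d0 IH]].
  have [d d0 hd] := near1 0%N; exists d => // s x; rewrite leqn0 => /eqP->; exact: hd.
have [d' d'0 hd'] := near1 J.+1.
exists (Num.min d d'); first by rewrite lt_min d0.
move=> s x; rewrite le_min leq_eqVlt ltnS => /orP[/eqP->|sJ] /andP[h1 h2]; first exact: hd'.
exact: IH.
Qed.
End Main.

Theorem theorem1p3 (R : realType) (r : nat) (rho : R)
    (hr : r%:R < rho) (hr1 : rho < r%:R + 1)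
    (f : circle R -> R) (hf : continuous f)
    (alpha theta : R) (halpha : alpha != 0) :
  sigma_ac (fun n : nat => f (to_circle (alpha * n%:R `^ rho + theta)))
    `<=` B_set r f.
Proof.
move=> z hz a _; have [B hB] := circle_bounded hf.
apply: (@sigma_ac_right_limit _ _ _ B) hz => // N e e0.
pose p (n : nat) := \sum_(j < r.+1) a j * n%:R ^+ j.
pose F x := f (to_circle x).
have [d d0 hd] := circle_near p N (continuous_comp_circle hf) e0.
have pr l : (r < l)%N -> fdiff l p 0%N = 0.
  move=> rl; rewrite (fdiff_sum l a (fun j n => n%:R ^+ j)) big1// => j _.
  by rewrite fdiff_mono ?mulr0//; apply: leq_trans rl.
(* A positive index has the form m.+1 used in [approx_shift]. Index j of the sites is n = j + 1, so
   the window is needed up to s = N. *)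
have [[//|m] _ hm] := poly_orbit (evsmall_powR alpha theta hr1) (large_powR theta hr halpha) pr N d0.
exists m => j jN; have [k kZ hk] := hm _ jN; rewrite -addnS.
set x := alpha * _ + _ in hk *.
rewrite -/(p j.+1) (@to_circle_eq _ x (x - k)); last by rewrite opprB addrC subrK.
by apply: hd => //; rewrite ler_norml addrAC.
Qed.
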